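(* Let $0<p,q<1$, $|\mu|<1$ and $c>0$. Then $C(S^2_{pq\phi})$ is isomorphic, as a $C^*$-algebra, to the $C^*$-algebra $C(S^2_{\mu c})$ of the Podleś sphere.
   Context: $P(S^2_{pq\phi})$ is the unital $*$-algebra generated by $f_1,f_{-1},f_0$ with $f_0^*=f_0$, $f_1^*=f_{-1}$ and relations $f_{-1}f_1-qf_1f_{-1}=(p-q)f_0+(1-p)1$, $f_0f_1-pf_1f_0=(1-p)f_1$, $f_{-1}f_0-pf_0f_{-1}=(1-p)f_{-1}$, $(1-f_0)(f_1f_{-1}-f_0)=0$. For $a\in P(S^2_{pq\phi})$ let $\|a\|=\sup_\rho\|\rho(a)\|$, the supremum over all (unital) $*$-representations $\rho$ of $P(S^2_{pq\phi})$ by bounded operators on Hilbert spaces; this is finite and is a $C^*$-norm. $C(S^2_{pq\phi})$ is the completion of $P(S^2_{pq\phi})$ in this norm. $C(S^2_{\mu c})$ is the universal unital $C^*$-algebra generated by $A,B$ with relations $A=A^*$, $BA=\mu^2AB$, $B^*B=A-A^2+c1$, $BB^*=\mu^2A-\mu^4A^2+c1$. *)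

(* Defs.v *)
From HB Require Import structures.
From mathcomp Require Import all_boot all_order all_algebra sesquilinear.
From mathcomp Require Import all_classical all_reals all_analysis.
From mathcomp Require Import complex ring.
Set Implicit Arguments.
Unset Strict Implicit.
Unset Printing Implicit Defensive.
Import Order.TTheory GRing.Theory Num.Theory.
Import numFieldNormedType.Exports.
Import Num.Def.
Local Open Scope classical_set_scope.
Local Open Scope ring_scope.
Local Open Scope quotient_scope.

(* Structures over a numClosedFieldType C are only used with C := R[i],
   R : realType. *)

HB.mixin Record isStarAlgebra (C : numClosedFieldType) A
    of GRing.Algebra C A := {
  star : A -> A;
  starK : involutive star;
  starD : {morph star : x y / x + y};
  starM : forall x y, star (x * y) = star y * star x;
  starZ : forall (k : C) x, star (k *: x) = k^* *: star x }.

#[short(type="starAlgType")]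
HB.structure Definition StarAlgebra (C : numClosedFieldType) :=
  {A of GRing.Algebra C A & isStarAlgebra C A}.

(* Hierarchy-Builder rejects a join of a ring and a normed module that is not a
   numDomainType, so the norm is given here, with values in R. Its
   nonnegativity follows from the triangle inequality and homogeneity. *)
HB.mixin Record isCStarAlgebra (R : realType) A of StarAlgebra R[i] A := {
  cnorm : A -> R;
  cnorm0_eq0 : forall x, cnorm x = 0 -> x = 0;
  cnormD : forall x y, cnorm (x + y) <= cnorm x + cnorm y;
  cnormZ : forall (k : R[i]) x, cnorm (k *: x) = complex.Re `|k| * cnorm x;
  cnormM : forall x y, cnorm (x * y) <= cnorm x * cnorm y;
  cnorm_star : forall x, cnorm (star x * x) = cnorm x ^+ 2;
  cnorm_complete : forall u : nat -> A,
    (forall e, 0 < e -> exists N : nat, forall m n : nat,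
       (N <= m)%N -> (N <= n)%N -> cnorm (u m - u n) < e) ->
    exists l, forall e, 0 < e -> exists N : nat, forall n : nat,
       (N <= n)%N -> cnorm (u n - l) < e }.

#[short(type="cstarAlgType")]
HB.structure Definition CStarAlgebra (R : realType) :=
  {A of StarAlgebra R[i] A & isCStarAlgebra R A}.

HB.mixin Record isHilbert (C : numClosedFieldType) H
    of CompleteNormedModule C H := {
  inner : {dot H for (@conjC C)};
  inner_norm : forall x : H, `|x| ^+ 2 = inner x x }.

#[short(type="hilbertType")]
HB.structure Definition Hilbert (C : numClosedFieldType) :=
  {H of CompleteNormedModule C H & isHilbert C H}.

Definition star_morphism (C : numClosedFieldType) (A B : starAlgType C)
    (f : A -> B) : Prop :=
  forall x, f (star x) = star (f x).

Definition cstar_isomorphic (R : realType) (A B : cstarAlgType R)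
    : Prop :=
  exists f : {lrmorphism A -> B}, star_morphism f /\ bijective f.

Definition bounded_operator (C : numClosedFieldType) (H : hilbertType C)
    (T : H -> H) : Prop :=
  linear T /\ exists M : C, forall x, `|T x| <= M * `|x|.

(* The norm of a normed module over R[i] takes values in the nonnegative reals of R[i], hence Re. *)
Definition op_norm (R : realType) (H : hilbertType R[i]) (T : H -> H)
    : \bar R :=
  ereal_sup [set (complex.Re `|T x|)%:E | x in [set x : H | `|x| <= 1]].

Record star_representation (C : numClosedFieldType) (P : starAlgType C)
    (H : hilbertType C) (rho : P -> H -> H) : Prop := StarRepresentation {
  rep_bounded : forall a, bounded_operator (rho a);
  rep_linear : forall (k : C) a b x,
    rho (k *: a + b) x = k *: rho a x + rho b x;
  rep_one : forall x, rho 1 x = x;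
  rep_mul : forall a b x, rho (a * b) x = rho a (rho b x);
  rep_star : forall a x y, inner (rho a x) y = inner x (rho (star a) y) }.

Definition rep_norm (R : realType) (P : starAlgType R[i]) (a : P) : \bar R :=
  ereal_sup [set y | exists (H : hilbertType R[i]) (rho : P -> H -> H),
    star_representation rho /\ y = op_norm (rho a)].

(* X, with the canonical map iota, is the completion of P for rep_norm. The
   equality in \bar R also records that rep_norm is finite. *)
Record cstar_completion (R : realType) (P : starAlgType R[i])
    (X : cstarAlgType R) (iota : {lrmorphism P -> X}) : Prop :=
  CStarCompletion {
  completion_star : star_morphism iota;
  completion_norm : forall a, (cnorm (iota a))%:E = rep_norm a;
  completion_dense : forall x (e : R), 0 < e ->
    exists a, cnorm (x - iota a) < e }.

Section Presentation.
Variables (C : numClosedFieldType) (G : Type).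

Inductive star_term : Type :=
  | TGen of G
  | TZero
  | TOne
  | TAdd of star_term & star_term
  | TMul of star_term & star_term
  | TScale of C & star_term
  | TStar of star_term.

Variable rel : star_term -> star_term -> Prop.

Reserved Notation "t ~~ u" (at level 70).
Inductive star_cong : star_term -> star_term -> Prop :=
  | SC_rel t u : rel t u -> t ~~ u
  | SC_refl t : t ~~ t
  | SC_sym t u : t ~~ u -> u ~~ t
  | SC_trans t u v : t ~~ u -> u ~~ v -> t ~~ v
  | SC_add t t' u u' : t ~~ t' -> u ~~ u' -> TAdd t u ~~ TAdd t' u'
  | SC_mul t t' u u' : t ~~ t' -> u ~~ u' -> TMul t u ~~ TMul t' u'
  | SC_scale k t t' : t ~~ t' -> TScale k t ~~ TScale k t'
  | SC_star t t' : t ~~ t' -> TStar t ~~ TStar t'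
  | SC_addA t u v : TAdd t (TAdd u v) ~~ TAdd (TAdd t u) v
  | SC_addC t u : TAdd t u ~~ TAdd u t
  | SC_add0 t : TAdd TZero t ~~ t
  | SC_addN t : TAdd (TScale (-1) t) t ~~ TZero
  | SC_mulA t u v : TMul t (TMul u v) ~~ TMul (TMul t u) v
  | SC_mul1l t : TMul TOne t ~~ t
  | SC_mul1r t : TMul t TOne ~~ t
  | SC_mulDl t u v : TMul (TAdd t u) v ~~ TAdd (TMul t v) (TMul u v)
  | SC_mulDr t u v : TMul t (TAdd u v) ~~ TAdd (TMul t u) (TMul t v)
  | SC_scaleA k l t : TScale k (TScale l t) ~~ TScale (k * l) t
  | SC_scale1 t : TScale 1 t ~~ t
  | SC_scaleDr k t u : TScale k (TAdd t u) ~~ TAdd (TScale k t) (TScale k u)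
  | SC_scaleDl k l t : TScale (k + l) t ~~ TAdd (TScale k t) (TScale l t)
  | SC_scaleAl k t u : TScale k (TMul t u) ~~ TMul (TScale k t) u
  | SC_scaleAr k t u : TScale k (TMul t u) ~~ TMul t (TScale k u)
  | SC_starK t : TStar (TStar t) ~~ t
  | SC_starD t u : TStar (TAdd t u) ~~ TAdd (TStar t) (TStar u)
  | SC_starM t u : TStar (TMul t u) ~~ TMul (TStar u) (TStar t)
  | SC_starZ k t : TStar (TScale k t) ~~ TScale k^* (TStar t)
where "t ~~ u" := (star_cong t u).

HB.instance Definition _ := gen_eqMixin star_term.
HB.instance Definition _ := gen_choiceMixin star_term.

Definition star_congb (t u : star_term) : bool := `[< star_cong t u >].

Lemma star_congb_refl : reflexive star_congb.
Proof. by move=> t; apply/asboolP; exact: SC_refl. Qed.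

Lemma star_congb_sym : symmetric star_congb.
Proof. by move=> t u; apply/asboolP/asboolP; exact: SC_sym. Qed.

Lemma star_congb_trans : transitive star_congb.
Proof.
by move=> u t v /asboolP tu /asboolP uv; apply/asboolP; exact: SC_trans tu uv.
Qed.

Canonical star_congb_equiv :=
  EquivRel star_congb star_congb_refl star_congb_sym star_congb_trans.

(* The unital star-algebra presented by the generators G and the relations
   rel. MathComp algebras are nontrivial, hence the argument nt, which is not
   used in the carrier. *)
Definition star_pres (nt : ~ star_cong TOne TZero) : Type :=
  {eq_quot star_congb}.

Variable nt : ~ star_cong TOne TZero.
Local Notation P := (star_pres nt).

HB.instance Definition _ := Choice.on P.
HB.instance Definition _ := EqQuotient.on P.

Definition pres_class (t : star_term) : P := \pi_P t.

Lemma pres_classP t u : pres_class t = pres_class u <-> star_cong t u.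
Proof. by split=> [/eqmodP/asboolP|tu] //; apply/eqmodP/asboolP. Qed.

Lemma pres_reprP t : star_cong (repr (pres_class t)) t.
Proof. by apply/pres_classP; rewrite /pres_class reprK. Qed.

Lemma pres_ind (Q : P -> Prop) : (forall t, Q (pres_class t)) -> forall a, Q a.
Proof. by move=> Qt a; rewrite -[a]reprK; exact: Qt. Qed.

Definition pres_add (a b : P) := pres_class (TAdd (repr a) (repr b)).
Definition pres_mul (a b : P) := pres_class (TMul (repr a) (repr b)).
Definition pres_scale k (a : P) := pres_class (TScale k (repr a)).
Definition pres_star (a : P) := pres_class (TStar (repr a)).

Lemma pres_addE t u :
  pres_add (pres_class t) (pres_class u) = pres_class (TAdd t u).
Proof. by apply/pres_classP; apply: SC_add; exact: pres_reprP. Qed.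

Lemma pres_mulE t u :
  pres_mul (pres_class t) (pres_class u) = pres_class (TMul t u).
Proof. by apply/pres_classP; apply: SC_mul; exact: pres_reprP. Qed.

Lemma pres_scaleE k t :
  pres_scale k (pres_class t) = pres_class (TScale k t).
Proof. by apply/pres_classP; apply: SC_scale; exact: pres_reprP. Qed.

Lemma pres_starE t : pres_star (pres_class t) = pres_class (TStar t).
Proof. by apply/pres_classP; apply: SC_star; exact: pres_reprP. Qed.

Definition presE := (pres_addE, pres_mulE, pres_scaleE, pres_starE).

Lemma pres_addA : associative pres_add.
Proof. by do 3!elim/pres_ind=> ?; rewrite !presE; apply/pres_classP/SC_addA. Qed.

Lemma pres_addC : commutative pres_add.
Proof. by do 2!elim/pres_ind=> ?; rewrite !presE; apply/pres_classP/SC_addC. Qed.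

Lemma pres_add0 : left_id (pres_class TZero) pres_add.
Proof. by elim/pres_ind=> ?; rewrite !presE; apply/pres_classP/SC_add0. Qed.

Lemma pres_addN : left_inverse (pres_class TZero) (pres_scale (-1)) pres_add.
Proof. by elim/pres_ind=> ?; rewrite !presE; apply/pres_classP/SC_addN. Qed.

HB.instance Definition _ :=
  GRing.isZmodule.Build P pres_addA pres_addC pres_add0 pres_addN.

Lemma pres_mulA : associative pres_mul.
Proof. by do 3!elim/pres_ind=> ?; rewrite !presE; apply/pres_classP/SC_mulA. Qed.

Lemma pres_mul1l : left_id (pres_class TOne) pres_mul.
Proof. by elim/pres_ind=> ?; rewrite !presE; apply/pres_classP/SC_mul1l. Qed.

Lemma pres_mul1r : right_id (pres_class TOne) pres_mul.
Proof. by elim/pres_ind=> ?; rewrite !presE; apply/pres_classP/SC_mul1r. Qed.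

Lemma pres_mulDl : left_distributive pres_mul pres_add.
Proof. by do 3!elim/pres_ind=> ?; rewrite !presE; apply/pres_classP/SC_mulDl. Qed.

Lemma pres_mulDr : right_distributive pres_mul pres_add.
Proof. by do 3!elim/pres_ind=> ?; rewrite !presE; apply/pres_classP/SC_mulDr. Qed.

Lemma pres_1_neq0 : pres_class TOne != pres_class TZero.
Proof. by apply/eqP => /pres_classP. Qed.

HB.instance Definition _ := GRing.Zmodule_isNzRing.Build P
  pres_mulA pres_mul1l pres_mul1r pres_mulDl pres_mulDr pres_1_neq0.

Lemma pres_scaleA k l a : pres_scale k (pres_scale l a) = pres_scale (k * l) a.
Proof. by elim/pres_ind: a => ?; rewrite !presE; apply/pres_classP/SC_scaleA. Qed.

Lemma pres_scale1 : left_id 1 pres_scale.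
Proof. by elim/pres_ind=> ?; rewrite !presE; apply/pres_classP/SC_scale1. Qed.

Lemma pres_scaleDr : right_distributive pres_scale pres_add.
Proof.
by move=> k; do 2!elim/pres_ind=> ?; rewrite !presE; apply/pres_classP/SC_scaleDr.
Qed.

Lemma pres_scaleDl (a : P) : {morph pres_scale^~ a : k l / k + l}.
Proof.
by elim/pres_ind: a => ? k l; rewrite -[RHS]/(pres_add _ _) !presE;
apply/pres_classP/SC_scaleDl.
Qed.

HB.instance Definition _ := GRing.Zmodule_isLmodule.Build C P
  pres_scaleA pres_scale1 pres_scaleDr pres_scaleDl.

Lemma pres_scaleAl k (a b : P) : k *: (a * b) = k *: a * b.
Proof.
elim/pres_ind: a => ?; elim/pres_ind: b => ?.
by rewrite /GRing.scale /GRing.mul /= !presE; apply/pres_classP/SC_scaleAl.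
Qed.

HB.instance Definition _ := GRing.Lmodule_isLalgebra.Build C P pres_scaleAl.

Lemma pres_scaleAr k (a b : P) : k *: (a * b) = a * (k *: b).
Proof.
elim/pres_ind: a => ?; elim/pres_ind: b => ?.
by rewrite /GRing.scale /GRing.mul /= !presE; apply/pres_classP/SC_scaleAr.
Qed.

HB.instance Definition _ := GRing.Lalgebra_isAlgebra.Build C P pres_scaleAr.

Lemma pres_starK : involutive pres_star.
Proof. by elim/pres_ind=> ?; rewrite !presE; apply/pres_classP/SC_starK. Qed.

Lemma pres_starD : {morph pres_star : a b / a + b}.
Proof.
by do 2!elim/pres_ind=> ?; rewrite /GRing.add /= !presE; apply/pres_classP/SC_starD.
Qed.

Lemma pres_starM (a b : P) : pres_star (a * b) = pres_star b * pres_star a.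
Proof.
elim/pres_ind: a => ?; elim/pres_ind: b => ?.
by rewrite /GRing.mul /= !presE; apply/pres_classP/SC_starM.
Qed.

Lemma pres_starZ k (a : P) : pres_star (k *: a) = k^* *: pres_star a.
Proof.
elim/pres_ind: a => ?.
by rewrite /GRing.scale /= !presE; apply/pres_classP/SC_starZ.
Qed.

HB.instance Definition _ := isStarAlgebra.Build C P
  pres_starK pres_starD pres_starM pres_starZ.

(* A character of the presentation, used to show that it is nontrivial. *)
Fixpoint term_eval (v : G -> C) (t : star_term) : C :=
  match t with
  | TGen g => v g
  | TZero => 0
  | TOne => 1
  | TAdd t u => term_eval v t + term_eval v u
  | TMul t u => term_eval v t * term_eval v u
  | TScale k t => k * term_eval v t
  | TStar t => (term_eval v t)^*
  end.

Lemma term_eval_cong (v : G -> C) :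
  (forall t u, rel t u -> term_eval v t = term_eval v u) ->
  forall t u, star_cong t u -> term_eval v t = term_eval v u.
Proof.
move=> vrel t u; elim=> //=.
- by move=> {}t {}u w _ -> _ ->.
- by move=> {}t t' {}u u' _ -> _ ->.
- by move=> {}t t' {}u u' _ -> _ ->.
- by move=> k {}t t' _ ->.
- by move=> {}t t' _ ->.
- by move=> *; rewrite addrA.
- by move=> *; rewrite addrC.
- by move=> *; rewrite add0r.
- by move=> *; rewrite mulN1r addNr.
- by move=> *; rewrite mulrA.
- by move=> *; rewrite mul1r.
- by move=> *; rewrite mulr1.
- by move=> *; rewrite mulrDl.
- by move=> *; rewrite mulrDr.
- by move=> *; rewrite mulrA.
- by move=> *; rewrite mul1r.
- by move=> *; rewrite mulrDr.
- by move=> *; rewrite mulrDl.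
- by move=> *; rewrite mulrA.
- by move=> *; rewrite mulrCA.
- by move=> *; rewrite conjCK.
- by move=> *; rewrite rmorphD.
- by move=> *; rewrite rmorphM mulrC.
- by move=> *; rewrite rmorphM.
Qed.

End Presentation.

Arguments TZero {C G}.
Arguments TOne {C G}.
Arguments TGen {C G}.

Declare Scope star_term_scope.
Delimit Scope star_term_scope with ST.
Notation "t + u" := (TAdd t u) : star_term_scope.
Notation "t * u" := (TMul t u) : star_term_scope.
Notation "k *: t" := (TScale k t) : star_term_scope.
Notation "t - u" := (TAdd t (TScale (-1) u)) : star_term_scope.
Notation "1" := TOne : star_term_scope.
Notation "0" := TZero : star_term_scope.

Inductive sphere_gen : Type := S_f1 | S_fm1 | S_f0.

Section Sphere.
Variables (R : realType) (p q : R).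
Let T := star_term R[i] sphere_gen.
Let f1 : T := TGen S_f1.
Let fm1 : T := TGen S_fm1.
Let f0 : T := TGen S_f0.

Inductive sphere_rel : T -> T -> Prop :=
  | SR_star0 : sphere_rel (TStar f0) f0
  | SR_star1 : sphere_rel (TStar f1) fm1
  | SR_m11 : sphere_rel (fm1 * f1 - q%:C%C *: (f1 * fm1))%ST
      ((p - q)%:C%C *: f0 + (1 - p)%:C%C *: 1)%ST
  | SR_01 : sphere_rel (f0 * f1 - p%:C%C *: (f1 * f0))%ST
      ((1 - p)%:C%C *: f1)%ST
  | SR_m10 : sphere_rel (fm1 * f0 - p%:C%C *: (f0 * fm1))%ST
      ((1 - p)%:C%C *: fm1)%ST
  | SR_proj : sphere_rel ((1 - f0) * (f1 * fm1 - f0))%ST 0%ST.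

Lemma sphere_nontrivial : ~ star_cong sphere_rel TOne TZero.
Proof.
move=> /(term_eval_cong (v := fun=> 1)) H.
have /eqP : (1 : R[i]) = 0; last by rewrite oner_eq0.
by apply: H => t u [] /=; rewrite ?rmorph1 ?rmorphB ?rmorph1 //; ring.
Qed.

Definition sphere_poly : Type := star_pres sphere_nontrivial.
HB.instance Definition _ := StarAlgebra.on sphere_poly.

End Sphere.

Definition podles_relations (R : realType) (mu c : R) (Y : starAlgType R[i])
    (A B : Y) : Prop :=
  [/\ A = star A,
      B * A = (mu ^+ 2)%:C%C *: (A * B),
      star B * B = A - A ^+ 2 + c%:C%C *: 1 &
      B * star B = (mu ^+ 2)%:C%C *: A - (mu ^+ 4)%:C%C *: A ^+ 2
                   + c%:C%C *: 1].

Definition podles_universal (R : realType) (mu c : R) (Y : cstarAlgType R)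
    (A B : Y) : Prop :=
  podles_relations mu c A B /\
  forall (Z : cstarAlgType R) (A' B' : Z), podles_relations mu c A' B' ->
    exists f : {lrmorphism Y -> Z},
      [/\ star_morphism f, f A = A' & f B = B'] /\
      forall g : {lrmorphism Y -> Z},
        [/\ star_morphism g, g A = A' & g B = B'] -> g =1 f.

(* Main.v *)
(* Put w = f_1, x = 1 - f_0, y = f_0 - f_1 f_1^*. The relations say that x y = 0,
   x w = p w x, y w = q w y, w w^* = 1 - x - y and w^* w = 1 - p x - q y. Thus
   w^* w is invertible, w has a defect projection which x and y split into two
   pieces e_0^+, e_0^-, and x = sum p^k e_k^+, y = sum q^k e_k^- in norm, where
   e_k^+- are the translates of e_0^+- by the shift: w is a weighted shift. The
   Podles relations describe in the same way a weighted shift w = c^(-1/2) B^*,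
   where A = sum m^k (l_+ e_k^+ + l_- e_k^-), m = mu^2 and l_+- are the roots of
   t^2 = t + c. Multiplying w by a norm-convergent combination of the e_k^+-
   changes one system of weights into the other, and the projections e_k^+- are
   determined by either set of generators; this gives mutually inverse
   morphisms.

   The morphism out of the completion exists because the norm of the image of a
   polynomial a in any C*-algebra is at most its norm in Hilbert space
   representations. For a of gauge degree 0 both norms are computed from the
   eigenvalues on the e_k^+-, none of which vanishes in the completion, by two
   representations on l^2. If a has degree at most d, averaging over the gauge
   action of the roots of unity of order 2d+1 extracts its homogeneous components
   a_k, and |a_k|^2 = |a_k^* a_k| reduces to degree 0, at the cost of a factor
   2d+1, which disappears when the estimate is applied to (a^* a)^N, N = 2^j. *)
Require Import Defs.
From HB Require Import structures.
From mathcomp Require Import all_boot all_order all_algebra sesquilinear.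
From mathcomp Require Import all_classical all_reals all_analysis.
From mathcomp Require Import complex ring lra zify cyclic separable cyclotomic.
Set Implicit Arguments.
Unset Strict Implicit.
Unset Printing Implicit Defensive.
Import Order.TTheory GRing.Theory Num.Theory.
Import numFieldNormedType.Exports.
Import Num.Def.
Local Open Scope classical_set_scope.
Local Open Scope ring_scope.

(** The completion is normed through Hilbert space representations, while the universal property of
    the Podles sphere ranges over abstract C*-algebras. Instead of the Gelfand-Naimark theorem an
    explicit comparison of norms links the two. It is needed in one direction only: the morphism out
    of the Podles algebra is given by universality. Spectral theory is replaced by elementary means.
    A function of the diagonal elements is a series over the projections e_k^+-, with coefficients
    tending geometrically to a limit; sharp norm bounds come from crude ones by the C*-identity and
    repeated squaring. Both weight systems tend to 1 and are bounded away from 0, so the quotients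
    that reweight w are again such coefficients. Working with translates of e_0^+- rather than with
    functions of A matters because mu = 0 is allowed: A then vanishes on all e_k^+- with k > 0 and
    cannot tell them apart. Invertibility of w^* w is not visible in the relations. It factors into
    two terms 1 - m s a, and such a term is inverted by replacing s with m s, m^2 s and so on, until
    the Neumann series converges. *)

Definition nm (R : realType) (z : R[i]) : R := complex.Re `|z|.

(** * The modulus as a real number *)

Section ComplexNorm.
Variable R : realType.
Implicit Types (z w : R[i]) (r : R).

Lemma nmE z : (nm z)%:C%C = `|z|.
Proof. by rewrite /nm RRe_real ?normr_real. Qed.

Lemma nm_ge0 z : 0 <= nm z.
Proof. by rewrite -lecR nmE; exact: normr_ge0. Qed.

Lemma nmM z w : nm (z * w) = nm z * nm w.
Proof. by apply: complexI; rewrite nmE normrM rmorphM /= !nmE. Qed.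

Lemma nmD z w : nm (z + w) <= nm z + nm w.
Proof. by rewrite -lecR rmorphD /= !nmE ler_normD. Qed.

Lemma nmN z : nm (- z) = nm z.
Proof. by rewrite /nm normrN. Qed.

Lemma nm0 : nm (0 : R[i]) = 0.
Proof. by rewrite /nm normr0. Qed.

Lemma nm1 : nm (1 : R[i]) = 1.
Proof. by rewrite /nm normr1. Qed.

Lemma nm_eq0 z : (nm z == 0) = (z == 0).
Proof. by rewrite -(inj_eq (@complexI R)) nmE normr_eq0. Qed.

Lemma nm_conj z : nm z^* = nm z.
Proof. by rewrite /nm norm_conjC. Qed.

Lemma nmX z n : nm (z ^+ n) = nm z ^+ n.
Proof. by elim: n => [|n IH]; rewrite ?expr0 ?nm1 // !exprS nmM IH. Qed.

Lemma nm_real r : nm r%:C%C = `|r|.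
Proof. by rewrite /nm normc_def /= expr0n addr0 sqrtr_sqr. Qed.

Lemma nm_sqr z : (nm z ^+ 2)%:C%C = z * z^*.
Proof. by rewrite rmorphXn /= nmE normCK. Qed.

Lemma nm_Re z : `|complex.Re z| <= nm z.
Proof. by rewrite -lecR nmE normc_ge_Re. Qed.

Lemma nm_i : nm ('i%C : R[i]) = 1.
Proof. by rewrite complexiE /nm normCi. Qed.

Lemma nm_Im z : `|complex.Im z| <= nm z.
Proof. by rewrite -normrN -ReiNIm (le_trans (nm_Re _)) // nmM nm_i mulr1. Qed.

End ComplexNorm.

(** * The Hilbert space of square-summable complex sequences *)

Section SquareSummable.
Variable R : realType.
Local Notation C := R[i].
Implicit Types u v : nat -> C.

Definition sqs u n : R := \sum_(k < n) nm (u k) ^+ 2.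

Lemma sqs_ge0 u n : 0 <= sqs u n.
Proof. by apply: sumr_ge0 => k _; rewrite sqr_ge0. Qed.

Lemma sqsS u n : sqs u n.+1 = sqs u n + nm (u n) ^+ 2.
Proof. by rewrite /sqs big_ord_recr. Qed.

Lemma sqs_homo u : {homo sqs u : m n / (m <= n)%N >-> m <= n}.
Proof.
by apply: (@homo_leq _ _ Order.le) => [//|? ? ?|n]; [exact: le_trans|];
  rewrite sqsS lerDl sqr_ge0.
Qed.

Lemma nm_le_sqs u k : nm (u k) ^+ 2 <= sqs u k.+1.
Proof. by rewrite sqsS lerDr sqs_ge0. Qed.

(** Squaring reduces the claim to Cauchy-Schwarz in the plane, that is to (a y - b x)^2 >= 0.
    Minkowski's inequality for partial sums follows by adding one coordinate at a time. *)
Lemma minkowski2 (a b x y : R) : 0 <= a -> 0 <= b -> 0 <= x -> 0 <= y ->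
  Num.sqrt ((a + b) ^+ 2 + (x + y) ^+ 2) <=
  Num.sqrt (a ^+ 2 + x ^+ 2) + Num.sqrt (b ^+ 2 + y ^+ 2).
Proof.
move=> a0 b0 x0 y0.
set s := Num.sqrt (a ^+ 2 + x ^+ 2); set t := Num.sqrt (b ^+ 2 + y ^+ 2).
have s0 : 0 <= s by exact: sqrtr_ge0.
have t0 : 0 <= t by exact: sqrtr_ge0.
have s2 : s ^+ 2 = a ^+ 2 + x ^+ 2 by rewrite sqr_sqrtr // addr_ge0 ?sqr_ge0.
have t2 : t ^+ 2 = b ^+ 2 + y ^+ 2 by rewrite sqr_sqrtr // addr_ge0 ?sqr_ge0.
rewrite -(ler_pXn2r (n := 2)) ?nnegrE ?sqrtr_ge0 ?addr_ge0 //.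
rewrite sqr_sqrtr ?addr_ge0 ?sqr_ge0 //.
suff h : a * b + x * y <= s * t by nra.
rewrite -(ler_pXn2r (n := 2)) ?nnegrE ?addr_ge0 ?mulr_ge0 //.
rewrite exprMn s2 t2.
have := sqr_ge0 (a * y - b * x); nra.
Qed.

Lemma sqs_minkowski u v n :
  Num.sqrt (sqs (u + v) n) <= Num.sqrt (sqs u n) + Num.sqrt (sqs v n).
Proof.
elim: n => [|n IH]; first by rewrite /sqs !big_ord0 sqrtr0 addr0.
have E w : sqs w n.+1 = Num.sqrt (sqs w n) ^+ 2 + nm (w n) ^+ 2.
  by rewrite sqsS sqr_sqrtr ?sqs_ge0.
rewrite !E; apply: le_trans (minkowski2 _ _ _ _); rewrite ?sqrtr_ge0 ?nm_ge0 //.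
rewrite ler_sqrt; last by rewrite addr_ge0 ?sqr_ge0.
by apply: lerD; rewrite ler_pXn2r ?nnegrE ?addr_ge0 ?sqrtr_ge0 ?nm_ge0 ?nmD.
Qed.

Lemma sqsZ (k : C) u n : sqs (k *: u) n = nm k ^+ 2 * sqs u n.
Proof.
by rewrite /sqs mulr_sumr; apply: eq_bigr => i _; rewrite -exprMn -nmM.
Qed.

Definition l2_pred : {pred nat -> C} :=
  fun u => `[< exists M, forall n, sqs u n <= M >].

Lemma l2_submod : submod_closed l2_pred.
Proof.
split=> [|k u v /asboolP[M uM] /asboolP[N vN]]; apply/asboolP.
  by exists 0 => n; rewrite /sqs big1 // => i _; rewrite nm0 expr0n.
exists ((Num.sqrt (nm k ^+ 2 * M) + Num.sqrt N) ^+ 2) => n.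
rewrite -[sqs _ _]sqr_sqrtr ?sqs_ge0 //.
rewrite ler_pXn2r ?nnegrE ?addr_ge0 ?sqrtr_ge0 //.
apply: le_trans (sqs_minkowski _ _ _) _.
apply: lerD; apply: ler_wsqrtr; rewrite ?vN // sqsZ.
by rewrite ler_wpM2l // sqr_ge0.
Qed.

HB.instance Definition _ := GRing.isSubmodClosed.Build C (nat -> C) l2_pred
  l2_submod.

Record l2 : predArgType := L2 { l2v :> nat -> C; l2_mem : l2v \in l2_pred }.
HB.instance Definition _ := [isSub for l2v].
HB.instance Definition _ := [Choice of l2 by <:].
HB.instance Definition _ := [SubChoice_isSubLmodule of l2 by <:].

End SquareSummable.

Section L2Norm.
Variable R : realType.
Local Notation C := R[i].
Local Notation H := (l2 R).
Implicit Types u v : H.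

Lemma l2_bounded u : exists M, forall n, sqs u n <= M.
Proof. by have /asboolP := l2_mem u. Qed.

Lemma sqs_cvg u : cvgn (sqs u).
Proof.
apply: nondecreasing_is_cvgn; first exact: sqs_homo.
by have [M uM] := l2_bounded u; exists M => _ [n _ <-].
Qed.

Definition sqnorm u : R := limn (sqs u).

Lemma sqs_le u n : sqs u n <= sqnorm u.
Proof. by apply: nondecreasing_cvgn_le; [exact: sqs_homo|exact: sqs_cvg]. Qed.

Lemma sqnorm_le u M : (forall n, sqs u n <= M) -> sqnorm u <= M.
Proof. by move=> h; apply: limr_le; [exact: sqs_cvg|near=> n; exact: h].
Unshelve. all: by end_near. Qed.

Lemma sqnorm_ge0 u : 0 <= sqnorm u.
Proof. exact: le_trans (sqs_ge0 _ 0) (sqs_le _ _). Qed.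

Definition l2norm u : C := (Num.sqrt (sqnorm u))%:C%C.

Lemma l2normD u v : l2norm (u + v) <= l2norm u + l2norm v.
Proof.
rewrite -rmorphD /= lecR -(ler_pXn2r (n := 2)) ?nnegrE ?addr_ge0 ?sqrtr_ge0 //.
rewrite sqr_sqrtr ?sqnorm_ge0 //; apply: sqnorm_le => n.
rewrite -[sqs _ _]sqr_sqrtr ?sqs_ge0 //.
rewrite ler_pXn2r ?nnegrE ?addr_ge0 ?sqrtr_ge0 //.
apply: le_trans (sqs_minkowski _ _ _) _.
by apply: lerD; apply: ler_wsqrtr; exact: sqs_le.
Qed.

Lemma sqnormZ (k : C) u : sqnorm (k *: u) = nm k ^+ 2 * sqnorm u.
Proof.
apply/eqP; rewrite eq_le; apply/andP; split.
  by apply: sqnorm_le => n; rewrite sqsZ ler_wpM2l ?sqr_ge0 ?sqs_le.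
have [->|k0] := eqVneq k 0; first by rewrite nm0 expr0n mul0r sqnorm_ge0.
have nk : 0 < nm k ^+ 2 by rewrite exprn_gt0 // lt_def nm_eq0 k0 nm_ge0.
rewrite -ler_pdivlMl //; apply: sqnorm_le => n.
by rewrite ler_pdivlMl // -sqsZ; exact: (sqs_le (k *: u)).
Qed.

Lemma l2normZ (k : C) u : l2norm (k *: u) = `|k| * l2norm u.
Proof.
rewrite /l2norm sqnormZ sqrtrM ?sqr_ge0 // sqrtr_sqr ger0_norm ?nm_ge0 //.
by rewrite rmorphM /= nmE.
Qed.

Lemma l2P u v : (forall k, u k = v k) -> u = v.
Proof. by move=> h; apply: val_inj; apply/funext => k; exact: h. Qed.

Lemma nm_le_sqnorm u k : nm (u k) ^+ 2 <= sqnorm u.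
Proof. exact: le_trans (nm_le_sqs _ _) (sqs_le _ _). Qed.

Lemma l2norm_eq0 u : l2norm u = 0 -> u = 0.
Proof.
move=> /complexI/eqP; rewrite sqrtr_eq0 => u0; apply: l2P => k; apply/eqP.
rewrite -nm_eq0 -sqrf_eq0 eq_le sqr_ge0 andbT.
exact: le_trans (nm_le_sqnorm _ _) u0.
Qed.

HB.instance Definition _ := Lmodule_isNormed.Build C H
  l2normD l2normZ l2norm_eq0.

Lemma l2_normE u : `|u| = (Num.sqrt (sqnorm u))%:C%C.
Proof. by []. Qed.

End L2Norm.

Section ComplexLimit.
Variable R : realType.
Local Notation C := R[i].
Implicit Types (s t : nat -> C) (l m : C).

(** Convergence by real and imaginary parts, because the comparison test and monotone limits are
    applied over [R]. *)
Definition cvgC s l :=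
  (fun n => complex.Re (s n)) @ \oo --> complex.Re l /\
  (fun n => complex.Im (s n)) @ \oo --> complex.Im l.

Lemma cvgC_unique s l m : cvgC s l -> cvgC s m -> l = m.
Proof.
move=> [a b] [c d]; apply/eqP; rewrite eq_complex; apply/andP; split; apply/eqP.
  exact: (cvg_unique _ a c).
exact: (cvg_unique _ b d).
Qed.

Lemma cvgCD s t l m : cvgC s l -> cvgC t m -> cvgC (fun n => s n + t n) (l + m).
Proof.
by move=> [a b] [c d]; split; rewrite raddfD; under eq_fun do rewrite raddfD;
  apply: cvgD.
Qed.

Lemma ReM (x y : C) :
  complex.Re (x * y) = complex.Re x * complex.Re y - complex.Im x * complex.Im y.
Proof. by case: x y => [a b] [c d]. Qed.

Lemma ImM (x y : C) :
  complex.Im (x * y) = complex.Re x * complex.Im y + complex.Im x * complex.Re y.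
Proof. by case: x y => [a b] [c d]. Qed.

Lemma cvgCZ s l (k : C) : cvgC s l -> cvgC (fun n => k * s n) (k * l).
Proof.
move=> [a b]; split.
  rewrite ReM; under eq_fun do rewrite ReM.
  by apply: cvgB; apply: cvgM => //; exact: cvg_cst.
rewrite ImM; under eq_fun do rewrite ImM.
by apply: cvgD; apply: cvgM => //; exact: cvg_cst.
Qed.

Lemma cvgC_conj s l : cvgC s l -> cvgC (fun n => (s n)^*) l^*.
Proof.
have E (z : C) : z^* = (complex.Re z -i* complex.Im z)%C by case: z.
move=> [a b]; split; rewrite E; under eq_fun do rewrite E; first exact: a.
exact: cvgN.
Qed.

Lemma cvgC_series_ex s (b : nat -> R) M : (forall n, nm (s n) <= b n) ->
  (forall n, \sum_(k < n) b k <= M) ->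
  exists l, cvgC (fun n => \sum_(k < n) s k) l.
Proof.
move=> sb bM; have b0 n : 0 <= b n by exact: le_trans (nm_ge0 _) (sb n).
have cb : cvgn (series b).
  apply: nondecreasing_is_cvgn.
    apply: (@homo_leq _ _ Order.le) => [//|? ? ?|n]; first exact: le_trans.
    by rewrite /series /= !big_mkord big_ord_recr /= lerDl b0.
  by exists M => _ [n _ <-]; rewrite /series /= big_mkord.
have cf (f : nat -> R) : (forall n, `|f n| <= b n) -> cvgn (series f).
  by move=> fb; apply: normed_cvg; by apply: series_le_cvg cb => // n; rewrite normr_ge0.
have c1 : cvgn (series (fun n => complex.Re (s n))).
  by apply: cf => n; exact: le_trans (nm_Re _) (sb n).
have c2 : cvgn (series (fun n => complex.Im (s n))).
  by apply: cf => n; exact: le_trans (nm_Im _) (sb n).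
exists (limn (series (fun n => complex.Re (s n))) +i*
        limn (series (fun n => complex.Im (s n))))%C.
have E (f : nat -> R) :
    series f = (fun n => \sum_(k < n) f k) by apply/funext => n; rewrite /series /= big_mkord.
split=> /=; under eq_fun do rewrite raddf_sum.
  by rewrite -(E (fun k => complex.Re (s k))).
by rewrite -(E (fun k => complex.Im (s k))).
Qed.

End ComplexLimit.

Section L2Inner.
Variable R : realType.
Local Notation C := R[i].
Local Notation H := (l2 R).
Implicit Types u v w : H.

Definition ips u v n : C := \sum_(k < n) u k * (v k)^*.

Lemma ips_cvg u v : exists l, cvgC (ips u v) l.
Proof.
have h1 n : nm (u n * (v n)^*) <= nm (u n) ^+ 2 + nm (v n) ^+ 2.
  rewrite nmM nm_conj; have := nm_ge0 (u n); have := nm_ge0 (v n).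
  have := sqr_ge0 (nm (u n) - nm (v n)); nra.
have h2 n : \sum_(k < n) (nm (u k) ^+ 2 + nm (v k) ^+ 2) <= sqnorm u + sqnorm v.
  by rewrite big_split /= lerD //; exact: sqs_le.
exact: cvgC_series_ex h1 h2.
Qed.

Definition l2_inner u v : C := projT1 (cid (ips_cvg u v)).

Lemma l2_innerP u v : cvgC (ips u v) (l2_inner u v).
Proof. by rewrite /l2_inner; case: cid. Qed.

Lemma l2_innerE u v l : cvgC (ips u v) l -> l2_inner u v = l.
Proof. exact: cvgC_unique (l2_innerP u v). Qed.

Lemma l2_inner_herm u v : l2_inner u v = (-1) ^+ false * (l2_inner v u)^*.
Proof.
rewrite expr0 mul1r; apply: l2_innerE.
rewrite (_ : ips u v = fun n => (ips v u n)^*); first exact/cvgC_conj/l2_innerP.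
apply/funext => n; rewrite /ips rmorph_sum; apply: eq_bigr => k _.
by rewrite rmorphM /= conjCK mulrC.
Qed.

Lemma l2_inner_linl v : GRing.linear_for *%R (l2_inner ^~ v).
Proof.
move=> k u w /=; apply: l2_innerE.
rewrite (_ : ips _ v = fun n => k * ips u v n + ips w v n).
  by apply: cvgCD; [apply: cvgCZ|]; exact: l2_innerP.
apply/funext => n; rewrite /ips mulr_sumr -big_split; apply: eq_bigr => i _ /=.
by rewrite mulrDl mulrA.
Qed.

Lemma l2_inner_bilinear : bilinear_for *%R (conjC \; *%R) (l2_inner : H -> H -> C).
Proof.
split=> [v|u]; first exact: l2_inner_linl.
move=> k v w /=; rewrite l2_inner_herm l2_inner_linl /= !mul1r rmorphD rmorphM /=.
by rewrite [in RHS]l2_inner_herm [l2_inner u w]l2_inner_herm !mul1r.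
Qed.

HB.instance Definition _ := bilinear_isBilinear.Build C H H C *%R
  (conjC \; *%R) l2_inner l2_inner_bilinear.
HB.instance Definition _ := isHermitianSesquilinear.Build C H false conjC
  l2_inner l2_inner_herm.

Lemma l2_inner_sqnorm u : l2_inner u u = (sqnorm u)%:C%C.
Proof.
apply: l2_innerE.
have E n : ips u u n = (sqs u n)%:C%C.
  rewrite /ips /sqs rmorph_sum; apply: eq_bigr => k _.
  exact/esym/nm_sqr.
split=> /=; under eq_fun do rewrite E; first exact: sqs_cvg.
exact: cvg_cst.
Qed.

Lemma l2_inner_norm u : `|u| ^+ 2 = l2_inner u u.
Proof.
by rewrite l2_inner_sqnorm l2_normE -rmorphXn /= sqr_sqrtr // sqnorm_ge0.
Qed.

Lemma l2_inner_gt0 u : u != 0 -> 0 < l2_inner u u.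
Proof. by move=> u0; rewrite -l2_inner_norm exprn_gt0 // normr_gt0. Qed.

HB.instance Definition _ := isDotProduct.Build C H l2_inner l2_inner_gt0.

End L2Inner.

Section L2Complete.
Variable R : realType.
Local Notation C := R[i].
Local Notation H := (l2 R).
Implicit Types u v w : H.

Lemma l2_norm_ltP u (e : R) : 0 <= e -> (`|u| <= e%:C%C) = (sqnorm u <= e ^+ 2).
Proof.
move=> e0; rewrite l2_normE lecR -[e in LHS]ger0_norm // -sqrtr_sqr.
by rewrite ler_sqrt // sqr_ge0.
Qed.

Lemma sqsB_le u v n (e : R) : 0 <= e -> `|u - v| <= e%:C%C ->
  sqs ((u : nat -> C) - (v : nat -> C)) n <= e ^+ 2.
Proof.
move=> e0; rewrite l2_norm_ltP //; apply: le_trans.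
exact: (sqs_le (u - v)).
Qed.

(** Coordinates are Cauchy, and the bound [d m] on each partial sum of x_m - x_n survives the limit
    in n. An explicit rate [d] yields the same rate for the limit. *)
Lemma l2_seq_complete (x : nat -> H) (d : nat -> R) : d @ \oo --> 0 ->
  (forall m n, (m <= n)%N -> `|x m - x n| <= (d m)%:C%C) ->
  exists l, forall m, `|x m - l| <= (d m)%:C%C.
Proof.
move=> d0 xd.
have dge0 m : 0 <= d m by have := xd m m (leqnn m); rewrite subrr normr0 lecR.
have sd m n k : (m <= n)%N ->
    sqs ((x m : nat -> C) - (x n : nat -> C)) k <= d m ^+ 2.
  by move=> mn; apply: sqsB_le (xd m n mn).
have cau (f : C -> R) : {morph f : a b / a - b} -> (forall z, `|f z| <= nm z) ->
    forall k, cvgn (fun n => f (x n k)).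
  move=> fB f_nm k; apply/cauchy_cvgP/cauchyP => e e0.
  have /cvgrPdist_lt/(_ e e0)[N _ hN] := d0.
  exists (f (x N k)); exists N => // n /= Nn.
  rewrite /ball /= -fB (le_lt_trans (f_nm _)) //.
  have := hN N (leqnn N); rewrite sub0r normrN ger0_norm //; apply: le_lt_trans.
  rewrite -(ler_pXn2r (n := 2)) ?nnegrE ?nm_ge0 //.
  exact: le_trans (nm_le_sqs ((x N : nat -> C) - x n) k) (sd _ _ _ Nn).
pose l k : C := (limn (fun n => complex.Re (x n k)) +i*
                 limn (fun n => complex.Im (x n k)))%C.
have cl k : cvgC (fun n => x n k) (l k).
  split=> /=; apply: cau => [a b|z]; rewrite ?raddfB ?nm_Re ?nm_Im //.
have nm2 (z : C) : nm z ^+ 2 = complex.Re z ^+ 2 + complex.Im z ^+ 2.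
  by apply: complexI; rewrite rmorphXn /= nmE add_Re2_Im2.
have sl m k : sqs ((x m : nat -> C) - l) k <= d m ^+ 2.
  have h : (fun n => sqs ((x m : nat -> C) - (x n : nat -> C)) k) @ \oo -->
      sqs ((x m : nat -> C) - l) k.
    rewrite /sqs; apply: (cvg_big (@add_continuous R)) => i _.
    rewrite nm2; under eq_fun do rewrite nm2.
    have [c1 c2] := cl i.
    have cc (f g : nat -> R) (a b : R) : f @ \oo --> a -> g @ \oo --> b ->
       (fun n => f n ^+ 2 + g n ^+ 2) @ \oo --> a ^+ 2 + b ^+ 2.
      move=> fa gb; apply: cvgD; rewrite expr2; under eq_fun do rewrite expr2;
      exact: cvgM.
    apply: cc; rewrite raddfB; under eq_fun do rewrite raddfB; apply: cvgB => //;
    exact: cvg_cst.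
  rewrite -(cvg_lim _ h) //; apply: limr_le; first by apply/cvg_ex; eexists; exact: h.
  by exists m => // n /= mn; exact: sd.
have lH : l \in @l2_pred R.
  (* Only x_0 - l is known to be square-summable; closure of [l2_pred] under linear combinations
     then gives l. *)
  have -> : l = (-1) *: ((x 0%N : nat -> C) - l) + (x 0%N : nat -> C).
    by rewrite scaleN1r opprB subrK.
  have [h0 h1] := l2_submod R; apply: h1; last exact: l2_mem.
  by apply/asboolP; exists (d 0%N ^+ 2) => n; exact: sl.
exists (L2 lH) => m; rewrite l2_norm_ltP //; apply: sqnorm_le => n.
exact: sl.
Qed.

(** A Cauchy filter is replaced by a sequence of centres x_n whose balls of radius 1/(n+1) belong to
    the filter. *)
Lemma l2_complete (F : set_system H) : ProperFilter F -> cauchy F -> cvg F.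
Proof.
move=> PF /cauchyP Fc.
have d0 n : (0 : C) < (n.+1%:R^-1 : R)%:C%C by rewrite ltcR invr_gt0 ltr0n.
pose x n : H := projT1 (cid (Fc _ (d0 n))).
have Fx n : F (ball (x n) (n.+1%:R^-1 : R)%:C%C).
  by rewrite /x; case: cid.
(* The balls around x_m and x_n meet, so for m <= n the centres are at distance at most 2/(m+1). *)
pose d n : R := n.+1%:R^-1 + n.+1%:R^-1.
have cd : d @ \oo --> (0 : R).
  have h : (fun n => n.+1%:R^-1 : R) @ \oo --> (0 : R) by exact: cvg_harmonic.
  by rewrite -[0]addr0; apply: cvgD.
have xd m n : (m <= n)%N -> `|x m - x n| <= (d m)%:C%C.
  move=> mn; have [z [h1 h2]] := filter_ex (filterI (Fx m) (Fx n)).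
  rewrite -[x m](subrK z) -addrA (le_trans (ler_normD _ _)) // rmorphD /=.
  apply: lerD; first by apply: ltW; move: h1; rewrite -ball_normE.
  have := h2; rewrite -ball_normE /ball_ /= distrC => /ltW/le_trans; apply.
  by rewrite lecR lef_pV2 ?posrE ?ltr0n // ler_nat ltnS.
have [l xl] := l2_seq_complete cd xd.
apply/cvg_ex; exists l => A /nbhs_ballP[e /= e0 eA].
have re0 : 0 < complex.Re e by move: e0; rewrite ltcE /= => /andP[].
have ee : e = (complex.Re e)%:C%C by rewrite RRe_real // gtr0_real.
have : (fun n => d n + n.+1%:R^-1 : R) @ \oo --> (0 : R).
  by rewrite -[0]addr0; apply: cvgD => //; exact: cvg_harmonic.
move=> /cvgrPdist_lt/(_ _ re0)[N _ /(_ N (leqnn N))].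
rewrite sub0r normrN ger0_norm; last by rewrite !addr_ge0 // invr_ge0 ler0n.
move=> dN; apply: filterS (Fx N) => z hz; apply: eA.
rewrite ee -ball_normE /ball_ /=.
rewrite -[l](subrK (x N)) -addrA (le_lt_trans (ler_normD _ _)) //.
move: dN; rewrite -ltcR; apply: le_lt_trans; rewrite rmorphD /=.
apply: lerD; first by rewrite distrC.
by move: hz; rewrite -ball_normE => /ltW.
Qed.

HB.instance Definition _ := Uniform_isComplete.Build H l2_complete.
HB.instance Definition _ := isHilbert.Build C H (@l2_inner_norm R).

End L2Complete.


(** * Representations of presented star-algebras by bounded operators *)

Section OperatorModel.
Variables (C : numClosedFieldType) (G : Type) (H : hilbertType C).
Variable rel : star_term C G -> star_term C G -> Prop.
Implicit Types (T U : H -> H) (x y : H) (t u : star_term C G).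

(** Each operator travels with its adjoint, so that [TStar] is interpreted by swapping the pair and
    no adjoint has to be produced from the Riesz theorem. *)
Definition adjoint_pair (T : (H -> H) * (H -> H)) : Prop :=
  [/\ bounded_operator T.1, bounded_operator T.2 &
      forall x y, inner (T.1 x) y = inner x (T.2 y)].

(** The bound in [bounded_operator] is an arbitrary scalar. As M |x| dominates a norm it is
    nonnegative, hence equal to |M| |x|, and M may be replaced by |M|. *)
Lemma bounded_operatorP T : bounded_operator T ->
  exists M : C, 0 <= M /\ forall x, `|T x| <= M * `|x|.
Proof.
move=> [_ [M hM]]; exists `|M|; split=> // x.
have h : 0 <= M * `|x| by exact: le_trans (normr_ge0 _) (hM x).
by rewrite -[in X in _ <= X](normr_id x) -normrM (ger0_norm h).
Qed.

Lemma bounded_operator0 : bounded_operator (fun=> 0 : H).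
Proof.
by split=> [k x y|]; [rewrite scaler0 addr0|exists 0 => x; rewrite normr0 mul0r].
Qed.

Lemma bounded_operator1 : bounded_operator (fun x : H => x).
Proof. by split=> //; exists 1 => x; rewrite mul1r. Qed.

Lemma bounded_operatorD T U : bounded_operator T -> bounded_operator U ->
  bounded_operator (fun x => T x + U x).
Proof.
move=> [lT [M hM]] [lU [N hN]]; split=> [k x y|].
  by rewrite lT lU scalerDr addrACA.
by exists (M + N) => x; rewrite mulrDl (le_trans (ler_normD _ _)) // lerD.
Qed.

Lemma bounded_operatorM T U : bounded_operator T -> bounded_operator U ->
  bounded_operator (fun x => T (U x)).
Proof.
move=> bT [lU [N hN]]; have [M [M0 hM]] := bounded_operatorP bT.
case: bT => lT _; split=> [k x y|]; first by rewrite lU lT.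
exists (M * N) => x; rewrite (le_trans (hM _)) // -mulrA.
by rewrite ler_wpM2l.
Qed.

Lemma bounded_operatorZ (k : C) T : bounded_operator T ->
  bounded_operator (fun x => k *: T x).
Proof.
move=> [lT [M hM]]; split=> [l x y|].
  by rewrite lT scalerDr !scalerA mulrC.
by exists (`|k| * M) => x; rewrite normrZ -mulrA ler_wpM2l.
Qed.

Lemma innerC x y : inner x y = (inner y x)^*.
Proof. by rewrite hermC expr0 mul1r. Qed.

Lemma linear_fD T x y : linear T -> T (x + y) = T x + T y.
Proof. by move=> lT; have := lT 1 x y; rewrite !scale1r. Qed.

Lemma linear_f0 T : linear T -> T 0 = 0.
Proof.
by move=> lT; have /eqP := linear_fD 0 0 lT; rewrite addr0 -subr_eq subrr => /eqP.
Qed.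

Lemma linear_fZ T (k : C) x : linear T -> T (k *: x) = k *: T x.
Proof.
by move=> lT; have := lT k x 0; rewrite (linear_f0 lT) addr0 [in RHS]addr0.
Qed.

Variable v : G -> (H -> H) * (H -> H).

Fixpoint op_eval t : (H -> H) * (H -> H) :=
  match t with
  | TGen g => v g
  | TZero => (fun=> 0, fun=> 0)
  | TOne => (fun x => x, fun x => x)
  | TAdd t u => (fun x => (op_eval t).1 x + (op_eval u).1 x,
                 fun x => (op_eval t).2 x + (op_eval u).2 x)
  | TMul t u => (fun x => (op_eval t).1 ((op_eval u).1 x),
                 fun x => (op_eval u).2 ((op_eval t).2 x))
  | TScale k t => (fun x => k *: (op_eval t).1 x,
                   fun x => k^* *: (op_eval t).2 x)
  | TStar t => ((op_eval t).2, (op_eval t).1)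
  end.

Hypothesis v_adj : forall g, adjoint_pair (v g).

Lemma op_eval_adjoint t : adjoint_pair (op_eval t).
Proof.
elim: t => //=.
- by split; [exact: bounded_operator0|exact: bounded_operator0|] => x y;
    rewrite linear0l linear0r.
- by split; [exact: bounded_operator1|exact: bounded_operator1|].
- move=> t [bt bt' at_] u [bu bu' au]; split; try exact: bounded_operatorD.
  by move=> x y /=; rewrite linearDl linearDr /= at_ au.
- move=> t [bt bt' at_] u [bu bu' au]; split; try exact: bounded_operatorM.
  by move=> x y /=; rewrite at_ au.
- move=> k t [bt bt' at_]; split; try exact: bounded_operatorZ.
  by move=> x y /=; rewrite linearZl_LR linearZr_LR /= at_ conjCK.
- move=> t [bt bt' at_]; split=> //= x y.
  by rewrite innerC -at_ -innerC.
Qed.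

Lemma op_eval_linear t :
  linear (op_eval t).1 /\ linear (op_eval t).2.
Proof. by have [[? _] [? _] _] := op_eval_adjoint t. Qed.

Hypothesis v_rel : forall t u, rel t u -> op_eval t = op_eval u.

(** Equality is asked of pairs: with the adjoints included in the induction, the case of [TStar] is
    immediate. *)
Lemma op_eval_cong t u : star_cong rel t u -> op_eval t = op_eval u.
Proof.
have D (t0 : star_term C G) x y :
    ((op_eval t0).1 (x + y) = (op_eval t0).1 x + (op_eval t0).1 y) *
    ((op_eval t0).2 (x + y) = (op_eval t0).2 x + (op_eval t0).2 y).
  by have [l1 l2] := op_eval_linear t0; split; exact: linear_fD.
have Z (t0 : star_term C G) k x :
    ((op_eval t0).1 (k *: x) = k *: (op_eval t0).1 x) *
    ((op_eval t0).2 (k *: x) = k *: (op_eval t0).2 x).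
  by have [l1 l2] := op_eval_linear t0; split; exact: linear_fZ.
elim=> //=.
- by move=> {}t {}u w _ -> _ ->.
- by move=> {}t t' {}u u' _ -> _ ->.
- by move=> {}t t' {}u u' _ -> _ ->.
- by move=> k {}t t' _ ->.
- by move=> {}t t' _ ->.
- by move=> *; congr pair; apply/funext => x; rewrite addrA.
- by move=> *; congr pair; apply/funext => x; rewrite addrC.
- by move=> t0; case: (op_eval t0) => f g; congr pair; apply/funext => x /=;
    rewrite add0r.
- by move=> *; congr pair; apply/funext => x; rewrite ?rmorphN ?rmorph1 scaleN1r addNr.
- by move=> t0; case: (op_eval t0).
- by move=> t0; case: (op_eval t0).
- by move=> *; congr pair; apply/funext => x; rewrite D.
- by move=> *; congr pair; apply/funext => x; rewrite D.
- by move=> *; congr pair; apply/funext => x; rewrite scalerA ?rmorphM.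
- by move=> t0; case: (op_eval t0) => f g; congr pair; apply/funext => x /=;
    rewrite ?rmorph1 scale1r.
- by move=> *; congr pair; apply/funext => x; rewrite scalerDr.
- by move=> *; congr pair; apply/funext => x; rewrite ?rmorphD scalerDl.
- by move=> *; congr pair; apply/funext => x; rewrite ?Z.
- by move=> *; congr pair; apply/funext => x; rewrite ?Z.
- by move=> t0; case: (op_eval t0).
- by move=> k t0; rewrite conjCK.
Qed.

Lemma op_star_representation (nt : ~ star_cong rel TOne TZero) :
  star_representation (fun (a : star_pres nt) => (op_eval (repr a)).1).
Proof.
have E t : op_eval (repr (pres_class nt t)) = op_eval t.
  exact/op_eval_cong/pres_reprP.
split.
- by move=> a; have [] := op_eval_adjoint (repr a).
- move=> k; elim/pres_ind=> t; elim/pres_ind=> u x.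
  have -> : k *: pres_class nt t + pres_class nt u =
      pres_class nt (TAdd (TScale k t) u).
    by rewrite -pres_addE -pres_scaleE.
  by rewrite !E.
- by move=> x; rewrite -[1]/(pres_class nt TOne) E.
- elim/pres_ind=> t; elim/pres_ind=> u x.
  by rewrite -[_ * _]/(pres_mul _ _) pres_mulE !E.
- elim/pres_ind=> t x y.
  rewrite -[star _]/(pres_star _) pres_starE !E.
  by have [_ _ ->] := op_eval_adjoint t.
Qed.

End OperatorModel.

(** * Weighted shifts on l^2 and two representations of the sphere relations *)

Section L2Shift.
Variable R : realType.
Local Notation C := R[i].
Local Notation H := (l2 R).
Implicit Types u v : H.

(** The number m of coordinates may exceed n because the backward shift reads one coordinate
    further. *)
Definition sqs_contraction (f : (nat -> C) -> nat -> C) :=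
  forall u n, exists m, sqs (f u) n <= sqs u m.

Lemma l2_lift_subproof f (fc : sqs_contraction f) u : f u \in @l2_pred R.
Proof.
apply/asboolP; exists (sqnorm u) => n; have [m h] := fc u n.
exact: le_trans h (sqs_le _ _).
Qed.

Definition l2_lift f (fc : sqs_contraction f) u : H := L2 (l2_lift_subproof fc u).

Lemma l2_lift_bounded f (fc : sqs_contraction f) :
  linear f -> bounded_operator (l2_lift fc).
Proof.
move=> fl; split=> [k u v|]; first by apply: val_inj; exact: fl.
exists 1 => u; rewrite mul1r !l2_normE lecR ler_wsqrtr //.
apply: sqnorm_le => n; have [m h] := fc u n.
exact: le_trans h (sqs_le _ _).
Qed.

Variable r : R.
Hypothesis r01 : 0 < r < 1.

Let r0 : 0 <= r. Proof. by case/andP: r01 => /ltW. Qed.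
Let rX k : 0 <= r ^+ k <= 1.
Proof. by case/andP: r01 => _ /ltW r1; rewrite exprn_ge0 ?exprn_ile1. Qed.

(** Forced by w^* w = 1 - r D and w w^* = 1 - D, where D has eigenvalues r^k. *)
Definition shift_weight k : R := Num.sqrt (1 - r ^+ k.+1).

Lemma shift_weight_sqr k : shift_weight k ^+ 2 = 1 - r ^+ k.+1.
Proof. by rewrite sqr_sqrtr // subr_ge0; case/andP: (rX k.+1). Qed.

Lemma shift_weight_le k : nm (shift_weight k)%:C%C ^+ 2 <= 1.
Proof.
rewrite nm_real real_normK ?num_real // shift_weight_sqr gerBl.
by case/andP: (rX k.+1).
Qed.

Lemma nmM_le1 (a z : C) : nm a ^+ 2 <= 1 -> nm (a * z) ^+ 2 <= nm z ^+ 2.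
Proof. by move=> a1; rewrite nmM exprMn ler_piMl ?sqr_ge0. Qed.

Definition shift_fun (u : nat -> C) k : C :=
  if k is j.+1 then (shift_weight j)%:C%C * u j else 0.
Definition coshift_fun (u : nat -> C) k : C := (shift_weight k)%:C%C * u k.+1.
Definition diag_fun (u : nat -> C) k : C := (r ^+ k)%:C%C * u k.

Lemma shift_fun_contraction : sqs_contraction shift_fun.
Proof.
move=> u n; exists n.-1; case: n => [|n]; first by rewrite /sqs !big_ord0.
rewrite /sqs big_ord_recl /= nm0 expr0n add0r; apply: ler_sum => k _.
exact/nmM_le1/shift_weight_le.
Qed.

Lemma coshift_fun_contraction : sqs_contraction coshift_fun.
Proof.
move=> u n; exists n.+1; rewrite [leRHS]/sqs big_ord_recl -[leLHS]add0r.
rewrite lerD ?sqr_ge0 //; apply: ler_sum => k _.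
exact/nmM_le1/shift_weight_le.
Qed.

Lemma diag_fun_contraction : sqs_contraction diag_fun.
Proof.
move=> u n; exists n; apply: ler_sum => k _; apply: nmM_le1.
by case/andP: (rX k) => ? ?; rewrite nm_real ger0_norm // exprn_ile1.
Qed.

Definition shift := l2_lift shift_fun_contraction.
Definition coshift := l2_lift coshift_fun_contraction.
Definition diag := l2_lift diag_fun_contraction.

Lemma coord_linear (f : (nat -> C) -> nat -> C) :
  (forall k (u v : nat -> C) j, f (k *: u + v) j = k * f u j + f v j) -> linear f.
Proof. by move=> h k u v; apply/funext => j; rewrite h. Qed.

Lemma shift_bounded : bounded_operator shift.
Proof.
apply/l2_lift_bounded/coord_linear => k u v [|j] /=; first by rewrite mulr0 addr0.
by rewrite -[(_ + v) j]/(k * u j + v j) mulrDr mulrCA.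
Qed.

Lemma coshift_bounded : bounded_operator coshift.
Proof.
apply/l2_lift_bounded/coord_linear => k u v j.
by rewrite /coshift_fun -[(_ + v) _]/(k * u j.+1 + v j.+1) mulrDr mulrCA.
Qed.

Lemma diag_bounded : bounded_operator diag.
Proof.
apply/l2_lift_bounded/coord_linear => k u v j.
by rewrite /diag_fun -[(_ + v) _]/(k * u j + v j) mulrDr mulrCA.
Qed.

Lemma conjC_real (a : R) : (a%:C%C)^* = a%:C%C :> C.
Proof. exact: conjc_real. Qed.

Lemma shift_adjoint u v : inner (shift u) v = inner u (coshift v).
Proof.
apply: l2_innerE; have [c1 c2] := l2_innerP u (coshift v).
(* The forward shift has coordinate 0 equal to 0, so the two partial sums agree after an offset of
   one, which does not affect the limit. *)
have E n : ips (shift u) v n.+1 = ips u (coshift v) n.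
  rewrite /ips big_ord_recl /= mul0r add0r; apply: eq_bigr => k _ /=.
  by rewrite /coshift_fun rmorphM /= conjC_real mulrCA mulrA.
split.
  rewrite -(cvg_shiftS (fun n => complex.Re (ips (shift u) v n))) /=.
  by under eq_fun do rewrite E.
rewrite -(cvg_shiftS (fun n => complex.Im (ips (shift u) v n))) /=.
by under eq_fun do rewrite E.
Qed.

Lemma diag_adjoint u v : inner (diag u) v = inner u (diag v).
Proof.
apply: l2_innerE.
rewrite (_ : ips (diag u) v = ips u (diag v)); first exact: l2_innerP.
apply/funext => n; apply: eq_bigr => k _ /=.
by rewrite /diag_fun rmorphM /= conjC_real mulrCA mulrA.
Qed.

Lemma coordB u v j : (u - v) j = u j - v j. Proof. by []. Qed.
Lemma coordD u v j : (u + v) j = u j + v j. Proof. by []. Qed.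
Lemma coordZ k u j : (k *: u) j = k * u j. Proof. by []. Qed.

Lemma coshift_shift u : coshift (shift u) = u - r%:C%C *: diag u.
Proof.
apply/l2P => k; rewrite coordB coordZ /= /coshift_fun /diag_fun /=.
rewrite mulrA -rmorphM /= -expr2 shift_weight_sqr rmorphB rmorph1 mulrBl mul1r.
by rewrite exprS rmorphM /= -mulrA.
Qed.

Lemma shift_coshift u : shift (coshift u) = u - diag u.
Proof.
apply/l2P => -[|k]; rewrite coordB /= /diag_fun; first by rewrite mul1r subrr.
rewrite /coshift_fun mulrA -rmorphM /= -expr2.
by rewrite shift_weight_sqr rmorphB rmorph1 mulrBl mul1r.
Qed.

Lemma diag_shift u : diag (shift u) = r%:C%C *: shift (diag u).
Proof.
apply/l2P => -[|k]; rewrite coordZ /= /diag_fun /= ?mulr0 //.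
by rewrite exprS rmorphM /=; ring.
Qed.

Lemma coshift_diag u : coshift (diag u) = r%:C%C *: diag (coshift u).
Proof.
apply/l2P => k; rewrite coordZ /= /diag_fun /coshift_fun /=.
by rewrite /diag_fun exprS rmorphM /=; ring.
Qed.

Definition l2_basis0 : H.
Proof.
apply: (@L2 _ (fun k => if k is 0%N then 1 else 0)).
apply/asboolP; exists 1 => -[|n]; first by rewrite /sqs big_ord0.
rewrite /sqs big_ord_recl big1 /= ?addr0 ?nm1 ?expr1n // => i _.
by rewrite nm0 expr0n.
Defined.

Lemma l2_basis0_norm : `|l2_basis0| <= 1.
Proof.
rewrite l2_norm_ltP // expr1n; apply: sqnorm_le => -[|n].
  by rewrite /sqs big_ord0.
rewrite /sqs big_ord_recl big1 /= ?addr0 ?nm1 ?expr1n // => i _.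
by rewrite nm0 expr0n.
Qed.

Lemma diag_basis0 : diag l2_basis0 = l2_basis0.
Proof.
apply/l2P => -[|k] /=; first by rewrite /diag_fun expr0 mul1r.
by rewrite /diag_fun mulr0.
Qed.

Lemma l2_basis0_neq0 : l2_basis0 != 0.
Proof.
apply/eqP => /(congr1 (fun u : H => u 0%N)) /=.
by move/eqP; rewrite oner_eq0.
Qed.

End L2Shift.

Section SphereModels.
Variables (R : realType) (p q : R).
Hypotheses (hp : 0 < p < 1) (hq : 0 < q < 1).
Local Notation C := R[i].
Local Notation H := (l2 R).

Definition par (b : bool) := if b then p else q.

Lemma par01 b : 0 < par b < 1. Proof. by case: b. Qed.

(** For [b = true] the element y vanishes and x is diagonal with eigenvalues p^k; for [b = false] it
    is x that vanishes and y that has eigenvalues q^k. Each model detects one of the two families of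
    projections. *)
Definition sphere_model b (g : sphere_gen) : (H -> H) * (H -> H) :=
  let T := shift (par01 b) in let T' := coshift (par01 b) in
  let F := if b then fun u => u - diag (par01 b) u else id in
  match g with
  | S_f1 => (T, T')
  | S_fm1 => (T', T)
  | S_f0 => (F, F)
  end.

Lemma sphere_model_adjoint b g : adjoint_pair (sphere_model b g).
Proof.
have D u v : inner (u - diag (par01 true) u) v = inner u (v - diag (par01 true) v).
  by rewrite linearBl linearBr /= diag_adjoint.
have B : bounded_operator (fun u : H => u - diag (par01 true) u).
  rewrite (_ : (fun _ => _) = fun u : H => u + (-1) *: diag (par01 true) u).
    apply: bounded_operatorD; first exact: bounded_operator1.
    exact/bounded_operatorZ/diag_bounded.
  by apply/funext => u; rewrite scaleN1r.
case: g => /=; split=> //=; try exact: shift_bounded; try exact: coshift_bounded.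
- exact: shift_adjoint.
- by move=> x y; rewrite innerC -shift_adjoint -innerC.
- by case: b => //; exact: bounded_operator1.
- by case: b => //; exact: bounded_operator1.
- by case: b.
Qed.

Lemma sphere_model_rel b t u : sphere_rel p q t u ->
  op_eval (sphere_model b) t = op_eval (sphere_model b) u.
Proof.
have [lS _] := shift_bounded (par01 b); have [lC _] := coshift_bounded (par01 b).
have [lD _] := diag_bounded (par01 b).
have fB (f : H -> H) : linear f -> forall x y, f (x - y) = f x - f y.
  by move=> lf x y; rewrite addrC -scaleN1r lf scaleN1r addrC.
have f0 (f : H -> H) : linear f -> f 0 = 0 by exact: linear_f0.
have SB := fB _ lS; have CB := fB _ lC; have DB := fB _ lD.
have D0 := linear_f0 lD; have C0 := linear_f0 lC.
case=> //=; congr pair; apply/funext => x /=.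
all: rewrite ?conjC_real ?rmorph1 ?rmorphN ?rmorph1.
all: case: b lS lC lD SB CB DB D0 C0 => lS lC lD SB CB DB D0 C0.
all: rewrite ?scaleN1r ?coshift_shift ?shift_coshift ?opprB ?subrr ?addr0 ?SB ?CB ?DB.
all: rewrite ?diag_shift ?coshift_diag ?coshift_shift ?shift_coshift ?subrr ?D0.
all: rewrite ?subrKA ?subrr ?D0 ?subrr ?addr0 //.
all: apply/l2P => k; rewrite ?(coordB, coordD, coordZ) ?rmorphB ?rmorph1 /=; ring.
Qed.
End SphereModels.

(** * Nonvanishing of x and y in the completion *)

Section CompletionKernel.
Variable R : realType.
Implicit Types (P : starAlgType R[i]) (X : cstarAlgType R).

Lemma cnorm0 X : cnorm (0 : X) = 0.
Proof. by rewrite -(scale0r (0 : X)) cnormZ normr0 mul0r. Qed.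

(** An element killed by [iota] has [rep_norm] 0 and so acts as 0 in every representation. Used in
    contrapositive form: one representation shows that an element survives. *)
Lemma completion_ker P X (iota : {lrmorphism P -> X}) (H : hilbertType R[i])
    (rho : P -> H -> H) (a : P) (x : H) :
  cstar_completion iota -> star_representation rho ->
  iota a = 0 -> `|x| <= 1 -> rho a x = 0.
Proof.
move=> hX hrho ia0 x1; have := completion_norm hX a; rewrite ia0 cnorm0 => a0.
have h1 : (op_norm (rho a) <= rep_norm a)%E.
  by apply: ereal_sup_ubound; exists H, rho.
have : ((complex.Re `|rho a x|)%:E <= rep_norm a)%E.
  by apply: le_trans h1; apply: ereal_sup_ubound; exists x.
rewrite -a0 lee_fin => h2.
apply/eqP; rewrite -normr_eq0 -[`|_|]RRe_real ?normr_real //.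
have -> : complex.Re `|rho a x| = 0; last by rewrite rmorph0.
apply/eqP; rewrite eq_le; rewrite h2 /=.
by have := normr_ge0 (rho a x); rewrite lecE => /andP[].
Qed.

End CompletionKernel.

Section SphereGenerators.
Variables (R : realType) (p q : R).
Hypotheses (hp : 0 < p < 1) (hq : 0 < q < 1).
Local Notation P := (sphere_poly p q).

Definition sp (g : sphere_gen) : P := pres_class (@sphere_nontrivial R p q) (TGen g).

Variables (X : cstarAlgType R) (iota : {lrmorphism P -> X}).
Hypothesis hX : cstar_completion iota.

(** In the model [true], x fixes the first basis vector. *)
Lemma completion_x_neq0 : iota (1 - sp S_f0) != 0.
Proof.
have hm := sphere_model_adjoint hp hq true.
have hr := op_star_representation hm (sphere_model_rel hp hq true)
  (@sphere_nontrivial R p q).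
apply/eqP => i0.
have := completion_ker hX hr i0 (l2_basis0_norm R).
have -> : 1 - sp S_f0 = pres_class (@sphere_nontrivial R p q)
    (TAdd TOne (TScale (-1) (TGen S_f0))).
  by rewrite -pres_addE -pres_scaleE.
rewrite (op_eval_cong hm (sphere_model_rel hp hq true) (pres_reprP _ _)) /=.
rewrite scaleN1r opprB addrCA subrr addr0 diag_basis0 => /eqP.
by rewrite (negbTE (l2_basis0_neq0 R)).
Qed.

(** The element is -y; in the model [false] it negates the first basis vector. *)
Lemma completion_y_neq0 : iota (sp S_f1 * sp S_fm1 - sp S_f0) != 0.
Proof.
have hm := sphere_model_adjoint hp hq false.
have hr := op_star_representation hm (sphere_model_rel hp hq false)
  (@sphere_nontrivial R p q).
apply/eqP => i0.
have := completion_ker hX hr i0 (l2_basis0_norm R).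
have -> : sp S_f1 * sp S_fm1 - sp S_f0 = pres_class (@sphere_nontrivial R p q)
    (TAdd (TMul (TGen S_f1) (TGen S_fm1)) (TScale (-1) (TGen S_f0))).
  by rewrite -pres_addE -pres_scaleE -pres_mulE.
rewrite (op_eval_cong hm (sphere_model_rel hp hq false) (pres_reprP _ _)) /=.
rewrite scaleN1r shift_coshift diag_basis0 subrr sub0r => /eqP.
by rewrite oppr_eq0 (negbTE (l2_basis0_neq0 R)).
Qed.

End SphereGenerators.

(** * Elementary C*-algebra theory *)

Section PowerTrick.
Variable R : realType.

Lemma cvg_geo (K r : R) : 0 <= r < 1 -> (fun n => K * r ^+ n) @ \oo --> (0 : R).
Proof. by move=> /andP[r0 r1]; apply: cvg_geometric; rewrite ger0_norm. Qed.

Lemma bernoulli_ge (x : R) n : 0 <= x -> 1 + n%:R * x <= (1 + x) ^+ n.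
Proof.
move=> x0; elim: n => [|n IH]; first by rewrite mul0r addr0 expr0.
rewrite exprS; apply: le_trans (_ : (1 + x) * (1 + n%:R * x) <= _).
  have : 0 <= n%:R * x * x by rewrite !mulr_ge0.
  by rewrite -natr1; lra.
by rewrite ler_wpM2l // addr_ge0.
Qed.

(* The power trick: multiplicative inequalities hold without the constant, even
   when the constant grows linearly in the exponent. *)
Lemma pow2_bound_le (s r K : R) : 0 <= r -> 0 <= s ->
  (forall j, s ^+ (2 ^ j) <= K * (2 ^ j).+1%:R * r ^+ (2 ^ j)) -> s <= r.
Proof.
move=> r0 s0 h; rewrite leNgt; apply/negP => rs.
have sp : 0 < s by exact: le_lt_trans rs.
have [r00|rn0] := eqVneq r 0.
  have := h 0%N; rewrite r00 expn0 !expr1 mulr0 => s1.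
  by move: (lt_le_trans sp s1); rewrite ltxx.
have rp : 0 < r by rewrite lt_def rn0.
pose x := s / r - 1.
have x0 : 0 < x by rewrite subr_gt0 ltr_pdivlMr // mul1r.
have sE : s = (1 + x) * r by rewrite /x addrC subrK divfK.
have N1 j : (1 : R) <= (2 ^ j)%:R by rewrite ler1n expn_gt0.
(* Bernoulli's bound is linear in N = 2^j and would not beat a constant growing linearly. The
   exponent 2N squares it: N^2 x^2 <= K (2N + 1) <= 3 K N, hence N x^2 is bounded, which fails for
   large N. *)
have K1 j : (2 ^ j)%:R * x ^+ 2 <= 3 * K.
  have := h j.+1; rewrite sE exprMn ler_pM2r ?exprn_gt0 // expnS mulnC exprM => h1.
  have := bernoulli_ge (2 ^ j) (ltW x0); have := N1 j.
  move: h1; rewrite -natr1 natrM; set N := (2 ^ j)%:R; set y := _ ^+ (2 ^ j).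
  move=> h1 hN hy.
  have : (N * x) ^+ 2 <= y ^+ 2.
    have Nx : 0 <= N * x by rewrite mulr_ge0 ?ltW // (lt_le_trans _ hN).
    by rewrite ler_pXn2r ?nnegrE //; lra.
  have hN0 : 0 < N by exact: lt_le_trans hN.
  move=> h2; have h3 : N * (N * x ^+ 2) <= N * (3 * K); last by rewrite ler_pM2l in h3.
  have K0 : 0 <= K.
    have h4 := le_trans (le_trans (sqr_ge0 _) h2) h1.
    by move: h4; rewrite pmulr_lge0 //; lra.
  have : 0 <= K * (N - 1) by rewrite mulr_ge0 // subr_ge0.
  by nra.
have xx : 0 < x ^+ 2 by rewrite exprn_gt0.
have := archi_boundP (_ : 0 <= `|3 * K / x ^+ 2|); rewrite normr_ge0 => /(_ isT).
set j := Num.bound _ => hj.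
have := K1 j; rewrite -ler_pdivlMr // => hj2.
have : (j%:R : R) <= (2 ^ j)%:R by rewrite ler_nat ltnW // ltn_expl.
move=> hj3; have := le_lt_trans (le_trans hj3 hj2) (le_lt_trans (ler_norm _) hj).
by rewrite ltxx.
Qed.

Lemma pow2_bound_leC (s r K : R) : 0 <= r -> 0 <= s ->
  (forall j, s ^+ (2 ^ j) <= K * r ^+ (2 ^ j)) -> s <= r.
Proof.
move=> r0 s0 h; apply: (@pow2_bound_le s r `|K|) => // j; apply: le_trans (h j) _.
rewrite ler_wpM2r ?exprn_ge0 // (le_trans (ler_norm _)) // ler_peMr //.
by rewrite ler1n.
Qed.

End PowerTrick.

Section CStarBasics.
Variables (R : realType) (Z : cstarAlgType R).
Implicit Types (x y h : Z) (u v : nat -> Z) (k : R[i]).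

Lemma cnormN x : cnorm (- x) = cnorm x.
Proof. by rewrite -scaleN1r cnormZ normrN normr1 mul1r. Qed.

Lemma cnorm_ge0 x : 0 <= cnorm x.
Proof.
have := cnormD x (- x); rewrite subrr cnorm0 cnormN; lra.
Qed.

Lemma cnorm_nmZ k x : cnorm (k *: x) = nm k * cnorm x.
Proof. exact: cnormZ. Qed.

Lemma cnormB x y : cnorm (x - y) = cnorm (y - x).
Proof. by rewrite -cnormN opprB. Qed.

Lemma cnorm_eq0 x : (cnorm x == 0) = (x == 0).
Proof. by apply/eqP/eqP => [|->]; [exact: cnorm0_eq0|exact: cnorm0]. Qed.

Lemma cnorm_sum (I : Type) (s : seq I) (P : pred I) (F : I -> Z) :
  cnorm (\sum_(i <- s | P i) F i) <= \sum_(i <- s | P i) cnorm (F i).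
Proof.
elim/big_rec2: _ => [|i x y _ h]; first by rewrite cnorm0.
by apply: (le_trans (cnormD _ _)); rewrite lerD2l.
Qed.

Lemma starN (C : numClosedFieldType) (A : starAlgType C) (x : A) :
  star (- x) = - star x.
Proof. by rewrite -scaleN1r starZ rmorphN rmorph1 scaleN1r. Qed.

Lemma starB (C : numClosedFieldType) (A : starAlgType C) (x y : A) :
  star (x - y) = star x - star y.
Proof. by rewrite starD starN. Qed.

Lemma star0 (C : numClosedFieldType) (A : starAlgType C) : star (0 : A) = 0.
Proof. by rewrite -(scale0r (0 : A)) starZ rmorph0 !scale0r. Qed.

Lemma star1 (C : numClosedFieldType) (A : starAlgType C) : star (1 : A) = 1.
Proof. by rewrite -[LHS]mulr1 -[X in _ * X]starK -starM mulr1 starK. Qed.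

Lemma starX (C : numClosedFieldType) (A : starAlgType C) (x : A) n :
  star (x ^+ n) = star x ^+ n.
Proof.
by elim: n => [|n IH]; rewrite ?expr0 ?star1 // exprSr starM IH exprS.
Qed.

Lemma star_sum (C : numClosedFieldType) (A : starAlgType C) (I : Type)
    (s : seq I) (P : pred I) (F : I -> A) :
  star (\sum_(i <- s | P i) F i) = \sum_(i <- s | P i) star (F i).
Proof. by apply: big_morph; [exact: starD|exact: star0]. Qed.

(** The C*-identity and submultiplicativity give |y|^2 <= |y^*| |y|; applying this to y and to its
    adjoint gives both inequalities. *)
Lemma cnorm_starE x : cnorm (star x) = cnorm x.
Proof.
suff le y : cnorm y <= cnorm (star y).
  by apply/eqP; rewrite eq_le le -{2}[x]starK le.
have [->|y0] := eqVneq y 0; first by rewrite star0.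
have yp : 0 < cnorm y by rewrite lt_def cnorm_eq0 y0 cnorm_ge0.
by rewrite -(ler_pM2r yp) -expr2 -cnorm_star cnormM.
Qed.

Lemma cnorm1 : cnorm (1 : Z) = 1.
Proof.
have := cnorm_star (1 : Z); rewrite star1 mulr1 expr2.
have n0 : cnorm (1 : Z) != 0 by rewrite cnorm_eq0 oner_eq0.
by move=> h; apply: (mulfI n0); rewrite mulr1 -h.
Qed.

Lemma cnormX x n : cnorm (x ^+ n) <= cnorm x ^+ n.
Proof.
elim: n => [|n IH]; first by rewrite !expr0 cnorm1.
by rewrite !exprS (le_trans (cnormM _ _)) // ler_wpM2l ?cnorm_ge0.
Qed.

(** Iterated C*-identity. It is exact for exponents 2^j, the only ones used in the power trick. *)
Lemma cnorm_pow2 h j : star h = h -> cnorm (h ^+ (2 ^ j)) = cnorm h ^+ (2 ^ j).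
Proof.
move=> hs; elim: j => [|j IH]; first by rewrite expn0 !expr1.
rewrite expnS mulnC !exprM -IH -cnorm_star expr2; congr (cnorm (_ * _)).
by rewrite starX hs.
Qed.

Lemma cnorm_star_pow2 x j :
  cnorm ((star x * x) ^+ (2 ^ j)) = (cnorm x ^+ (2 ^ j)) ^+ 2.
Proof.
by rewrite cnorm_pow2 ?starM ?starK // cnorm_star -!exprM mulnC.
Qed.

Definition ccvg u (l : Z) : Prop := (fun n => cnorm (u n - l)) @ \oo --> (0 : R).

Lemma ccvg_bound u l (b : nat -> R) :
  (forall n, cnorm (u n - l) <= b n) -> b @ \oo --> (0 : R) -> ccvg u l.
Proof.
move=> ub b0; apply: (squeeze_cvgr (f := fun=> 0) (h := b)) => //; last exact: cvg_cst.
by near=> n; rewrite cnorm_ge0 ub.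
Unshelve. all: by end_near. Qed.

Lemma ccvg_unique u l m : ccvg u l -> ccvg u m -> l = m.
Proof.
move=> ul um; apply/eqP; rewrite -subr_eq0 -cnorm_eq0; apply/eqP.
have h : (fun=> cnorm (l - m)) @ \oo --> (0 : R).
  apply: (squeeze_cvgr (f := fun=> 0)
    (h := fun n => cnorm (u n - l) + cnorm (u n - m))).
  - near=> n; rewrite cnorm_ge0 /= (cnormB (u n)); apply: le_trans (cnormD _ _).
    by rewrite addrA subrK.
  - exact: cvg_cst.
  - by rewrite -[0 in X in _ --> X]addr0; exact: cvgD.
exact: (cvg_unique _ (cvg_cst _) h).
Unshelve. all: by end_near. Qed.

Lemma ccvg_cst (l : Z) : ccvg (fun=> l) l.
Proof. by rewrite /ccvg; under eq_fun do rewrite subrr cnorm0; exact: cvg_cst. Qed.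

Lemma ccvgD u v l m : ccvg u l -> ccvg v m -> ccvg (fun n => u n + v n) (l + m).
Proof.
move=> ul vm; apply: (ccvg_bound (b := fun n => cnorm (u n - l) + cnorm (v n - m))).
  by move=> n; rewrite opprD addrACA cnormD.
by rewrite -[0 in X in _ --> X]addr0; exact: cvgD.
Qed.

Lemma ccvgZ k u l : ccvg u l -> ccvg (fun n => k *: u n) (k *: l).
Proof.
move=> ul; apply: (ccvg_bound (b := fun n => nm k * cnorm (u n - l))).
  by move=> n; rewrite -scalerBr cnorm_nmZ.
by rewrite -[0 in X in _ --> X](mulr0 (nm k)); apply: cvgM => //; exact: cvg_cst.
Qed.

Lemma ccvgN u l : ccvg u l -> ccvg (fun n => - u n) (- l).
Proof.
move=> /(ccvgZ (-1)); rewrite scaleN1r; under eq_fun do rewrite scaleN1r; exact.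
Qed.

Lemma ccvgB u v l m : ccvg u l -> ccvg v m -> ccvg (fun n => u n - v n) (l - m).
Proof. by move=> ul vm; apply: ccvgD => //; exact: ccvgN. Qed.

Lemma ccvgM u v l m : ccvg u l -> ccvg v m -> ccvg (fun n => u n * v n) (l * m).
Proof.
move=> ul vm.
apply: (ccvg_bound (b := fun n => cnorm (u n - l) * cnorm (v n - m) +
  (cnorm (u n - l) * cnorm m + cnorm l * cnorm (v n - m)))) => [n|].
  have -> : u n * v n - l * m =
     (u n - l) * (v n - m) + ((u n - l) * m + l * (v n - m)).
    by rewrite addrA -mulrDr subrK mulrBl mulrBr subrKA.
  apply: (le_trans (cnormD _ _)); apply: lerD; first exact: cnormM.
  by apply: (le_trans (cnormD _ _)); apply: lerD; exact: cnormM.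
have cM (f g : nat -> R) (a b : R) : f @ \oo --> a -> g @ \oo --> b ->
  (fun n => f n * g n) @ \oo --> a * b by move=> *; exact: cvgM.
rewrite -[0 in X in _ --> X](mulr0 0) -[0 * 0]addr0; apply: cvgD; first exact: cM.
rewrite -[0 in X in _ --> X](mul0r (cnorm m)) -[0 * _]addr0; apply: cvgD.
  by apply: cM => //; exact: cvg_cst.
by rewrite -[0 in X in _ --> X](mulr0 (cnorm l)); apply: cM => //; exact: cvg_cst.
Qed.

Lemma ccvgMl x u l : ccvg u l -> ccvg (fun n => x * u n) (x * l).
Proof. exact/ccvgM/ccvg_cst. Qed.

Lemma ccvgMr x u l : ccvg u l -> ccvg (fun n => u n * x) (l * x).
Proof. by move=> h; apply: ccvgM => //; exact: ccvg_cst. Qed.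

Lemma ccvg_star u l : ccvg u l -> ccvg (fun n => star (u n)) (star l).
Proof.
by move=> ul; rewrite /ccvg; under eq_fun do rewrite -starB cnorm_starE.
Qed.

Lemma ccvg_le u l (M : R) : ccvg u l -> (forall n, cnorm (u n) <= M) -> cnorm l <= M.
Proof.
move=> ul uM; apply/ler_addgt0Pr => e e0.
have /cvgrPdist_lt/(_ e e0)[N _ /(_ N (leqnn N))] := ul.
rewrite sub0r normrN ger0_norm ?cnorm_ge0 // => h.
rewrite -[l](subrK (u N)); apply: (le_trans (cnormD _ _)).
by rewrite addrC lerD // cnormB ltW.
Qed.

Lemma ccvgS u l : ccvg u l -> ccvg (fun n => u n.+1) l.
Proof.
by move=> ul; rewrite /ccvg (cvg_shiftS (fun n => cnorm (u n - l))).
Qed.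

(** The sole entry point of completeness: every limit constructed below is approached at a geometric
    rate. *)
Lemma ccvg_geo_ex u (K r : R) : 0 <= r < 1 ->
  (forall n, cnorm (u n.+1 - u n) <= K * r ^+ n) -> exists l, ccvg u l.
Proof.
move=> r01 hu; case/andP: (r01) => r0 r1.
have r1' : 0 < 1 - r by rewrite subr_gt0.
have tele m n : cnorm (u (n + m)%N - u m) <= (K / (1 - r)) * r ^+ m.
  have K0 : 0 <= K by have := le_trans (cnorm_ge0 _) (hu 0%N); rewrite expr0 mulr1.
  (* Keeping the term - r^(n+m) makes the induction on n telescope. *)
  suff h : cnorm (u (n + m)%N - u m) <= (K / (1 - r)) * (r ^+ m - r ^+ (n + m)).
    apply: (le_trans h); apply: ler_wpM2l; first by rewrite divr_ge0 // ltW.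
    by rewrite gerBl exprn_ge0.
  elim: n => [|n IH]; first by rewrite add0n !subrr cnorm0 mulr0.
  rewrite addSn -[u _](subrK (u (n + m)%N)) -addrA.
  apply: (le_trans (cnormD _ _)); apply: (le_trans (lerD (hu _) IH)).
  rewrite le_eqVlt; apply/orP; left; apply/eqP.
  by rewrite exprS; field; rewrite gt_eqF.
have cz := cvg_geo (K / (1 - r)) r01.
have cauchy e : 0 < e -> exists N : nat, forall m n : nat,
    (N <= m)%N -> (N <= n)%N -> cnorm (u m - u n) < e.
  move=> e0; have e20 : 0 < e / 2 by rewrite divr_gt0.
  have /cvgrPdist_lt/(_ _ e20)[N _ /(_ N (leqnn N))] := cz.
  rewrite sub0r normrN => /ltr_normlW hN; exists N => m n Nm Nn.
  have tN (k : nat) : (N <= k)%N -> cnorm (u k - u N) < e / 2.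
    by move=> Nk; rewrite -[k](subnK Nk); exact: le_lt_trans (tele _ _) hN.
  rewrite -[u m](subrK (u N)) -addrA (splitr e).
  apply: (le_lt_trans (cnormD _ _)); apply: ltrD; first exact: tN.
  by rewrite cnormB; exact: tN.
have [l hl] := cnorm_complete u cauchy; exists l; apply/cvgrPdist_lt => e e0.
have [N hN] := hl e e0; exists N => // n /= Nn.
by rewrite sub0r normrN ger0_norm ?cnorm_ge0 ?hN.
Qed.

End CStarBasics.

(** * Neumann series and square roots *)

Section Neumann.
Variables (R : realType) (Z : cstarAlgType R).
Implicit Types (x y h : Z).

Definition cinvertible x := exists y, y * x = 1 /\ x * y = 1.

Lemma neumann_inverse x : cnorm x < 1 -> cinvertible (1 - x).
Proof.
move=> x1; have r01 : 0 <= cnorm x < 1 by rewrite cnorm_ge0.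
pose u n : Z := \sum_(k < n) x ^+ k.
have hu n : cnorm (u n.+1 - u n) <= 1 * cnorm x ^+ n.
  by rewrite /u big_ord_recr /= addrAC subrr add0r mul1r cnormX.
have [y uy] := ccvg_geo_ex r01 hu.
have xn : ccvg (fun n => 1 - x ^+ n) (1 : Z).
  apply: (ccvg_bound (b := fun n => 1 * cnorm x ^+ n)); last exact: cvg_geo.
  by move=> n; rewrite addrAC subrr add0r cnormN mul1r cnormX.
have comm n : u n * x = x * u n.
  by rewrite /u mulr_suml mulr_sumr; apply: eq_bigr => k _; rewrite -exprS exprSr.
have E n : (1 - x) * u n = 1 - x ^+ n.
  rewrite /u; elim: n => [|n IH]; first by rewrite big_ord0 mulr0 expr0 subrr.
  by rewrite big_ord_recr /= mulrDr IH mulrBl mul1r -exprS subrKA.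
exists y; split; apply: ccvg_unique xn.
  have := ccvgMr (1 - x) uy; congr ccvg; apply/funext => n.
  by rewrite -E mulrBr mulrBl comm mulr1 mul1r.
by have := ccvgMl (1 - x) uy; congr ccvg; apply/funext => n; rewrite E.
Qed.

(** With s = 1 - l the equation s^2 = 1 - h^2 reads l = (h^2 + l^2) / 2, which is solved by
    iteration from 0. *)
Lemma sqrt_one_sub_sqr h : star h = h -> cnorm h < 1 ->
  exists s, [/\ star s = s, s * s = 1 - h * h & s * h = h * s].
Proof.
move=> hs h1; set r := cnorm h; have r0 : 0 <= r by exact: cnorm_ge0.
have r2 : 0 < 1 - r ^+ 2 by rewrite subr_gt0 expr_lt1.
(* c solves the scalar equation c = (r^2 + c^2) / 2. It bounds all the iterates, and as c < 1 it is
   also the contraction ratio. *)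
pose c := 1 - Num.sqrt (1 - r ^+ 2).
have c1 : c < 1 by rewrite /c gtrBl sqrtr_gt0.
have c0 : 0 <= c.
  by rewrite subr_ge0 -[leRHS]sqrtr1 ler_wsqrtr // gerBl sqr_ge0.
have cE : (r ^+ 2 + c ^+ 2) / 2 = c.
  have := sqr_sqrtr (ltW r2); rewrite /c; set t := Num.sqrt _ => tE.
  have -> : r ^+ 2 = 1 - t ^+ 2 by rewrite tE; ring.
  by field.
pose k := fix k n : Z := if n is m.+1 then 2^-1 *: (h * h + k m * k m) else 0.
have nm2 : nm (2^-1 : R[i]) = 2^-1.
  by rewrite -[2^-1]/(2%:R^-1) -(rmorph_nat (real_complex R)) -fmorphV nm_real ger0_norm // invr_ge0.
have kn n : cnorm (k n) <= c.
  elim: n => [|n IH] /=; first by rewrite cnorm0.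
  rewrite cnorm_nmZ nm2 -cE mulrC ler_wpM2r ?invr_ge0 //.
  apply: (le_trans (cnormD _ _)); apply: lerD; first by rewrite expr2 cnormM.
  by apply: (le_trans (cnormM _ _)); rewrite expr2 ler_pM ?cnorm_ge0.
have kd n : cnorm (k n.+1 - k n) <= cnorm (k 1%N - k 0%N) * c ^+ n.
  elim: n => [|n IH]; first by rewrite expr0 mulr1.
  rewrite exprS mulrCA; apply: le_trans (_ : c * cnorm (k n.+1 - k n) <= _).
    rewrite [in leLHS]/= -/(k n.+1) -scalerBr cnorm_nmZ nm2.
    rewrite opprD addrACA subrr add0r.
    have -> : k n.+1 * k n.+1 - k n * k n =
        k n.+1 * (k n.+1 - k n) + (k n.+1 - k n) * k n.
      by rewrite mulrBr mulrBl subrKA.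
    rewrite mulrC ler_pdivrMr // mulrAC; apply: (le_trans (cnormD _ _)).
    have -> : c * 2 * cnorm (k n.+1 - k n) =
      c * cnorm (k n.+1 - k n) + cnorm (k n.+1 - k n) * c by ring.
    by apply: lerD; apply: (le_trans (cnormM _ _)); rewrite ler_pM ?cnorm_ge0.
  by rewrite ler_wpM2l.
have [l kl] := ccvg_geo_ex (introT andP (conj c0 c1)) kd.
have ks n : star (k n) = k n.
  elim: n => [|n IH] /=; first exact: star0.
  rewrite starZ starD !starM hs IH; congr (_ *: _).
  by rewrite fmorphV rmorph_nat.
have kh n : k n * h = h * k n.
  elim: n => [|n IH] /=; first by rewrite mul0r mulr0.
  rewrite -scalerAl -scalerAr mulrDl mulrDr mulrA; congr (_ *: (_ + _)).
  by rewrite -mulrA IH !mulrA IH.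
have lE : l = 2^-1 *: (h * h + l * l).
  apply: (ccvg_unique (ccvgS kl)).
  by apply: ccvgZ; apply: ccvgD; [exact: ccvg_cst|exact: ccvgM].
have lE2 : l + l = h * h + l * l.
  rewrite {1 2}lE -scalerDl -[in RHS](scale1r (h * h + l * l)); congr (_ *: _).
  by field.
exists (1 - l); split.
- rewrite starB star1; congr (_ - _); apply: (ccvg_unique (ccvg_star kl)).
  by under eq_fun do rewrite ks.
- rewrite mulrBl mul1r mulrBr mulr1 opprB addrA.
  rewrite -[1 - l + l * l - l]addrA -addrA; congr (_ + _).
  have -> : h * h = l + l - l * l by rewrite lE2 addrK.
  by rewrite !opprB opprD addrCA.
- rewrite mulrBl mulrBr mul1r mulr1; congr (_ - _).
  apply: (ccvg_unique (ccvgMr h kl)).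
  by under eq_fun do rewrite kh; exact: ccvgMl.
Qed.

End Neumann.

Section Contractive.
Variables (R : realType) (Y Z : cstarAlgType R) (f : {lrmorphism Y -> Z}).
Hypothesis fs : star_morphism f.

(* A selfadjoint contraction h is the real part of the unitary
   h + i sqrt(1 - h^2), and unitaries are sent to unitaries. *)
Lemma morphism_unit_ball (h : Y) : star h = h -> cnorm h < 1 -> cnorm (f h) <= 1.
Proof.
move=> hs h1; have [s [ss s2 sh]] := sqrt_one_sub_sqr hs h1.
pose u := h + 'i%C *: s.
have us : star u = h - 'i%C *: s.
  by rewrite starD starZ hs ss complexiE conjCi scaleNr.
have uu : star u * u = 1.
  rewrite us mulrDr !mulrBl -!scalerAl -!scalerAr scalerA -(expr2 'i%C) sqr_i.
  by rewrite scaleN1r opprK s2 sh subrKA addrC subrK.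
have fu : cnorm (f u) = 1.
  apply/eqP; rewrite -[_ == _](@eqrXn2 _ 2) ?cnorm_ge0 // -cnorm_star -fs -rmorphM.
  by rewrite uu rmorph1 cnorm1 expr1n.
have hE : h = 2^-1 *: (u + star u).
  rewrite us /u addrACA subrr addr0 scalerDr -scalerDl.
  by rewrite (_ : 2^-1 + 2^-1 = 1) ?scale1r //; field.
have nm2 : nm (2^-1 : R[i]) = 2^-1.
  by rewrite -[2^-1]/(2%:R^-1) -(rmorph_nat (real_complex R)) -fmorphV nm_real ger0_norm // invr_ge0.
rewrite hE linearZ cnorm_nmZ nm2 mulrC ler_pdivrMr // mul1r rmorphD /=.
by apply: (le_trans (cnormD _ _)); rewrite fs cnorm_starE fu.
Qed.

(** Selfadjoint elements are scaled by 1 / (|h| + e) into the open unit ball; a general element is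
    reduced to [star a * a] by the C*-identity. *)
Lemma morphism_contractive (a : Y) : cnorm (f a) <= cnorm a.
Proof.
have sa (h : Y) : star h = h -> cnorm (f h) <= cnorm h.
  move=> hs; apply/ler_addgt0Pr => e e0; set t := cnorm h + e.
  have t0 : 0 < t by rewrite ltr_wpDl ?cnorm_ge0.
  have nmt : nm (t^-1)%:C%C = t^-1 by rewrite nm_real ger0_norm // invr_ge0 ltW.
  have := @morphism_unit_ball ((t^-1)%:C%C *: h).
  rewrite starZ hs conjC_real => /(_ erefl).
  rewrite linearZ !cnorm_nmZ nmt mulrC ltr_pdivrMr // mul1r ltrDl => /(_ e0).
  by rewrite mulrC ler_pdivrMr // mul1r.
rewrite -(ler_pXn2r (n := 2)) ?nnegrE ?cnorm_ge0 // -!cnorm_star -fs -rmorphM.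
by apply: sa; rewrite starM starK.
Qed.

Lemma morphism_ccvg (u : nat -> Y) (l : Y) :
  ccvg u l -> ccvg (fun n => f (u n)) (f l).
Proof.
move=> ul; apply: (ccvg_bound (b := fun n => cnorm (u n - l))) => // n.
by rewrite -rmorphB morphism_contractive.
Qed.

End Contractive.

(** * Diagonal elements over orthogonal projections *)

(* A function on the index type option (bool * nat) stands for two sequences
   (indexed by true and false) together with their common limit, the value at
   None. *)
Definition didx : Type := option (bool * nat).

Section DiagonalSequences.
Variable R : realType.
Local Notation C := R[i].
Implicit Types (u v : didx -> C).

(** A geometric rate, uniform in both sequences, is stable under sums, products and index shifts,
    and matches the hypothesis of [ccvg_geo_ex]. *)
Definition geo v := exists K r : R, 0 <= r < 1 /\
  forall b k, nm (v (Some (b, k)) - v None) <= K * r ^+ k.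

Lemma geo_weaken v (K r K' r' : R) : 0 <= r <= r' -> K <= K' -> 0 <= K ->
  (forall b k, nm (v (Some (b, k)) - v None) <= K * r ^+ k) ->
  forall b k, nm (v (Some (b, k)) - v None) <= K' * r' ^+ k.
Proof.
move=> /andP[r0 rr] KK K0 h b k; apply: (le_trans (h b k)).
by apply: ler_pM; rewrite ?exprn_ge0 // lerXn2r ?nnegrE // (le_trans r0).
Qed.

Lemma geo2 u v : geo u -> geo v -> exists K r : R, [/\ 0 <= r < 1, 0 <= K,
  forall b k, nm (u (Some (b, k)) - u None) <= K * r ^+ k &
  forall b k, nm (v (Some (b, k)) - v None) <= K * r ^+ k].
Proof.
move=> [K [r [/andP[r0 r1] hu]]] [K' [r' [/andP[r0' r1'] hv]]].
have K0 : 0 <= K by have := le_trans (nm_ge0 _) (hu true 0%N); rewrite expr0 mulr1.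
have K0' : 0 <= K' by have := le_trans (nm_ge0 _) (hv true 0%N); rewrite expr0 mulr1.
exists (Num.max K K'), (Num.max r r'); split.
- by rewrite le_max r0 /= gt_max r1.
- by rewrite le_max K0.
- by apply: geo_weaken hu; rewrite // ?r0 le_max lexx.
- by apply: geo_weaken hv; rewrite // ?r0' le_max lexx orbT.
Qed.

Lemma geo_const (c : C) : geo (fun=> c).
Proof. by exists 0, 0; split=> [|b k]; rewrite ?lexx ?ltr01 // subrr nm0 mul0r. Qed.

Lemma geoD u v : geo u -> geo v -> geo (fun i => u i + v i).
Proof.
move=> gu gv; have [K [r [r01 K0 hu hv]]] := geo2 gu gv.
exists (K + K), r; split=> // b k.
have -> : u (Some (b, k)) + v (Some (b, k)) - (u None + v None) =
  (u (Some (b, k)) - u None) + (v (Some (b, k)) - v None) by ring.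
by rewrite mulrDl (le_trans (nmD _ _)) // lerD.
Qed.

Lemma geoM u v : geo u -> geo v -> geo (fun i => u i * v i).
Proof.
move=> gu gv; have [K [r [r01 K0 hu hv]]] := geo2 gu gv.
case/andP: (r01) => r0 r1.
exists (K * (nm (v None) + K) + nm (u None) * K), r; split=> // b k.
have -> : u (Some (b, k)) * v (Some (b, k)) - u None * v None =
  (u (Some (b, k)) - u None) * v (Some (b, k)) +
  u None * (v (Some (b, k)) - v None) by ring.
rewrite [leRHS]mulrDl (le_trans (nmD _ _)) // !nmM; apply: lerD; last first.
  by rewrite -mulrA ler_wpM2l ?nm_ge0.
rewrite mulrAC ler_pM ?nm_ge0 //.
rewrite -[v (Some _)](subrK (v None)) addrC (le_trans (nmD _ _)) // lerD2l.
by rewrite (le_trans (hv b k)) // ler_piMr // exprn_ile1 // ltW.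
Qed.

Lemma geoZ (c : C) v : geo v -> geo (fun i => c * v i).
Proof. exact/geoM/geo_const. Qed.

Lemma geoN v : geo v -> geo (fun i => - v i).
Proof. by move/(geoZ (-1)); congr geo; apply/funext => i; rewrite mulN1r. Qed.

Lemma geo_conj v : geo v -> geo (fun i => (v i)^*).
Proof.
move=> [K [r [r01 h]]]; exists K, r; split=> // b k.
by rewrite -rmorphB nm_conj.
Qed.

Definition dshift v : didx -> C :=
  fun i => if i is Some (b, k) then v (Some (b, k.+1)) else v None.

Lemma geo_shift v : geo v -> geo (dshift v).
Proof.
move=> [K [r [r01 h]]]; exists (K * r), r; split=> // b k.
by rewrite -mulrA -exprS; exact: h.
Qed.

Lemma geo_bounded v : geo v -> exists2 M : R, 0 <= M & forall i, nm (v i) <= M.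
Proof.
move=> [K [r [/andP[r0 r1] h]]].
have K0 : 0 <= K by have := le_trans (nm_ge0 _) (h true 0%N); rewrite expr0 mulr1.
exists (K + nm (v None)); first by rewrite addr_ge0 ?nm_ge0.
move=> [[b k]|]; last by rewrite lerDr.
rewrite -[v _](subrK (v None)) (le_trans (nmD _ _)) // lerD2r.
by rewrite (le_trans (h b k)) // ler_piMr // exprn_ile1 // ltW.
Qed.

End DiagonalSequences.

Section DiagonalCalculus.
Variables (R : realType) (Z : cstarAlgType R).
Local Notation C := R[i].
Implicit Types (u v : didx -> C) (e : bool -> nat -> Z).

Definition oproj e := (forall b k, star (e b k) = e b k) /\
  forall b k b' k',
    e b k * e b' k' = if (b == b') && (k == k') then e b k else 0.

(** The element equal to v on the projections with index below n and to the limit [v None] on their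
    complement. Because the complement is included, [dpart e ^~ n] is a unital star-homomorphism for
    each n, before any limit is taken. *)
Definition dpart e v n : Z := v None *: 1 +
  \sum_(i : bool * 'I_n) (v (Some (i.1, i.2 : nat)) - v None) *: e i.1 i.2.

Lemma dpartD e u v n : dpart e (fun i => u i + v i) n = dpart e u n + dpart e v n.
Proof.
rewrite /dpart /= [RHS]addrACA -scalerDl -big_split /=; congr (_ + _).
by apply: eq_bigr => i _; rewrite -scalerDl; congr (_ *: _); ring.
Qed.

Lemma dpart_const e (c : C) n : dpart e (fun=> c) n = c *: 1.
Proof. by rewrite /dpart big1 ?addr0 // => i _; rewrite subrr scale0r. Qed.

Lemma dpart_conj e v n : oproj e -> dpart e (fun i => (v i)^*) n = star (dpart e v n).
Proof.
move=> [es _]; rewrite /dpart starD starZ star1 star_sum; congr (_ + _).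
by apply: eq_bigr => i _; rewrite starZ es rmorphB.
Qed.

Lemma dpartM e u v n : oproj e ->
  dpart e (fun i => u i * v i) n = dpart e u n * dpart e v n.
Proof.
move=> [_ eM]; rewrite /dpart /=.
set S := \sum_(i : bool * 'I_n) (u _ - _) *: _.
set T := \sum_(i : bool * 'I_n) (v _ - _) *: _.
have ST : S * T = \sum_(i : bool * 'I_n) ((u (Some (i.1, i.2 : nat)) - u None) *
    (v (Some (i.1, i.2 : nat)) - v None)) *: e i.1 i.2.
  rewrite /S mulr_suml; apply: eq_bigr => i _.
  rewrite /T mulr_sumr (bigD1 i) //= big1 ?addr0; last first.
    move=> j ji; rewrite -scalerAl -scalerAr eM.
    case: ifP => [/andP[/eqP h1 /eqP h2]|_]; last by rewrite !scaler0.
    case/negP: ji; apply/eqP; case: i j h1 h2 => [b k] [b' k'] /= -> h2.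
    by congr pair; apply: val_inj.
  by rewrite -scalerAl -scalerAr eM !eqxx /= scalerA.
rewrite mulrDl !mulrDr ST -!scalerAl !mul1r -scalerAr mulr1 scalerA.
rewrite -[RHS]addrA; congr (_ + _).
rewrite /S /T !scaler_sumr -!big_split /=; apply: eq_bigr => i _.
by rewrite !scalerA -!scalerDl; congr (_ *: _); ring.
Qed.

Lemma dpart_rec e v n : dpart e v n.+1 = dpart e v n +
  \sum_(b : bool) (v (Some (b, n)) - v None) *: e b n.
Proof.
rewrite /dpart -addrA; congr (_ + _).
pose F b k : Z := (v (Some (b, k)) - v None) *: e b k.
rewrite -(pair_bigA _ (fun b (k : 'I_n.+1) => F b k)) /=.
rewrite -(pair_bigA _ (fun b (k : 'I_n) => F b k)) /= -big_split /=.
by apply: eq_bigr => b _; rewrite big_ord_recr.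
Qed.

Lemma dpart_recl e v n : dpart e v n.+1 = v None *: 1 +
  \sum_(b : bool) (v (Some (b, 0%N)) - v None) *: e b 0%N +
  \sum_(i : bool * 'I_n) (v (Some (i.1, i.2.+1)) - v None) *: e i.1 i.2.+1.
Proof.
rewrite /dpart -addrA; congr (_ + _).
pose F b k : Z := (v (Some (b, k)) - v None) *: e b k.
rewrite -(pair_bigA _ (fun b (k : 'I_n.+1) => F b k)) /=.
rewrite -(pair_bigA _ (fun b (k : 'I_n) => F b k.+1)) /= -big_split /=.
by apply: eq_bigr => b _; rewrite big_ord_recl.
Qed.

Lemma oproj_norm e b k : oproj e -> cnorm (e b k) <= 1.
Proof.
move=> [es eM]; have := cnorm_star (e b k); rewrite es eM !eqxx /= expr2 => h.
have [->//|n0] := eqVneq (cnorm (e b k)) 0.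
by have -> : cnorm (e b k) = 1 by apply: (mulfI n0); rewrite -h mulr1.
Qed.

Lemma dpart_norm_crude e v n (M : R) : oproj e -> (forall i, nm (v i) <= M) ->
  cnorm (dpart e v n) <= (4 * n%:R + 1) * M.
Proof.
move=> oe vM; rewrite /dpart (le_trans (cnormD _ _)) // mulrDl mul1r addrC lerD //.
  apply: (le_trans (cnorm_sum _ _ _)).
  apply: le_trans (_ : \sum_(i : bool * 'I_n) (2 * M) <= _).
    apply: ler_sum => i _; rewrite cnorm_nmZ -[leRHS]mulr1.
    apply: ler_pM; rewrite ?nm_ge0 ?cnorm_ge0 ?oproj_norm //.
    apply: (le_trans (nmD _ _)); rewrite nmN.
    by have := vM None; have := vM (Some (i.1, i.2 : nat)); lra.
  rewrite sumr_const card_prod card_bool card_ord -[leLHS]mulr_natr natrM.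
  by rewrite le_eqVlt; apply/orP; left; apply/eqP; ring.
by rewrite cnorm_nmZ cnorm1 mulr1.
Qed.

Lemma dpartX e v n m : oproj e ->
  dpart e (fun i => v i ^+ m) n = dpart e v n ^+ m.
Proof.
move=> oe; elim: m => [|m IH].
  by under [X in dpart _ X]eq_fun do rewrite expr0; rewrite dpart_const scale1r expr0.
by under [X in dpart _ X]eq_fun do rewrite exprS; rewrite dpartM // IH exprS.
Qed.

(** For fixed n the crude bound is applied to v^* v raised to powers 2^j. Its factor 4n + 1 does not
    depend on j and disappears by [pow2_bound_leC]. *)
Lemma dpart_norm e v n (M : R) : oproj e -> (forall i, nm (v i) <= M) ->
  cnorm (dpart e v n) <= M.
Proof.
move=> oe vM; have M0 : 0 <= M by exact: le_trans (nm_ge0 _) (vM None).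
rewrite -(ler_pXn2r (n := 2)) ?nnegrE ?cnorm_ge0 //.
apply: (@pow2_bound_leC _ _ _ (4 * n%:R + 1)); rewrite ?sqr_ge0 // => j.
rewrite -exprM mulnC exprM -cnorm_star_pow2 -dpart_conj // -dpartM // -dpartX //.
apply: dpart_norm_crude => // i; rewrite nmX nmM nm_conj -expr2.
by apply: lerXn2r; rewrite ?nnegrE ?sqr_ge0 // lerXn2r ?nnegrE ?nm_ge0.
Qed.

(** The default 0 is never met for orthogonal projections and geometric v, since [dval_cvg] then
    provides the limit. *)
Definition dval e v : Z := xget 0 [set l | ccvg (dpart e v) l].

Lemma dval_cvg e v : oproj e -> geo v -> ccvg (dpart e v) (dval e v).
Proof.
move=> oe [K [r [r01 h]]].
have [l hl] : exists l, ccvg (dpart e v) l.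
  apply: (ccvg_geo_ex (K := 2 * K) r01) => n.
  rewrite dpart_rec addrAC subrr add0r (le_trans (cnorm_sum _ _ _)) //.
  rewrite big_bool /= !cnorm_nmZ -mulrA mulrDl mul1r.
  by rewrite lerD // -[leRHS]mulr1 ler_pM ?nm_ge0 ?cnorm_ge0 ?oproj_norm.
by rewrite /dval; case: xgetP => [l' -> //|/(_ l)].
Qed.

Lemma dvalE e v l : oproj e -> geo v -> ccvg (dpart e v) l -> dval e v = l.
Proof. by move=> oe gv; exact/ccvg_unique/dval_cvg. Qed.

Lemma dval_const e (c : C) : oproj e -> dval e (fun=> c) = c *: 1.
Proof.
move=> oe; apply: dvalE => //; first exact: geo_const.
by rewrite (_ : dpart _ _ = fun=> c *: 1);
  [exact: ccvg_cst|apply/funext => n; rewrite dpart_const].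
Qed.

Lemma dvalD e u v : oproj e -> geo u -> geo v ->
  dval e (fun i => u i + v i) = dval e u + dval e v.
Proof.
move=> oe gu gv; apply: dvalE => //; first exact: geoD.
rewrite (_ : dpart _ _ = fun n => dpart e u n + dpart e v n).
  by apply: ccvgD; exact: dval_cvg.
by apply/funext => n; rewrite dpartD.
Qed.

Lemma dvalM e u v : oproj e -> geo u -> geo v ->
  dval e (fun i => u i * v i) = dval e u * dval e v.
Proof.
move=> oe gu gv; apply: dvalE => //; first exact: geoM.
rewrite (_ : dpart _ _ = fun n => dpart e u n * dpart e v n).
  by apply: ccvgM; exact: dval_cvg.
by apply/funext => n; rewrite dpartM.
Qed.

Lemma dvalZ e (c : C) v : oproj e -> geo v ->
  dval e (fun i => c * v i) = c *: dval e v.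
Proof.
move=> oe gv; rewrite (dvalM (u := fun=> c)) ?dval_const //; last exact: geo_const.
by rewrite -scalerAl mul1r.
Qed.

Lemma dvalN e v : oproj e -> geo v -> dval e (fun i => - v i) = - dval e v.
Proof.
move=> oe gv; rewrite -scaleN1r -dvalZ //; congr dval.
by apply/funext => i; rewrite mulN1r.
Qed.

Lemma dvalB e u v : oproj e -> geo u -> geo v ->
  dval e (fun i => u i - v i) = dval e u - dval e v.
Proof. by move=> oe gu gv; rewrite dvalD ?dvalN //; exact: geoN. Qed.

Lemma dval_star e v : oproj e -> geo v ->
  star (dval e v) = dval e (fun i => (v i)^*).
Proof.
move=> oe gv; apply/esym/dvalE => //; first exact: geo_conj.
rewrite (_ : dpart _ _ = fun n => star (dpart e v n)).
  exact/ccvg_star/dval_cvg.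
by apply/funext => n; rewrite dpart_conj.
Qed.

Lemma dval_norm e v (M : R) : oproj e -> geo v -> (forall i, nm (v i) <= M) ->
  cnorm (dval e v) <= M.
Proof.
by move=> oe gv vM; apply: (ccvg_le (dval_cvg oe gv)) => n; exact: dpart_norm.
Qed.

Lemma dpart_mulr e v b k n : oproj e -> (k < n)%N ->
  dpart e v n * e b k = v (Some (b, k)) *: e b k.
Proof.
move=> oe kn; have [_ eM] := oe.
rewrite /dpart mulrDl -scalerAl mul1r mulr_suml.
rewrite (bigD1 (b, Ordinal kn)) //= big1 ?addr0.
  by rewrite -scalerAl eM !eqxx /= -scalerDl addrC subrK.
move=> [b' k'] /= h; rewrite -scalerAl eM.
case: ifP => [/andP[/eqP h1 /eqP h2]|_]; last by rewrite scaler0.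
by case/eqP: h; rewrite h1; congr pair; apply: val_inj.
Qed.

Lemma dval_mulr e v b k : oproj e -> geo v ->
  dval e v * e b k = v (Some (b, k)) *: e b k.
Proof.
move=> oe gv; have c1 := ccvgMr (e b k) (dval_cvg oe gv).
apply: (ccvg_unique c1); apply/cvgrPdist_lt => eps eps0; exists k.+1 => // n /= kn.
by rewrite dpart_mulr // subrr cnorm0 subr0 normr0.
Qed.

(** The partial sum of order n+1 on the left matches the one of order n on the right: the terms of
    index 0 are killed by w and the others move down by one. *)
Lemma dval_shift e v w : oproj e -> geo v ->
  (forall b k, e b k.+1 * w = w * e b k) -> (forall b, e b 0%N * w = 0) ->
  dval e v * w = w * dval e (dshift v).
Proof.
move=> oe gv eS e0; have gs := geo_shift gv.
apply: (ccvg_unique (ccvgMr w (ccvgS (dval_cvg oe gv)))).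
have := ccvgMl w (dval_cvg oe gs); congr ccvg; apply/funext => n.
have e0w : (\sum_(b : bool) (v (Some (b, 0%N)) - v None) *: e b 0%N) * w = 0.
  by rewrite mulr_suml big1 // => b _; rewrite -scalerAl e0 scaler0.
rewrite dpart_recl /dpart !mulrDl e0w addr0 mulrDr -scalerAl -scalerAr mul1r mulr1.
congr (_ + _); rewrite mulr_suml mulr_sumr; apply: eq_bigr => i _.
by rewrite -scalerAl -scalerAr eS.
Qed.

Lemma dval_ext e u v : u =1 v -> dval e u = dval e v.
Proof. by move=> /funext ->. Qed.

End DiagonalCalculus.

Section DiagonalNaturality.
Variables (R : realType) (Y Z : cstarAlgType R) (f : {lrmorphism Y -> Z}).
Hypothesis fs : star_morphism f.

Lemma morphism_oproj e : oproj e -> oproj (fun b k => f (e b k)).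
Proof.
move=> [es eM]; split=> [b k|b k b' k']; first by rewrite -fs es.
by rewrite -rmorphM eM; case: ifP; rewrite ?rmorph0.
Qed.

Lemma morphism_dval e v : oproj e -> geo v ->
  f (dval e v) = dval (fun b k => f (e b k)) v.
Proof.
move=> oe gv; apply/esym/dvalE => //; first exact: morphism_oproj.
have := morphism_ccvg fs (dval_cvg oe gv); congr ccvg; apply/funext => n.
rewrite /dpart linearD linearZ linear_sum /= rmorph1; congr (_ + _).
by apply: eq_bigr => i _; rewrite linearZ.
Qed.

End DiagonalNaturality.

(** * Weighted shifts *)

Section WeightedShift.
Variables (R : realType) (Z : cstarAlgType R).
Local Notation C := R[i].
Implicit Types (v tau sigma : didx -> C) (e : bool -> nat -> Z) (w : Z).

(** The value 0 at index 0 expresses that the projections [e b 0] are orthogonal to the range of w;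
    it is what w w^* takes there. *)
Definition dunshift v : didx -> C := fun i =>
  match i with
  | None => v None
  | Some (b, 0%N) => 0
  | Some (b, k.+1) => v (Some (b, k))
  end.

Lemma geo_unshift v : geo v -> geo (dunshift v).
Proof.
move=> gv; have [M M0 vM] := geo_bounded gv; case: gv => K [r [/andP[r0 r1] h]].
have K0 : 0 <= K by have := le_trans (nm_ge0 _) (h true 0%N); rewrite expr0 mulr1.
(* Delaying a sequence by one step costs a factor 1/r, so a rate equal to 0 is first replaced by
   1/2. *)
have [r00|rn0] := eqVneq r 0.
  exists (2 * (K + M)), (2^-1); split=> [|b [|k]].
  - by apply/andP; split; lra.
  - by rewrite /= sub0r nmN expr0 mulr1; have := vM None; lra.
  - have := h b k; rewrite /= r00 => hk; apply: (le_trans hk).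
    case: k hk => [|k] hk; first by rewrite expr0 expr1; lra.
    have p : 0 <= (2^-1 : R) ^+ k.+2 by rewrite exprn_ge0 // invr_ge0 ler0n.
    by rewrite exprS mul0r mulr0 mulr_ge0 // mulr_ge0 // addr_ge0.
have rp : 0 < r by rewrite lt_def rn0.
exists (K / r + M), r; split=> [|b [|k]]; first by rewrite r0.
  rewrite /= sub0r nmN expr0 mulr1; have := vM None.
  have : 0 <= K / r by rewrite divr_ge0.
  by lra.
rewrite /= (le_trans (h b k)) // mulrDl exprS mulrA divfK ?gt_eqF //.
by rewrite lerDl !mulr_ge0 ?exprn_ge0.
Qed.

Lemma dunshiftK v : dshift (dunshift v) =1 v.
Proof. by case=> [[b k]|]. Qed.

Lemma dunshiftM u v i : dunshift (fun i => u i * v i) i = dunshift u i * dunshift v i.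
Proof. by case: i => [[b [|k]]|] //=; rewrite mulr0. Qed.

(* In a representation, w is a direct sum of shifts with weights sqrt tau and
   ranges of defect projections e b 0, and of a multiple of a unitary. *)
Record weighted_shift tau w e : Prop := WeightedShift {
  ws_oproj : oproj e;
  ws_S : forall b k, e b k.+1 * w = w * e b k;
  ws_0 : forall b, e b 0%N * w = 0;
  ws_starM : star w * w = dval e tau;
  ws_Mstar : w * star w = dval e (dunshift tau) }.

Lemma dval_mull e v b k : oproj e -> geo v ->
  e b k * dval e v = v (Some (b, k)) *: e b k.
Proof.
move=> oe gv; have [es _] := oe.
have := congr1 star (dval_mulr b k oe (geo_conj gv)).
rewrite starM starZ es conjCK -dval_star // starK; exact.
Qed.

Lemma ws_dval_shift tau w e v : weighted_shift tau w e -> geo v ->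
  w * dval e v = dval e (dunshift v) * w.
Proof.
move=> h gv; rewrite (dval_shift (ws_oproj h) (geo_unshift gv) (ws_S h) (ws_0 h)).
by congr (_ * _); apply: dval_ext => i; rewrite dunshiftK.
Qed.

(** A real diagonal element is selfadjoint and commutes with all the projections, so it rescales the
    weights and leaves the projections in place. *)
Lemma ws_change tau w e sigma : weighted_shift tau w e -> geo tau -> geo sigma ->
  (forall i, (sigma i)^* = sigma i) ->
  weighted_shift (fun i => sigma i ^+ 2 * tau i) (w * dval e sigma) e.
Proof.
move=> h gt gs sr; have oe := ws_oproj h.
have ss : star (dval e sigma) = dval e sigma.
  by rewrite dval_star //; apply: dval_ext.
have gs2 : geo (fun i => sigma i * sigma i) by exact: geoM.
split=> //.
- by move=> b k; rewrite mulrA (ws_S h) -!mulrA dval_mull // dval_mulr.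
- by move=> b; rewrite mulrA (ws_0 h) mul0r.
- rewrite starM ss -mulrA [star w * _]mulrA (ws_starM h) -!dvalM //; last exact: geoM.
  by apply: dval_ext => i; rewrite expr2; ring.
- rewrite starM ss mulrA -[w * _ * _]mulrA -dvalM // (ws_dval_shift h) //.
  rewrite -mulrA (ws_Mstar h) -dvalM //; try exact: geo_unshift.
  by apply: dval_ext => i; rewrite -dunshiftM.
Qed.

(** Where tau does not vanish this is a recursion for the projections: they are determined by w and
    the base projections. *)
Lemma ws_next tau w e b k : weighted_shift tau w e -> geo tau ->
  w * e b k * star w = tau (Some (b, k)) *: e b k.+1.
Proof.
move=> h gt; rewrite -(ws_S h) -mulrA (ws_Mstar h).
by rewrite dval_mull //; [exact: ws_oproj h|exact: geo_unshift].
Qed.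

(* Products e1 b 0 * e2 b' k.+1 vanish, so e1 b 0 * dval e2 v only sees the two
   projections e2 b' 0, which the eigenvalues of v separate. *)
Lemma ws_base_unique tau w e e' v b : geo tau -> (forall i, tau i != 0) ->
  weighted_shift tau w e -> weighted_shift tau w e' -> geo v -> v None = 0 ->
  dval e v = dval e' v -> v (Some (b, 0%N)) != 0 ->
  v (Some (~~ b, 0%N)) != v (Some (b, 0%N)) -> e b 0%N = e' b 0%N.
Proof.
move=> gt t0.
(* One product formula suffices: with e = e e' and e' = e' e at the base, the adjoint of the second
   gives e' = e e'. *)
suff H e1 e2 : weighted_shift tau w e1 -> weighted_shift tau w e2 -> geo v ->
    v None = 0 -> dval e1 v = dval e2 v -> v (Some (b, 0%N)) != 0 ->
    v (Some (~~ b, 0%N)) != v (Some (b, 0%N)) -> e1 b 0%N = e1 b 0%N * e2 b 0%N.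
  move=> h h' gv v0 E vb vn.
  have [es _] := ws_oproj h; have [es' _] := ws_oproj h'.
  have /(congr1 star) := H _ _ h' h gv v0 (esym E) vb vn.
  rewrite starM es es' => ->; exact: H h h' gv v0 E vb vn.
move=> h h' gv v0 E vb vn.
have o1 := ws_oproj h; have o2 := ws_oproj h'; have [_ e2M] := o2.
have z b' k : e1 b 0%N * e2 b' k.+1 = 0.
  have := ws_next b' k h' gt; move=> /(congr1 (fun x => e1 b 0%N * x)).
  rewrite !mulrA (ws_0 h) !mul0r -scalerAr => /esym/eqP.
  by rewrite scaler_eq0 (negbTE (t0 _)) /= => /eqP.
have E1 : v (Some (b, 0%N)) *: e1 b 0%N =
    \sum_(b' : bool) v (Some (b', 0%N)) *: (e1 b 0%N * e2 b' 0%N).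
  rewrite -dval_mull // E.
  apply: (ccvg_unique (ccvgMl (e1 b 0%N) (ccvgS (dval_cvg o2 gv)))).
  rewrite (_ : (fun _ => _) = fun=> \sum_(b' : bool)
      v (Some (b', 0%N)) *: (e1 b 0%N * e2 b' 0%N)); first exact: ccvg_cst.
  apply/funext => n; rewrite dpart_recl v0 scale0r add0r mulrDr.
  rewrite [X in _ + X]mulr_sumr [X in _ + X]big1 ?addr0; last first.
    by move=> i _; rewrite -scalerAr z scaler0.
  by rewrite mulr_sumr; apply: eq_bigr => b' _; rewrite subr0 -scalerAr.
(* Multiplying [E1] on the right by the other projection makes the product an eigenvector for both
   eigenvalues, which differ. *)
have E0 : e1 b 0%N * e2 (~~ b) 0%N = 0.
  have := congr1 (fun x => x * e2 (~~ b) 0%N) E1.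
  rewrite mulr_suml (bigD1 (~~ b)) //= big1 ?addr0; last first.
    move=> b' b'b; rewrite -scalerAl -mulrA e2M.
    by rewrite (negbTE b'b) /= mulr0 scaler0.
  rewrite -!scalerAl -mulrA e2M !eqxx /= => /eqP.
  rewrite -subr_eq0 -scalerBl scaler_eq0 subr_eq0 eq_sym (negbTE vn) /=.
  by move/eqP.
have := E1; rewrite (bigD1 b) //= big1 ?addr0; last first.
  by move=> b' b'b; have -> : b' = ~~ b; [case: (b) b' b'b => -[]|rewrite E0 scaler0].
by move/(scalerI vb).
Qed.

Lemma ws_unique tau w e e' : geo tau -> (forall i, tau i != 0) ->
  weighted_shift tau w e -> weighted_shift tau w e' ->
  (forall b, e b 0%N = e' b 0%N) -> forall b k, e b k = e' b k.
Proof.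
move=> gt t0 h h' e0 b; elim=> [//|k IH].
by apply: (scalerI (t0 (Some (b, k)))); rewrite -(ws_next b k h gt) -(ws_next b k h' gt) IH.
Qed.

(** If the next projection vanished, w would kill [e b k], whereas w^* w acts on it by a nonzero
    weight. *)
Lemma ws_neq0 tau w e b k : geo tau -> (forall i, tau i != 0) ->
  weighted_shift tau w e -> e b 0%N != 0 -> e b k != 0.
Proof.
move=> gt t0 h e0; elim: k => [//|k IH]; apply/eqP => ek.
have := ws_S h b k; rewrite ek mul0r => /esym /(congr1 (fun x => star w * x)).
rewrite mulrA (ws_starM h) dval_mulr //; last exact: ws_oproj h.
by move/eqP; rewrite mulr0 scaler_eq0 (negbTE (t0 _)) (negbTE IH).
Qed.

End WeightedShift.

Section WeightedShiftNaturality.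
Variables (R : realType) (Y Z : cstarAlgType R) (f : {lrmorphism Y -> Z}).
Hypothesis fs : star_morphism f.

Lemma morphism_ws tau w e : geo tau -> weighted_shift tau w e ->
  weighted_shift tau (f w) (fun b k => f (e b k)).
Proof.
move=> gt h; have oe := ws_oproj h; split.
- exact: morphism_oproj.
- by move=> b k; rewrite -!rmorphM (ws_S h).
- by move=> b; rewrite -rmorphM (ws_0 h) rmorph0.
- by rewrite -fs -rmorphM (ws_starM h); exact: morphism_dval.
- rewrite -fs -rmorphM (ws_Mstar h); apply: morphism_dval => //.
  exact: geo_unshift.
Qed.

End WeightedShiftNaturality.

(** The eigenvalues of an element a with a w = m w a: it acts by [al b] on the base pieces, and each
    translation by w contributes a factor m. *)
Definition eigseq (R : realType) (m : R) (al : bool -> R) : didx -> R[i] :=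
  fun j => if j is Some (b, k) then (m ^+ k * al b)%:C%C else 0.

Lemma eigseq_geo (R : realType) (m : R) (al : bool -> R) :
  0 <= m < 1 -> geo (eigseq m al).
Proof.
move=> m01; exists (\sum_b `|al b|), m; split=> //.
have /andP[m0 _] := m01.
move=> b k; rewrite subr0 nm_real normrM ger0_norm ?exprn_ge0 // mulrC.
rewrite ler_wpM2r ?exprn_ge0 // (bigD1 b) //= lerDl.
by apply: sumr_ge0.
Qed.

(* phi Y := w S Y w^* is multiplicative, and multiplicativity makes it contractive
   on selfadjoint elements by the power trick. Iterating
   a = sum_b al b E b + m phi(a) diagonalises a over e b k := phi^k(E b). *)
Section DiagonalExistence.
Variables (R : realType) (Z : cstarAlgType R).
Local Notation C := R[i].
Variables (w S : Z) (a E : bool -> Z) (m : bool -> R) (al : bool -> bool -> R).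
Local Notation T := (star w * w).
Hypotheses (ST : S * T = 1) (TS : T * S = 1).
Hypotheses (m01 : forall i, 0 <= m i < 1).
Hypotheses (a_star : forall i, star (a i) = a i)
  (a_comm : forall i j, a i * a j = a j * a i)
  (a_w : forall i, a i * w = (m i)%:C%C *: (w * a i))
  (a_T : forall Y, (forall i, a i * Y = Y * a i) -> T * Y = Y * T).
Hypotheses (E_star : forall b, star (E b) = E b)
  (E_mul : forall b b', E b * E b' = if b == b' then E b else 0)
  (E_sum : \sum_b E b = 1 - w * S * star w)
  (a_E : forall i b, a i * E b = (al i b)%:C%C *: E b).

(** By [a_T], commuting with the elements a forces commuting with [star w * w] and its inverse S;
    and [phi] preserves this property. *)
Let comm Y := forall i, a i * Y = Y * a i.
(** For Y commuting with S this is conjugation by the isometry w S^(1/2) of the polar decomposition,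
    written without a square root. *)
Let phi Y := w * S * Y * star w.

Let S_star : star S = S.
Proof.
have h : star S * T = 1.
  by have := congr1 star TS; rewrite star1 !starM starK.
by rewrite -[star S]mulr1 -TS mulrA h mul1r.
Qed.

Let commS Y : comm Y -> S * Y = Y * S.
Proof.
move=> /a_T; move: ST TS; set t := T => h1 h2 c.
by rewrite -[LHS]mulr1 -h2 mulrA -(mulrA S) -c mulrA h1 mul1r.
Qed.

Let comm_star Y : comm Y -> comm (star Y).
Proof. by move=> c i; have := congr1 star (c i); rewrite !starM a_star. Qed.

Let comm_a i : comm (a i). Proof. by move=> j; exact: a_comm. Qed.

Let aS i : a i * S = S * a i. Proof. by rewrite commS. Qed.

Let w_a i : star w * a i = (m i)%:C%C *: (a i * star w).
Proof. by have := congr1 star (a_w i); rewrite starZ !starM a_star conjC_real. Qed.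

Let a_phi i Y : comm Y -> a i * phi Y = (m i)%:C%C *: phi (a i * Y).
Proof.
move=> c; rewrite /phi !mulrA a_w -!scalerAl; congr (_ *: _).
by rewrite -(mulrA w (a i)) aS !mulrA.
Qed.

Let comm_phi Y : comm Y -> comm (phi Y).
Proof.
move=> c i; rewrite a_phi // /phi -!mulrA w_a -!scalerAr !mulrA; congr (_ *: _).
by rewrite -!(mulrA w) -!(mulrA S) c !mulrA.
Qed.

Let phiM X Y : phi X * phi Y = phi (X * Y).
Proof.
rewrite /phi !mulrA -[_ * star w * w]mulrA -[_ * T * S]mulrA TS mulr1.
by rewrite -!mulrA.
Qed.

Let phi_star Y : comm Y -> star (phi Y) = phi (star Y).
Proof.
move=> c; rewrite /phi !starM starK S_star !mulrA.
by rewrite -(mulrA w (star Y)) -(commS (comm_star c)) mulrA.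
Qed.

Let phi0 : phi 0 = 0. Proof. by rewrite /phi mulr0 mul0r. Qed.
Let phiD X Y : phi (X + Y) = phi X + phi Y.
Proof. by rewrite /phi mulrDr mulrDl. Qed.
Let phiZ k X : phi (k *: X) = k *: phi X.
Proof. by rewrite /phi -scalerAr -scalerAl. Qed.

Let comm_E b : comm (E b).
Proof.
move=> i; have := congr1 star (a_E i b).
by rewrite starM starZ a_star E_star conjC_real => ->; exact: a_E.
Qed.

Let w_E b : star w * E b = 0.
Proof.
have h : star w * \sum_b' E b' = 0.
  by rewrite E_sum mulrBr mulr1 !mulrA TS mul1r subrr.
have -> : E b = (\sum_b' E b') * E b.
  rewrite mulr_suml (bigD1 b) //= E_mul eqxx big1 ?addr0 // => b' /negbTE bb.
  by rewrite E_mul bb.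
by rewrite mulrA h mul0r.
Qed.

Let E_w b : E b * w = 0.
Proof. by have := congr1 star (w_E b); rewrite starM starK E_star star0. Qed.

Let phi_E Y b : phi Y * E b = 0.
Proof. by rewrite /phi -mulrA w_E mulr0. Qed.

Let E_phi Y b : E b * phi Y = 0.
Proof. by rewrite /phi !mulrA E_w !mul0r. Qed.

Let e b k := iter k phi (E b).

Let comm_e b k : comm (e b k).
Proof. by elim: k => [|k IH]; [exact: comm_E|exact: comm_phi]. Qed.

Let e_oproj : oproj e.
Proof.
split=> [b k|b].
  elim: k => [|k IH]; first exact: E_star.
  by rewrite /e iterS -/(e b k) phi_star // IH.
elim=> [|k IH] b' [|k']; rewrite /e ?iterS /=.
- by rewrite E_mul eqxx andbT.
- by rewrite E_phi andbF.
- by rewrite phi_E andbF.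
rewrite -/(e b k) -/(e b' k') phiM IH eqSS.
by case: ifP.
Qed.

Let phi_contract Y : comm Y -> star Y = Y -> cnorm (phi Y) <= cnorm Y.
Proof.
move=> c Ys; pose K := cnorm w * cnorm S * cnorm (star w).
(* [phi] is multiplicative but need not be unital, hence positive powers only, and 2^j is rewritten
   as a successor. *)
have phiX n : phi (Y ^+ n.+1) = phi Y ^+ n.+1.
  elim: n => [|n IH]; first by rewrite !expr1.
  by rewrite [RHS]exprS -IH phiM -exprS.
apply: (@pow2_bound_leC _ _ _ K); rewrite ?cnorm_ge0 // => j.
rewrite -cnorm_pow2; last by rewrite phi_star // Ys.
have -> : (2 ^ j = (2 ^ j).-1.+1)%N by rewrite prednK // expn_gt0.
rewrite -phiX /phi (le_trans (cnormM _ _)) // /K mulrAC ler_wpM2r ?cnorm_ge0 //.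
rewrite (le_trans (cnormM _ _)) // ler_pM ?cnorm_ge0 ?cnormM //.
exact: cnormX.
Qed.

Lemma diagonal_existence : exists e0 : bool -> nat -> Z,
  [/\ oproj e0, forall b, e0 b 0%N = E b,
      forall b k, e0 b k.+1 * w = w * e0 b k,
      forall b, e0 b 0%N * w = 0 &
      forall i, a i = dval e0 (eigseq (m i) (al i))].
Proof.
exists e; split=> // [b k|i].
  rewrite /e iterS -/(e b k) /phi -!mulrA (mulrA S) (commS (comm_e b k)).
  by rewrite -(mulrA (e b k)) ST mulr1.
apply/esym/dvalE => //; first exact: eigseq_geo.
have step : a i = \sum_b (al i b)%:C%C *: E b + (m i)%:C%C *: phi (a i).
  rewrite -[LHS]mulr1 -[1](subrK (w * S * star w)) -E_sum mulrDr mulr_sumr.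
  congr (_ + _); first by apply: eq_bigr => b _; rewrite a_E.
  by rewrite /phi !mulrA a_w -!scalerAl -(mulrA w (a i)) aS !mulrA.
have iterD n X Y : iter n phi (X + Y) = iter n phi X + iter n phi Y.
  by elim: n => [//|n IH]; rewrite !iterS IH phiD.
have iterZ n k X : iter n phi (k *: X) = k *: iter n phi X.
  by elim: n => [//|n IH]; rewrite !iterS IH phiZ.
have iter_sum n : iter n phi (\sum_b (al i b)%:C%C *: E b) =
    \sum_b (al i b)%:C%C *: e b n.
  by rewrite !big_bool /= iterD !iterZ.
(* The limit value of [eigseq] is 0, so [dpart] is a plain partial sum and m^n phi^n(a) is the exact
   remainder, of norm at most m^n |a|. *)
have rest n : a i = dpart e (eigseq (m i) (al i)) n + ((m i) ^+ n)%:C%C *: iter n phi (a i).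
  elim: n => [|n IH].
    rewrite /dpart scale0r add0r big1 ?add0r; last by case=> b [].
    by rewrite expr0 scale1r.
  rewrite {1}IH dpart_rec -[RHS]addrA; congr (dpart e (eigseq (m i) (al i)) n + _).
  rewrite {1}step iterD iterZ iter_sum scalerDr scalerA -iterSr.
  rewrite exprSr rmorphM; congr (_ + _).
  rewrite scaler_sumr; apply: eq_bigr => b _.
  by rewrite scalerA subr0 /= -rmorphM.
have star_iter n : comm (iter n phi (a i)) /\ star (iter n phi (a i)) = iter n phi (a i).
  elim: n => [|n [c s]]; first by split; [exact: comm_a|exact: a_star].
  by rewrite iterS; split; [exact: comm_phi|rewrite phi_star // s].
have norm_iter n : cnorm (iter n phi (a i)) <= cnorm (a i).
  elim: n => [//|n IH]; have [c s] := star_iter n.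
  by rewrite iterS (le_trans (phi_contract c s)).
have /andP[m0 m1] := m01 i.
apply: (ccvg_bound (b := fun n => cnorm (a i) * m i ^+ n)); last exact: cvg_geo.
move=> n; rewrite cnormB {1}(rest n) addrAC subrr add0r cnorm_nmZ nm_real.
by rewrite ger0_norm ?exprn_ge0 // mulrC ler_wpM2r ?exprn_ge0.
Qed.

End DiagonalExistence.

(** * Inverting linear factors of the diagonal elements *)

Section Invertibility.
Variables (R : realType) (Z : cstarAlgType R).
Local Notation C := R[i].
Implicit Types (a w x y : Z).

Lemma zmod_cancel (V : zmodType) (q u y z t : V) :
  q - u + (y - z) + t + (u - y + (z - t)) = q.
Proof.
have -> : q - u + (y - z) + t = q - (u - y + (z - t)); last by rewrite subrK.
by rewrite opprD !opprB -!addrA [- u + _]addrCA [- z + t]addrC.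
Qed.

Lemma cinvertible_sides x y z : y * x = 1 -> x * z = 1 -> cinvertible x.
Proof.
move=> yx xz; exists y; split=> //.
by have -> : y = z by rewrite -[y]mulr1 -xz mulrA yx mul1r.
Qed.

Lemma cinvertibleM x y : cinvertible x -> cinvertible y -> cinvertible (x * y).
Proof.
move=> [x' [h1 h2]] [y' [h3 h4]]; exists (y' * x'); split.
  by rewrite mulrA -(mulrA y') h1 mulr1.
by rewrite mulrA -(mulrA x) h4 mulr1.
Qed.

(* (1 - s a) w = w (1 - m s a) turns an inverse of 1 - m s a into
   an element u with (1 - s a) u = q(a), and 1 - s a divides q(a) - q(1/s). *)
Lemma cinvertible_step a w g (m s k1 k2 k0 : R) :
  star a = a -> a * w = m%:C%C *: (w * a) ->
  w * star w * g = k0%:C%C *: 1 + k1%:C%C *: a + k2%:C%C *: (a * a) ->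
  g * (w * star w) = k0%:C%C *: 1 + k1%:C%C *: a + k2%:C%C *: (a * a) ->
  s != 0 -> k0 + k1 / s + k2 / s ^+ 2 != 0 ->
  cinvertible (1 - (m * s)%:C%C *: a) -> cinvertible (1 - s%:C%C *: a).
Proof.
move=> as_ aw Eq Eq' s0 q0 [r [h1 h2]].
have wa : star w * a = m%:C%C *: (a * star w).
  by have := congr1 star aw; rewrite starZ !starM as_ conjC_real.
set A := 1 - s%:C%C *: a; set q := k0 + k1 / s + k2 / s ^+ 2 in q0.
have Aw : A * w = w * (1 - (m * s)%:C%C *: a).
  rewrite /A mulrBl mulrBr mul1r mulr1 -scalerAl -scalerAr aw scalerA.
  by rewrite rmorphM /= mulrC.
have wA : star w * A = (1 - (m * s)%:C%C *: a) * star w.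
  rewrite /A mulrBl mulrBr mul1r mulr1 -scalerAl -scalerAr wa scalerA.
  by rewrite rmorphM /= mulrC.
(* Coefficients of the polynomial division of q(t) by 1 - s t; the remainder is the number q(1/s),
   called [q] here, so (1 - s a) l = q(a) - q(1/s). *)
pose l0 := k1 / s + k2 / s ^+ 2; pose l1 := k2 / s.
pose l : Z := - (l0%:C%C *: 1 + l1%:C%C *: a).
have Al : A * l = - (l0%:C%C *: 1 - (l0 * s)%:C%C *: a +
                     (l1%:C%C *: a - (l1 * s)%:C%C *: (a * a))).
  rewrite mulrN mulrDr -!scalerAr mulr1 mulrBl mul1r -scalerAl !scalerBr !scalerA.
  by rewrite -!rmorphM.
have aA : a * A = A * a.
  by rewrite /A mulrBl mulrBr mul1r mulr1 -scalerAl -scalerAr.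
have lA : l * A = A * l.
  rewrite mulNr mulrN; congr (- _).
  by rewrite [LHS]mulrDl [RHS]mulrDr -!scalerAl -!scalerAr mul1r mulr1 aA.
have Q : k0%:C%C *: 1 + k1%:C%C *: a + k2%:C%C *: (a * a) - A * l = q%:C%C *: 1.
  rewrite Al opprK.
  have -> : k0 = q - l0 by rewrite /q /l0; ring.
  have -> : k1 = l0 * s - l1 by rewrite /l0 /l1; field.
  have -> : k2 = l1 * s by rewrite /l1 divfK.
  rewrite !rmorphB !scalerBl.
  exact: zmod_cancel.
have qi : (q^-1)%:C%C * q%:C%C = 1 :> C by rewrite -rmorphM mulVf.
apply: (@cinvertible_sides _ ((q^-1)%:C%C *: (g * (w * r * star w) - l))
          ((q^-1)%:C%C *: (w * r * star w * g - l))).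
  rewrite -scalerAl mulrBl lA -!mulrA wA (mulrA r) h1 mul1r.
  by rewrite Eq' Q scalerA qi scale1r.
rewrite -scalerAr mulrBr !mulrA Aw -(mulrA w) h2 mulr1.
by rewrite Eq Q scalerA qi scale1r.
Qed.

(** For large j the element 1 - m^j s a is inverted by the Neumann series; [cinvertible_step] then
    climbs back one power of m at a time. The nonvanishing condition is asked for m != 0 only, the
    case m = 0 being trivial. *)
Lemma cinvertible_chain a w g (m s k1 k2 k0 : R) :
  star a = a -> a * w = m%:C%C *: (w * a) ->
  w * star w * g = k0%:C%C *: 1 + k1%:C%C *: a + k2%:C%C *: (a * a) ->
  g * (w * star w) = k0%:C%C *: 1 + k1%:C%C *: a + k2%:C%C *: (a * a) ->
  0 <= m < 1 -> s != 0 ->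
  (forall j, m != 0 -> k0 + k1 / (m ^+ j.+1 * s) + k2 / (m ^+ j.+1 * s) ^+ 2 != 0) ->
  cinvertible (1 - (m * s)%:C%C *: a).
Proof.
move=> as_ aw Eq Eq' /andP[m0 m1] s0 hq.
have [->|mn0] := eqVneq m 0.
  by rewrite mul0r scale0r subr0; exists 1; rewrite mulr1.
have P j : cinvertible (1 - (m ^+ j.+1 * s)%:C%C *: a) ->
    cinvertible (1 - (m * s)%:C%C *: a).
  elim: j => [|j IH]; first by rewrite expr1.
  rewrite exprS -mulrA => h; apply: IH.
  apply: (cinvertible_step as_ aw Eq Eq' _ _ h); last exact: hq.
  by rewrite mulf_neq0 // expf_neq0.
have : (fun n => (`|s| * cnorm a) * m ^+ n) @ \oo --> (0 : R).
  by apply: cvg_geo; rewrite m0.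
move=> /cvgrPdist_lt/(_ 1 ltr01)[N _ /(_ N.+1 (leqnSn N))].
rewrite sub0r normrN ger0_norm ?mulr_ge0 ?exprn_ge0 ?cnorm_ge0 // => hN.
apply: (P N); apply: neumann_inverse.
rewrite cnorm_nmZ nm_real normrM ger0_norm ?exprn_ge0 //.
by move: hN; rewrite mulrC mulrA.
Qed.

End Invertibility.

Section BaseProjection.
Variables (R : realType) (Z : cstarAlgType R).
Variables (w S : Z).
Local Notation T := (star w * w).
Hypotheses (ST : S * T = 1) (TS : T * S = 1).

(** With S inverse to w^* w, w S w^* is the range projection of w, so this is the projection onto
    the kernel of w^*. *)
Definition base_proj : Z := 1 - w * S * star w.

Let S_star : star S = S.
Proof.
have h : star S * T = 1.
  by have := congr1 star TS; rewrite star1 !starM starK.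
by rewrite -[star S]mulr1 -TS mulrA h mul1r.
Qed.

Lemma base_proj_star : star base_proj = base_proj.
Proof. by rewrite starB star1 !starM starK S_star mulrA. Qed.

Lemma star_base_proj : star w * base_proj = 0.
Proof. by rewrite mulrBr mulr1 !mulrA TS mul1r subrr. Qed.

Lemma base_proj_idem : base_proj * base_proj = base_proj.
Proof. by rewrite {1}/base_proj mulrBl mul1r -!mulrA star_base_proj !mulr0 subr0. Qed.

Lemma base_proj_comm (a : Z) (m : R) : star a = a ->
  a * w = m%:C%C *: (w * a) -> T * a = a * T ->
  a * base_proj = base_proj * a.
Proof.
move=> as_ aw Ta.
have wa : star w * a = m%:C%C *: (a * star w).
  by have := congr1 star aw; rewrite starZ !starM as_ conjC_real.
have Sa : S * a = a * S.
  move: ST TS Ta; set t := T => h1 h2 c.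
  by rewrite -[LHS]mulr1 -h2 mulrA -(mulrA S) -c mulrA h1 mul1r.
rewrite mulrBl mulrBr mulr1 mul1r !mulrA aw -!scalerAl; congr (_ - _).
by rewrite -(mulrA _ (star w) a) wa -scalerAr !mulrA -(mulrA w a) -Sa !mulrA.
Qed.

End BaseProjection.

(** * The algebras of the two spheres as weighted shifts *)

Definition rc (R : realType) (t : didx -> R) : didx -> R[i] := fun i => (t i)%:C%C.

Lemma zmod_regroup (V : zmodType) (a b c d e u : V) :
  u - (b + e) - (c - (d + e)) = a - c - (b - d) + (u - a).
Proof.
rewrite [RHS]addrC -[a - c - _]addrA subrKA -addrA; congr (u + _).
rewrite !opprB opprD addrC [- b - e]addrC addrA [d + e - c - e]addrAC addrK.
by rewrite -addrA addrCA.
Qed.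

Lemma zmod_regroup' (V : zmodType) (a b c d f u : V) :
  a - c - (b - d) + (u - a) + (b - d - f) = u - c - f.
Proof. by rewrite [_ + (u - a)]addrC -[a - c - _]addrA subrKA [u + (- c - _)]addrA subrKA. Qed.

Section SphereShift.
Variables (R : realType) (p q : R).
Hypotheses (hp : 0 < p < 1) (hq : 0 < q < 1).
Local Notation C := R[i].
Local Notation r := (par p q).

(** Here f_1 = w and f_{-1} = w^*. The relation between f_{-1} and f_0 is omitted because it is the
    adjoint of the one between f_0 and f_1. *)
Definition sphere_relations (Z : starAlgType C) (w f0 : Z) : Prop :=
  [/\ star f0 = f0,
      star w * w - q%:C%C *: (w * star w) =
        (p - q)%:C%C *: f0 + (1 - p)%:C%C *: 1,
      f0 * w - p%:C%C *: (w * f0) = (1 - p)%:C%C *: w &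
      (1 - f0) * (w * star w - f0) = 0].

Lemma sphere_diagonal (Z : starAlgType C) (w f0 x y : Z) :
  sphere_relations w f0 -> x = 1 - f0 -> y = f0 - w * star w ->
  [/\ star x = x, star y = y, x * y = 0 & y * x = 0] /\
  [/\ x * w = p%:C%C *: (w * x), y * w = q%:C%C *: (w * y),
      w * star w = 1 - x - y &
      star w * w = 1 - p%:C%C *: x - q%:C%C *: y].
Proof.
move=> [fs R1 R2 R3] xE yE.
have xs : star x = x by rewrite xE starB star1 fs.
have ys : star y = y by rewrite yE starB fs starM starK.
have xy : x * y = 0 by rewrite xE yE -(opprB _ f0) mulrN R3 oppr0.
have yx : y * x = 0 by have := congr1 star xy; rewrite starM xs ys star0.
have Mw : w * star w = 1 - x - y.
  by rewrite xE yE subKr subKr.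
have xw : x * w = p%:C%C *: (w * x).
  have -> : x * w = w - f0 * w by rewrite xE mulrBl mul1r.
  move/eqP: R2; rewrite subr_eq => /eqP ->.
  rewrite xE mulrBr mulr1 scalerBr rmorphB scalerBl rmorph1 scale1r.
  by rewrite opprD opprB addrA addrCA subrr addr0.
have wM : star w * w = 1 - p%:C%C *: x - q%:C%C *: y.
  move/eqP: R1; rewrite subr_eq => /eqP ->; rewrite Mw.
  have -> : f0 = 1 - x by rewrite xE subKr.
  rewrite !rmorphB !scalerBl rmorph1 scale1r !scalerBr /=.
  set a := p%:C%C *: 1; set b := q%:C%C *: 1; set c := p%:C%C *: x.
  set d := q%:C%C *: x; set f := q%:C%C *: y.
  exact: zmod_regroup'.
have yw : y * w = q%:C%C *: (w * y).
  have yE' : y = 1 - x - w * star w by rewrite Mw subKr.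
  rewrite {1}yE' !mulrBl mul1r xw -mulrA wM !scalerAr -[X in X - _ - _]mulr1.
  by rewrite -!mulrBr subKr.
by split.
Qed.

Definition sphere_tau : didx -> R :=
  fun i => if i is Some (b, k) then 1 - r b ^+ k.+1 else 1.

(** The eigenvalues of x for [i = true] and of y for [i = false]: each is 1 on its own base piece
    and 0 on the other. *)
Definition sphere_eig (i : bool) : didx -> C := eigseq (r i) (fun b => (b == i)%:R).

Lemma par_ge0_lt1 b : 0 <= r b < 1.
Proof. by have /andP[/ltW -> ->] := par01 hp hq b. Qed.

Lemma sphere_eig_geo i : geo (sphere_eig i).
Proof. exact/eigseq_geo/par_ge0_lt1. Qed.

Lemma sphere_tauE i : rc sphere_tau i =
  1 - ((r true)%:C%C * sphere_eig true i + (r false)%:C%C * sphere_eig false i).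
Proof.
case: i => [[b k]|]; last by rewrite /rc /= !mulr0 addr0 subr0 rmorph1.
rewrite /rc /= rmorphB rmorph1 -!rmorphM -rmorphD /=; congr (_ - _%:C)%C.
by case: b => /=; rewrite ?mulr1 ?mulr0 ?addr0 ?add0r exprS.
Qed.

Lemma sphere_tau_shiftE i : dunshift (rc sphere_tau) i =
  1 - (sphere_eig true i + sphere_eig false i).
Proof.
case: i => [[b [|k]]|]; last by rewrite /= /rc /= addr0 subr0 rmorph1.
  by rewrite /= -rmorphD /=; case: b => /=;
    rewrite ?expr0 ?mul1r ?addr0 ?add0r rmorph1 subrr.
rewrite /= /rc /= rmorphB rmorph1 -!rmorphD /=; congr (_ - _%:C)%C.
by case: b => /=; rewrite ?mulr1 ?mulr0 ?addr0 ?add0r.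
Qed.

Lemma sphere_tau_geo : geo (rc sphere_tau).
Proof.
rewrite (_ : rc _ = fun i => 1 + -
    ((r true)%:C%C * sphere_eig true i + (r false)%:C%C * sphere_eig false i)).
  apply: geoD; first exact: geo_const.
  by apply/geoN/geoD; exact/geoZ/sphere_eig_geo.
by apply/funext => i; exact: sphere_tauE.
Qed.

Variable Z : cstarAlgType R.
Implicit Types (w : Z) (e : bool -> nat -> Z).

Lemma sphere_dval_tau e : oproj e -> dval e (rc sphere_tau) =
  1 - ((r true)%:C%C *: dval e (sphere_eig true) +
       (r false)%:C%C *: dval e (sphere_eig false)).
Proof.
move=> oe; have g i := sphere_eig_geo i.
have gz i := geoZ (r i)%:C%C (g i).
rewrite -!dvalZ // -dvalD // (dval_ext e sphere_tauE) dvalB ?dval_const ?scale1r //.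
  exact: geo_const.
exact: geoD.
Qed.

Lemma sphere_dval_tau_shift e : oproj e -> dval e (dunshift (rc sphere_tau)) =
  1 - (dval e (sphere_eig true) + dval e (sphere_eig false)).
Proof.
move=> oe; have g i := sphere_eig_geo i.
rewrite -dvalD // (dval_ext e sphere_tau_shiftE) dvalB ?dval_const ?scale1r //.
  exact: geo_const.
exact: geoD.
Qed.

Lemma ws_sphere w e : weighted_shift (rc sphere_tau) w e ->
  sphere_relations w (1 - dval e (sphere_eig true)).
Proof.
move=> h; have oe := ws_oproj h; have g i := sphere_eig_geo i.
set x := dval e (sphere_eig true); set y := dval e (sphere_eig false).
have xs : star x = x.
  rewrite /x dval_star //; apply: dval_ext => -[[b k]|] /=; last by rewrite rmorph0.
  by rewrite conjC_real.
have xw : x * w = p%:C%C *: (w * x).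
  rewrite /x (dval_shift oe (g true) (ws_S h) (ws_0 h)) scalerAr -dvalZ //.
  congr (_ * _); apply: dval_ext => -[[b k]|] /=; last by rewrite mulr0.
  by rewrite -rmorphM exprS mulrA.
have Ew : star w * w = 1 - (p%:C%C *: x + q%:C%C *: y).
  by rewrite (ws_starM h) sphere_dval_tau.
have Ew' : w * star w = 1 - (x + y).
  by rewrite (ws_Mstar h) sphere_dval_tau_shift.
have xy : x * y = 0.
  rewrite /x /y -dvalM // -[RHS](scale0r 1) -(dval_const 0 oe).
  apply: dval_ext => -[[[] k]|] /=; rewrite ?mulr0 ?rmorph0 ?mulr0 ?mul0r //.
split.
- by rewrite starB star1 xs.
- rewrite Ew Ew' !scalerBr !rmorphB !scalerBl rmorph1 scale1r !scalerDr ?scalerBr /=.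
  exact: zmod_regroup.
- rewrite mulrBl mulrBr mul1r mulr1 xw scalerBr rmorphB scalerBl rmorph1 scale1r.
  by rewrite opprB addrA subrK.
- rewrite opprB addrCA subrr addr0 Ew' [X in _ * X]addrC subrKA opprD addrA.
  by rewrite subrr add0r mulrN xy oppr0.
Qed.

Lemma sphere_ws w f0 : sphere_relations w f0 -> exists e,
  [/\ weighted_shift (rc sphere_tau) w e,
      1 - f0 = dval e (sphere_eig true) &
      f0 - w * star w = dval e (sphere_eig false)].
Proof.
move=> rel; have [x xE] : exists x, x = 1 - f0 by eexists.
have [y yE] : exists y, y = f0 - w * star w by eexists.
have [[xs ys xy yx] [xw yw Mw wM]] := sphere_diagonal rel xE yE.
rewrite -xE -yE.
pose a b := if b then x else y.
have a_star i : star (a i) = a i by case: i.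
have a_mul i j : i != j -> a i * a j = 0 by case: i j => -[].
have atf : a true * a false = 0 by [].
have aft : a false * a true = 0 by [].
have a_w i : a i * w = (r i)%:C%C *: (w * a i) by case: i.
have Mw' : w * star w = 1 - a true - a false by [].
have wM' : star w * w = 1 - (r true)%:C%C *: a true - (r false)%:C%C *: a false by [].
have a_comm i j : a i * a j = a j * a i.
  by case: (eqVneq i j) => [->//|ij]; rewrite !a_mul // eq_sym.
(* Taking g = a_i removes the other diagonal element, since x y = 0. What remains is t - t^2, a
   polynomial in a_i alone, which does not vanish at the inverse powers of [r i] that occur in the
   chain. *)
have q1 i : w * star w * a i = 0%:C%C *: 1 + 1%:C%C *: a i + (-1)%:C%C *: (a i * a i).
  rewrite Mw' !mulrBl mul1r rmorph0 scale0r add0r rmorph1 scale1r rmorphN rmorph1 scaleN1r.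
  by case: i; rewrite ?atf ?aft ?subr0.
have q2 i : a i * (w * star w) = 0%:C%C *: 1 + 1%:C%C *: a i + (-1)%:C%C *: (a i * a i).
  rewrite Mw' !mulrBr mulr1 rmorph0 scale0r add0r rmorph1 scale1r rmorphN rmorph1 scaleN1r.
  by case: i; rewrite ?atf ?aft ?subr0.
have inv1 i : cinvertible (1 - (r i)%:C%C *: a i).
  have := cinvertible_chain (a_star i) (a_w i) (q1 i) (q2 i) (par_ge0_lt1 i) (oner_neq0 _).
  rewrite mulr1; apply=> j r0; rewrite mulr1 add0r.
  have /andP[rp r1] := par01 hp hq i.
  have t0 : r i ^+ j.+1 != 0 by rewrite expf_neq0.
  have t1 : r i ^+ j.+1 < 1 by rewrite exprn_ilt1 // ltW.
  move: t0 t1; set t := r i ^+ j.+1 => t0 t1.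
  have -> : 1 / t + -1 / t ^+ 2 = (t - 1) / t ^+ 2 by field.
  by rewrite mulf_neq0 ?invr_eq0 ?expf_neq0 // subr_eq0 lt_eqF.
(* Since x y = 0, the sum 1 - p x - q y factors as (1 - p x)(1 - q y). *)
have [S [ST TS]] : cinvertible (star w * w).
  have -> : star w * w = (1 - (r true)%:C%C *: a true) * (1 - (r false)%:C%C *: a false).
    rewrite mulrBl mul1r mulrBr mulr1 -scalerAl -scalerAr atf !scaler0 subr0.
    by rewrite wM' addrAC.
  exact: cinvertibleM.
have a_T Y : (forall i, a i * Y = Y * a i) -> star w * w * Y = Y * (star w * w).
  move=> c; rewrite wM' !mulrBl !mulrBr mul1r mulr1 -!scalerAl -!scalerAr.
  by rewrite !c.
have Ta i : star w * w * a i = a i * (star w * w) by apply: a_T => j; rewrite a_comm.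
have [F FE] : exists F, F = base_proj w S by eexists.
(* On the range of F one has w w^* = 0, hence x + y = 1; with x y = 0 this makes x F and y F
   orthogonal projections with sum F. *)
pose E b := a b * F.
have Fs : star F = F by rewrite FE; exact: base_proj_star.
have FF : F * F = F by rewrite FE; exact: base_proj_idem.
have wF : star w * F = 0 by rewrite FE; exact: star_base_proj.
have aF i : a i * F = F * a i by rewrite FE; exact: base_proj_comm (a_star i) (a_w i) (Ta i).
have sumF : a true * F + a false * F = F.
  have : w * star w * F = 0 by rewrite -mulrA wF mulr0.
  rewrite Mw' !mulrBl mul1r => /eqP.
  by rewrite -addrA -opprD subr_eq0 => /eqP.
have aa b : a b * a b * F = a b * F.
  rewrite -mulrA -[in RHS]sumF mulrDr.
  by case: b; rewrite !mulrA ?atf ?aft mul0r ?addr0 ?add0r.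
have a_E i b : a i * E b = (b == i)%:R%:C%C *: E b.
  rewrite /E mulrA; have [<-|bi] := eqVneq b i; first by rewrite aa rmorph1 scale1r.
  by rewrite a_mul 1?eq_sym // mul0r rmorph0 scale0r.
have E_star b : star (E b) = E b by rewrite starM Fs a_star -aF.
have E_mul b b' : E b * E b' = if b == b' then E b else 0.
  have -> : E b * E b' = a b * a b' * F.
    by rewrite /E -mulrA (mulrA F) -aF -(mulrA _ F) FF mulrA.
  by case: eqVneq => [<-|bb]; [exact: aa|rewrite a_mul // mul0r].
have E_sum : \sum_b E b = 1 - w * S * star w.
  by rewrite big_bool /= sumF FE.
have [e [oe _ eS e0 eE]] := diagonal_existence (al := fun i b => (b == i)%:R)
  ST TS par_ge0_lt1 a_star a_comm a_w a_T E_star E_mul E_sum a_E.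
have xe : x = dval e (sphere_eig true) by exact: (eE true).
have ye : y = dval e (sphere_eig false) by exact: (eE false).
exists e; split=> //; split=> //.
  by rewrite wM sphere_dval_tau // -xe -ye opprD addrA.
by rewrite Mw sphere_dval_tau_shift // -xe -ye opprD addrA.
Qed.

End SphereShift.

Lemma one_sub_scale_mul (C : nzRingType) (A : algType C) (x : A) (k l : C) :
  (1 - k *: x) * (1 - l *: x) = 1 - l *: x - (k *: x - (k * l) *: (x * x)).
Proof. by rewrite mulrBl mul1r mulrBr mulr1 -scalerAl -scalerAr scalerA. Qed.

Section PodlesShift.
Variables (R : realType) (mu c : R).
Hypotheses (hmu : `|mu| < 1) (hc : 0 < c).
Local Notation C := R[i].
Local Notation m := (mu ^+ 2).

Definition podles_lam (b : bool) : R :=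
  (1 + (-1) ^+ (~~ b) * Num.sqrt (1 + 4 * c)) / 2.
Local Notation lam := podles_lam.

Let sqE : Num.sqrt (1 + 4 * c) ^+ 2 = 1 + 4 * c.
Proof. by move: hc => h; rewrite sqr_sqrtr //; lra. Qed.

Let sq1 : 1 < Num.sqrt (1 + 4 * c).
Proof. by rewrite -[ltLHS]sqrtr1 ltr_sqrt; move: hc => h; lra. Qed.

Lemma lam_sqr b : lam b ^+ 2 = lam b + c.
Proof.
rewrite /lam; set s := (-1) ^+ _ * _.
have -> : c = (s ^+ 2 - 1) / 4; last by field.
by rewrite /s exprMn sqrr_sign mul1r sqE; field.
Qed.

Lemma lam_sum : lam true + lam false = 1.
Proof. by rewrite /lam /= expr0 expr1; field. Qed.

Lemma lam_prod : lam true * lam false = - c.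
Proof.
have -> : lam false = 1 - lam true by rewrite -lam_sum; ring.
by rewrite mulrBr mulr1 -expr2 lam_sqr; ring.
Qed.

Lemma lam_true_gt1 : 1 < lam true.
Proof. by rewrite /lam /= expr0; have := sq1; lra. Qed.

Lemma lam_false_lt0 : lam false < 0.
Proof. by rewrite /lam /= expr1; have := sq1; lra. Qed.

Lemma lam_neq0 b : lam b != 0.
Proof.
by case: b; [rewrite gt_eqF // (lt_trans ltr01) // lam_true_gt1|
  rewrite lt_eqF // lam_false_lt0].
Qed.

(** The negative root is -c divided by a number larger than 1. This bound keeps the weights positive
    and the chain of inverses unobstructed. *)
Lemma lam_geNc b : - c <= lam b.
Proof.
have c0 := hc; case: b; first by have := lam_true_gt1; lra.
have := lam_prod; have := lam_true_gt1; have := lam_false_lt0; nra.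
Qed.

Lemma sqr_ge0_lt1 : 0 <= m < 1.
Proof.
rewrite sqr_ge0 /= -(ger0_norm (sqr_ge0 mu)) normrX expr_lt1 //.
Qed.

Definition podles_tau : didx -> R := fun i => if i is Some (b, k) then
  1 + (m ^+ k.+1 * lam b - (m ^+ k.+1 * lam b) ^+ 2) / c else 1.

Definition podles_eig : didx -> C := eigseq m lam.

Lemma podles_eig_geo : geo podles_eig.
Proof. exact/eigseq_geo/sqr_ge0_lt1. Qed.

(** As a function of M = m^(k+1) the weight vanishes at M = 1, because [lam b] is a root of t^2 = t
    + c. Splitting off 1 - M leaves a factor that is at least 1 by [lam_geNc]. *)
Lemma podles_tau_ge i : 1 - m <= podles_tau i.
Proof.
have /andP[m0 m1] := sqr_ge0_lt1.
case: i => [[b k]|] /=; last by lra.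
have M0 : 0 <= m ^+ k.+1 by rewrite exprn_ge0.
have Mm : m ^+ k.+1 <= m by rewrite exprS ler_piMr // exprn_ile1 // ltW.
move: M0 Mm; set M := m ^+ k.+1; clearbody M => M0 Mm.
have -> : 1 + (M * lam b - (M * lam b) ^+ 2) / c =
  (1 - M) * (1 + M * (1 + lam b / c)).
  rewrite exprMn lam_sqr; field; exact: lt0r_neq0.
have h : 0 <= 1 + lam b / c.
  have -> : 1 + lam b / c = (c + lam b) / c by field; exact: lt0r_neq0.
  by apply: divr_ge0; [have := lam_geNc b; lra|exact: ltW].
have : 0 <= M * (1 + lam b / c) by rewrite mulr_ge0.
by move=> h2; nra.
Qed.

Lemma podles_tauE i : rc podles_tau i = 1 + (c^-1)%:C%C *
  (m%:C%C * podles_eig i - (m ^+ 2)%:C%C * (podles_eig i * podles_eig i)).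
Proof.
case: i => [[b k]|]; last by rewrite /rc /= !mulr0 subr0 mulr0 addr0 rmorph1.
rewrite /rc /= -!rmorphM -rmorphB -rmorphM -(rmorph1 (real_complex R)) -rmorphD.
by congr (_%:C)%C; rewrite exprS; ring.
Qed.

Lemma podles_tau_shiftE i : dunshift (rc podles_tau) i = 1 + (c^-1)%:C%C *
  (podles_eig i - podles_eig i * podles_eig i).
Proof.
case: i => [[b [|k]]|]; last by rewrite /= /rc /= !mulr0 subr0 mulr0 addr0 rmorph1.
  rewrite /= -!rmorphM -rmorphB -rmorphM -(rmorph1 (real_complex R)) -rmorphD.
  rewrite expr0 mul1r -expr2 lam_sqr.
  by rewrite (_ : 1 + _ = 0) ?rmorph0 //; field; exact: lt0r_neq0.
rewrite /= /rc /= -!rmorphM -rmorphB -rmorphM -(rmorph1 (real_complex R)) -rmorphD.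
by congr (_%:C)%C; rewrite exprS; ring.
Qed.

Lemma podles_tau_geo : geo (rc podles_tau).
Proof.
have g := podles_eig_geo.
rewrite (_ : rc _ = fun i => 1 + (c^-1)%:C%C * (m%:C%C * podles_eig i
    + - ((m ^+ 2)%:C%C * (podles_eig i * podles_eig i)))).
  apply: geoD; first exact: geo_const.
  apply/geoZ/geoD; first exact: geoZ.
  exact/geoN/geoZ/geoM.
by apply/funext => i; exact: podles_tauE.
Qed.

Variable Z : cstarAlgType R.
Implicit Types (A B w : Z) (e : bool -> nat -> Z).

Lemma podles_dval_tau e : oproj e -> dval e (rc podles_tau) =
  1 + (c^-1)%:C%C *: (m%:C%C *: dval e podles_eig -
      (m ^+ 2)%:C%C *: (dval e podles_eig * dval e podles_eig)).
Proof.
move=> oe; have g := podles_eig_geo; have g2 := geoM g g.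
have gz k := geoZ k g; have gz2 k := geoZ k g2.
rewrite (dval_ext e podles_tauE) dvalD //; last first.
- by apply/geoZ/geoD => //; exact: geoN.
- exact: geo_const.
rewrite dval_const // scale1r dvalZ //; last by apply/geoD => //; exact: geoN.
by rewrite dvalB // !dvalZ // dvalM.
Qed.

Lemma podles_dval_tau_shift e : oproj e -> dval e (dunshift (rc podles_tau)) =
  1 + (c^-1)%:C%C *: (dval e podles_eig - dval e podles_eig * dval e podles_eig).
Proof.
move=> oe; have g := podles_eig_geo; have g2 := geoM g g.
rewrite (dval_ext e podles_tau_shiftE) dvalD //; last first.
- by apply/geoZ/geoD => //; exact: geoN.
- exact: geo_const.
rewrite dval_const // scale1r dvalZ //; last by apply/geoD => //; exact: geoN.
by rewrite dvalB // dvalM.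
Qed.

Local Notation sc := (Num.sqrt c).

Let sc2 : sc * sc = c. Proof. by rewrite -expr2 sqr_sqrtr // ltW. Qed.
Let sc0 : sc != 0. Proof. by rewrite gt_eqF // sqrtr_gt0. Qed.

Lemma ws_podles w e : weighted_shift (rc podles_tau) w e ->
  podles_relations mu c (dval e podles_eig) (sc%:C%C *: star w).
Proof.
move=> h; have oe := ws_oproj h; have g := podles_eig_geo.
have As : star (dval e podles_eig) = dval e podles_eig.
  rewrite dval_star //; apply: dval_ext => -[[b k]|] /=; last by rewrite rmorph0.
  by rewrite conjC_real.
have Aw : dval e podles_eig * w = m%:C%C *: (w * dval e podles_eig).
  rewrite (dval_shift oe g (ws_S h) (ws_0 h)) scalerAr -dvalZ //.
  congr (_ * _); apply: dval_ext => -[[b k]|] /=; last by rewrite mulr0.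
  by rewrite -rmorphM (mulrA m) -exprS.
have wA : star w * dval e podles_eig = m%:C%C *: (dval e podles_eig * star w).
  by have := congr1 star Aw; rewrite starZ !starM As conjC_real.
have cV : c%:C%C * (c^-1)%:C%C = 1 :> C by rewrite -rmorphM mulfV ?rmorph1 // gt_eqF.
have ww : star (sc%:C%C *: star w) * (sc%:C%C *: star w) = c%:C%C *: (w * star w).
  by rewrite starZ starK conjC_real -scalerAl -scalerAr scalerA -rmorphM sc2.
have ww' : (sc%:C%C *: star w) * star (sc%:C%C *: star w) = c%:C%C *: (star w * w).
  by rewrite starZ starK conjC_real -scalerAl -scalerAr scalerA -rmorphM sc2.
split=> //.
- by rewrite -scalerAl -scalerAr wA !scalerA mulrC.
- rewrite ww (ws_Mstar h) podles_dval_tau_shift // scalerDr scalerA cV scale1r.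
  by rewrite addrC expr2.
- rewrite ww' (ws_starM h) podles_dval_tau // scalerDr scalerA cV scale1r.
  by rewrite addrC (expr2 (dval e _)) -exprM.
Qed.

Lemma podles_ws A B : podles_relations mu c A B -> exists e,
  weighted_shift (rc podles_tau) ((sc^-1)%:C%C *: star B) e /\
  A = dval e podles_eig.
Proof.
move=> [/esym As BA BB BB']; set w := _ *: star B.
have cC : (c^-1)%:C%C * c%:C%C = 1 :> C by rewrite -rmorphM mulVf ?rmorph1 // gt_eqF.
have ws_ : star w = (sc^-1)%:C%C *: B by rewrite starZ starK conjC_real.
have sV : (sc^-1)%:C%C * (sc^-1)%:C%C = (c^-1)%:C%C :> C.
  by rewrite -rmorphM -invfM sc2.
have Mw : w * star w = 1 + (c^-1)%:C%C *: (A - A * A).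
  rewrite ws_ -scalerAl -scalerAr scalerA sV BB scalerDr scalerA cC scale1r.
  by rewrite addrC expr2.
have wM : star w * w = 1 + (c^-1)%:C%C *: (m%:C%C *: A - (m ^+ 2)%:C%C *: (A * A)).
  rewrite ws_ -scalerAl -scalerAr scalerA sV BB' scalerDr scalerA cC scale1r.
  by rewrite addrC (expr2 A) -exprM.
have Aw : A * w = m%:C%C *: (w * A).
  have := congr1 star BA; rewrite starZ !starM As conjC_real => h.
  by rewrite -scalerAl -scalerAr h scalerA mulrC -scalerA.
clearbody w; clear ws_ BB BB' BA.
have q1 : w * star w * 1 = 1%:C%C *: 1 + (c^-1)%:C%C *: A + (- c^-1)%:C%C *: (A * A).
  by rewrite mulr1 Mw rmorph1 scale1r scalerBr rmorphN scaleNr addrA.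
have q2 : 1 * (w * star w) = 1%:C%C *: 1 + (c^-1)%:C%C *: A + (- c^-1)%:C%C *: (A * A).
  by rewrite mul1r -q1 mulr1.
have cn0 : c != 0 by rewrite gt_eqF.
(* Here g = 1 and the polynomial is w w^* itself, 1 + (t - t^2)/c, with roots [lam b]. The same
   polynomial at m A is w^* w, so its factors are 1 - (m / lam b) A and s = 1 / lam b. *)
have inv1 b : cinvertible (1 - (m * (lam b)^-1)%:C%C *: A).
  apply: (cinvertible_chain As Aw q1 q2 sqr_ge0_lt1); first by rewrite invr_eq0 lam_neq0.
  move=> j m0; have /andP[mge0 m1] := sqr_ge0_lt1.
  have M0 : m ^+ j.+1 != 0 by rewrite expf_neq0.
  have Mp : 0 < m ^+ j.+1 by rewrite lt_def M0 exprn_ge0.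
  have M1 : m ^+ j.+1 < 1 by rewrite exprn_ilt1.
  move: M0 Mp M1; set M := m ^+ j.+1; clearbody M => M0 Mp M1.
  have l0 := lam_neq0 b.
  have -> : 1 + c^-1 / (M * (lam b)^-1) + - c^-1 / (M * (lam b)^-1) ^+ 2 =
    (c * M ^+ 2 + lam b * M - lam b ^+ 2) / (c * M ^+ 2) by field; rewrite l0 cn0 M0.
  rewrite lam_sqr.
  have -> : c * M ^+ 2 + lam b * M - (lam b + c) = (M - 1) * (c * (1 + M) + lam b) by ring.
  rewrite mulf_neq0 ?mulf_neq0 ?invr_eq0 ?mulf_neq0 ?expf_neq0 //.
    by rewrite subr_eq0 lt_eqF.
  rewrite gt_eqF //; have := lam_geNc b.
  have : 0 < c * M by rewrite mulr_gt0.
  by lra.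
have [S [ST TS]] : cinvertible (star w * w).
  have -> : star w * w = (1 - (m * (lam true)^-1)%:C%C *: A) *
      (1 - (m * (lam false)^-1)%:C%C *: A).
    rewrite one_sub_scale_mul wM -rmorphM.
    have lt0 := lam_neq0 true; have lf0 := lam_neq0 false.
    set k1 := m * (lam true)^-1; set k2 := m * (lam false)^-1.
    have cE : c^-1 = - (lam true * lam false)^-1 by rewrite lam_prod invrN opprK.
    have e1 : c^-1 * m = - (k1 + k2).
      rewrite -[c^-1 * m]mulr1 -lam_sum /k1 /k2 cE.
      by field; rewrite lt0 lf0.
    have e2 : c^-1 * m ^+ 2 = - (k1 * k2).
      rewrite /k1 /k2 cE.
      by field; rewrite lt0 lf0.
    rewrite scalerBr !scalerA -!rmorphM e1 e2 !rmorphN !scaleNr opprK rmorphD scalerDl.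
    by rewrite opprD [- _ - _]addrC opprB -!addrA [_ - k1%:C%C *: A]addrC.
  exact: cinvertibleM.
have a_T Y : (forall i : bool, A * Y = Y * A) -> star w * w * Y = Y * (star w * w).
  move=> /(_ true) h; rewrite wM mulrDl mulrDr mul1r mulr1; congr (_ + _).
  have h2 : A * A * Y = Y * (A * A) by rewrite -mulrA h mulrA h mulrA.
  by rewrite -scalerAl -scalerAr mulrBl mulrBr -!scalerAl -!scalerAr h h2.
have TA : star w * w * A = A * (star w * w) by apply: a_T.
have [F FE] : exists F, F = base_proj w S by eexists.
have Fs : star F = F by rewrite FE; exact: base_proj_star.
have FF : F * F = F by rewrite FE; exact: base_proj_idem.
have wF : star w * F = 0 by rewrite FE; exact: star_base_proj.
have AF : A * F = F * A by rewrite FE; exact: base_proj_comm As Aw TA.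
(* On the range of F the equation w w^* = 0 turns into A^2 = A + c. *)
have A2F : A * A * F = A * F + c%:C%C *: F.
  have : w * star w * F = 0 by rewrite -mulrA wF mulr0.
  rewrite Mw mulrDl mul1r -scalerAl mulrBl => /(congr1 ( *:%R c%:C%C)).
  rewrite scalerDr scalerA mulrC cC scale1r scaler0 addrA => /eqP.
  by rewrite subr_eq0 addrC => /eqP.
(* Lagrange interpolation: (A - lam (~~ b)) / (lam b - lam (~~ b)) restricted to F is the spectral
   projection for the eigenvalue [lam b]. *)
pose d b := (lam b - lam (~~ b))^-1.
have dn b : lam b - lam (~~ b) != 0.
  have h1 := lam_true_gt1; have h2 := lam_false_lt0.
  by case: b => /=; [rewrite gt_eqF //; lra|rewrite lt_eqF //; lra].
have dE b : d b * (lam b - lam (~~ b)) = 1 by rewrite mulVf.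
pose E b := (d b)%:C%C *: (A * F - (lam (~~ b))%:C%C *: F).
have a_E (i b : bool) : A * E b = (lam b)%:C%C *: E b.
  rewrite -scalerAr scalerA mulrC -scalerA; congr (_ *: _).
  rewrite mulrBr mulrA A2F -scalerAr scalerBr scalerA -rmorphM.
  have -> : lam b * lam (~~ b) = - c by case: (b); rewrite /= ?lam_prod // mulrC lam_prod.
  have -> : lam b = 1 - lam (~~ b).
    by rewrite -lam_sum; case: (b) => /=; ring.
  by rewrite rmorphB rmorph1 scalerBl scale1r rmorphN scaleNr opprK addrAC.
have E_star b : star (E b) = E b.
  by rewrite starZ conjC_real starB starZ conjC_real starM Fs As -AF.
have E_F b : F * E b = E b.
  rewrite -scalerAr mulrBr mulrA -AF -(mulrA A) FF -scalerAr FF.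
  by [].
have E_mul b b' : E b * E b' = if b == b' then E b else 0.
  have -> : E b * E b' = ((d b)%:C%C * ((lam b')%:C%C - (lam (~~ b))%:C%C)) *: E b'.
    rewrite {1}/E -scalerAl mulrBl -mulrA -scalerAl E_F a_E // -scalerBl scalerA.
    by [].
  rewrite -rmorphB -rmorphM; case: eqVneq => [<-|bb]; first by rewrite dE rmorph1 scale1r.
  have -> : b' = ~~ b by case: (b) (b') bb => -[].
  by rewrite subrr mulr0 rmorph0 scale0r.
have E_sum : \sum_b E b = 1 - w * S * star w.
  rewrite big_bool /= -/(base_proj w S) -FE /E /=.
  have -> : d false = - d true by rewrite /d /= -invrN opprB.
  rewrite rmorphN scaleNr -scalerBr opprB addrAC addrCA subrr addr0.
  by rewrite -scalerBl -rmorphB scalerA -rmorphM dE rmorph1 scale1r.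
(* The existence result takes a pair of diagonal elements, as the sphere requires; the single A
   fills both places. *)
have [e [oe _ eS e0 eE]] := diagonal_existence (a := fun=> A) (m := fun=> m)
  (al := fun=> lam) ST TS (fun=> sqr_ge0_lt1) (fun=> As) (fun _ _ => erefl) (fun=> Aw) a_T
  E_star E_mul E_sum a_E.
have Ae : A = dval e podles_eig by exact: (eE true).
exists e; split=> //; split=> //.
  by rewrite podles_dval_tau // -Ae.
by rewrite podles_dval_tau_shift // -Ae.
Qed.

End PodlesShift.

(** * Passing from one system of weights to another *)

Section Reweight.
Variables (R : realType).
Local Notation C := R[i].
Implicit Types (s t : didx -> R).

Definition reweight s t : didx -> C := rc (fun i => Num.sqrt (t i / s i)).

(** The square root costs nothing near 1, as |u - 1| <= |u^2 - 1| for u >= 0; the lower bound on s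
    controls the quotient t / s. *)
Lemma reweight_geo s t (ds dt : R) : geo (rc s) -> geo (rc t) ->
  0 < ds -> 0 < dt -> (forall i, ds <= s i) -> (forall i, dt <= t i) ->
  s None = 1 -> t None = 1 -> geo (reweight s t).
Proof.
move=> gs gt ds0 dt0 hs ht s1 t1; have [K [r [r01 K0 h1 h2]]] := geo2 gs gt.
exists (2 * K / ds), r; split=> // b k.
have := h1 b k; have := h2 b k; have := hs (Some (b, k)); have := ht (Some (b, k)).
rewrite /reweight /rc s1 t1 divr1 sqrtr1 -!rmorphB !nm_real.
set x := s _; set y := t _ => hy hx by1 bx1.
have x0 : 0 < x by exact: lt_le_trans hx.
have y0 : 0 < y by exact: lt_le_trans hy.
have r0 : 0 <= Num.sqrt (y / x) by exact: sqrtr_ge0.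
have r2 : Num.sqrt (y / x) ^+ 2 = y / x by rewrite sqr_sqrtr // divr_ge0 // ltW.
apply: le_trans (_ : `|y / x - 1| <= _).
  move: r0 r2; set u := Num.sqrt _ => r0 r2; rewrite -r2.
  have -> : u ^+ 2 - 1 = (u - 1) * (u + 1) by ring.
  rewrite normrM ler_peMr //; rewrite ger0_norm; first by lra.
  by rewrite addr_ge0.
have -> : y / x - 1 = (y - x) / x by field; exact: lt0r_neq0.
rewrite normrM normfV (gtr0_norm x0).
rewrite ler_pdivrMr //; apply: le_trans (_ : 2 * (K * r ^+ k) <= _).
  have -> : y - x = (y - 1) - (x - 1) by ring.
  by apply: (le_trans (ler_normB _ _)); lra.
have Kr : 0 <= K * r ^+ k by rewrite mulr_ge0 // exprn_ge0 //; case/andP: r01.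
have -> : 2 * K / ds * r ^+ k * x = 2 * (K * r ^+ k) * (x / ds) by field; exact: lt0r_neq0.
have xd : 1 <= x / ds by rewrite ler_pdivlMr // mul1r.
by rewrite ler_peMr // mulr_ge0.
Qed.

Variable Z : cstarAlgType R.
Implicit Types (w : Z) (e : bool -> nat -> Z).

Lemma ws_reweight s t w e : geo (rc s) -> geo (reweight s t) ->
  (forall i, 0 < s i) -> (forall i, 0 < t i) -> weighted_shift (rc s) w e ->
  weighted_shift (rc t) (w * dval e (reweight s t)) e.
Proof.
move=> gs gr s0 t0 h.
have -> : rc t = fun i => reweight s t i ^+ 2 * rc s i.
  apply/funext => i; rewrite /reweight /rc -rmorphXn -rmorphM /= sqr_sqrtr.
    by rewrite divfK // gt_eqF.
  by rewrite divr_ge0 // ltW.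
by apply: ws_change => // i; rewrite /reweight /rc conjC_real.
Qed.

Lemma reweightK s t w e : oproj e -> geo (reweight s t) -> geo (reweight t s) ->
  (forall i, 0 < s i) -> (forall i, 0 < t i) ->
  w * dval e (reweight s t) * dval e (reweight t s) = w.
Proof.
move=> oe gr gr' s0 t0; rewrite -mulrA -dvalM //.
rewrite (_ : (fun _ => _) = fun=> 1) ?dval_const // ?scale1r ?mulr1 //.
apply/funext => i; rewrite /reweight /rc -rmorphM -sqrtrM.
  by rewrite mulrA divfK ?gt_eqF // divff ?gt_eqF // sqrtr1 rmorph1.
by rewrite divr_ge0 // ltW.
Qed.

End Reweight.

(** * Morphisms out of a presented star-algebra *)

Section PresentationLift.
Variables (C : numClosedFieldType) (G : Type).
Variable rel : star_term C G -> star_term C G -> Prop.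
Variable nt : ~ star_cong rel TOne TZero.
Variables (Y : starAlgType C) (v : G -> Y).
Implicit Types (t u : star_term C G).

Fixpoint alg_eval t : Y :=
  match t with
  | TGen g => v g
  | TZero => 0
  | TOne => 1
  | TAdd t u => alg_eval t + alg_eval u
  | TMul t u => alg_eval t * alg_eval u
  | TScale k t => k *: alg_eval t
  | TStar t => star (alg_eval t)
  end.

Hypothesis v_rel : forall t u, rel t u -> alg_eval t = alg_eval u.

Lemma alg_eval_cong t u : star_cong rel t u -> alg_eval t = alg_eval u.
Proof.
elim=> //=.
- by move=> {}t {}u w _ -> _ ->.
- by move=> {}t t' {}u u' _ -> _ ->.
- by move=> {}t t' {}u u' _ -> _ ->.
- by move=> k {}t t' _ ->.
- by move=> {}t t' _ ->.
- by move=> *; rewrite addrA.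
- by move=> *; rewrite addrC.
- by move=> *; rewrite add0r.
- by move=> *; rewrite scaleN1r addNr.
- by move=> *; rewrite mulrA.
- by move=> *; rewrite mul1r.
- by move=> *; rewrite mulr1.
- by move=> *; rewrite mulrDl.
- by move=> *; rewrite mulrDr.
- by move=> *; rewrite scalerA.
- by move=> *; rewrite scale1r.
- by move=> *; rewrite scalerDr.
- by move=> *; rewrite scalerDl.
- by move=> *; rewrite scalerAl.
- by move=> *; rewrite scalerAr.
- by move=> *; rewrite starK.
- by move=> *; rewrite starD.
- by move=> *; rewrite starM.
- by move=> *; rewrite starZ.
Qed.

Definition pres_lift (a : star_pres nt) : Y := alg_eval (repr a).

Lemma pres_liftE t : pres_lift (pres_class nt t) = alg_eval t.
Proof. exact/alg_eval_cong/pres_reprP. Qed.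

Lemma pres_lift_linear : linear pres_lift.
Proof.
move=> k; elim/pres_ind=> t; elim/pres_ind=> u.
have -> : k *: pres_class nt t + pres_class nt u =
    pres_class nt (TAdd (TScale k t) u) by rewrite -pres_addE -pres_scaleE.
by rewrite !pres_liftE.
Qed.

Lemma pres_lift_monoid : monoid_morphism pres_lift.
Proof.
split; first by rewrite -[1]/(pres_class nt TOne) pres_liftE.
elim/pres_ind=> t; elim/pres_ind=> u.
by rewrite -[_ * _ in LHS]/(pres_mul _ _) pres_mulE !pres_liftE.
Qed.

HB.instance Definition _ := GRing.isLinear.Build C (star_pres nt) Y *:%R
  pres_lift pres_lift_linear.
HB.instance Definition _ := GRing.isMonoidMorphism.Build (star_pres nt) Y
  pres_lift pres_lift_monoid.

Definition pres_lrmorphism : {lrmorphism star_pres nt -> Y} := pres_lift.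

Lemma pres_lrmorphismE t : pres_lrmorphism (pres_class nt t) = alg_eval t.
Proof. exact: pres_liftE. Qed.

Lemma pres_lrmorphism_star : star_morphism pres_lrmorphism.
Proof.
elim/pres_ind=> t.
by rewrite -[star (pres_class nt t)]/(pres_star _) pres_starE !pres_lrmorphismE.
Qed.

End PresentationLift.

(** * Gauge action and comparison of norms *)

Section RootsOfUnity.

(** In characteristic 0 the polynomial X^n - 1 is separable, so it has n distinct roots, among which
    one is primitive. *)
Lemma prim_root_ex (C : numClosedFieldType) n :
  (0 < n)%N -> exists z : C, n.-primitive_root z.
Proof.
move=> n0; pose P : {poly C} := 'X^n - 1.
have [r Pr] := closed_field_poly_normal P.
have mP : P \is monic by exact: monicXnsubC.
rewrite (monicP mP) scale1r in Pr.
have rn : all n.-unity_root r by apply/allP => z; rewrite -root_prod_XsubC -Pr.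
have szr : (n <= size r)%N.
  by rewrite -ltnS -(size_prod_XsubC r id) -Pr size_XnsubC.
have ur : uniq r.
  rewrite -separable_prod_XsubC -Pr separable_Xn_sub_1 // pnatr_eq0 -lt0n //.
by have /hasP[z _ hz] := has_prim_root n0 rn ur szr; exists z.
Qed.

(** Orthogonality of the characters of a cyclic group: for l != k this is the geometric sum of the
    n-th root of unity u = z^l / z^k, which is not 1. *)
Lemma prim_root_sum (F : fieldType) n (z : F) (k l : 'I_n) :
  n.-primitive_root z ->
  \sum_(j < n) (z ^+ j) ^+ l / (z ^+ j) ^+ k = if l == k then n%:R else 0.
Proof.
move=> hz; have n0 : (0 < n)%N := prim_order_gt0 hz.
have z0 : z != 0.
  apply/eqP => z00; have := prim_expr_order hz; rewrite z00 expr0n gtn_eqF //.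
  by move/eqP; rewrite eq_sym oner_eq0.
pose u := z ^+ l / z ^+ k.
have E (j : 'I_n) : (z ^+ j) ^+ l / (z ^+ j) ^+ k = u ^+ j.
  by rewrite /u exprMn exprVn -!exprM ![(j * _)%N]mulnC.
rewrite (eq_bigr _ (fun j _ => E j)).
have un : u ^+ n = 1.
  by rewrite /u exprMn exprVn -!exprM ![(_ * n)%N]mulnC !exprM (prim_expr_order hz) !expr1n divr1.
have [lk|lk] := eqVneq l k.
  rewrite (eq_bigr (fun=> 1)) ?sumr_const ?card_ord // => j _.
  by rewrite /u lk divff ?expr1n // expf_neq0.
have u1 : u != 1.
  apply: contraNneq lk => /(congr1 ( *%R^~ (z ^+ k))).
  rewrite /u divfK ?expf_neq0 // mul1r => /eqP.
  by rewrite (eq_prim_root_expr hz) !modn_small.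
have := subrX1 u n; rewrite un subrr => /esym/eqP.
by rewrite mulf_eq0 subr_eq0 (negbTE u1) /= => /eqP.
Qed.

End RootsOfUnity.

Section SphereLift.
Variables (R : realType) (p q : R).
Local Notation C := R[i].
Local Notation P := (sphere_poly p q).
Local Notation cls := (pres_class (@sphere_nontrivial R p q)).

Lemma cls_rel t u : sphere_rel p q t u -> cls t = cls u.
Proof. by move=> h; apply/pres_classP/SC_rel. Qed.

Lemma sp_star1 : sp p q S_fm1 = star (sp p q S_f1).
Proof.
rewrite -[star _]/(pres_star _) pres_starE; apply/esym.
exact/cls_rel/SR_star1.
Qed.

Lemma sphere_poly_relations : sphere_relations p q (sp p q S_f1) (sp p q S_f0).
Proof.
have cD t u : cls (TAdd t u) = cls t + cls u by rewrite -[RHS]/(pres_add _ _) pres_addE.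
have cM t u : cls (TMul t u) = cls t * cls u by rewrite -[RHS]/(pres_mul _ _) pres_mulE.
have cZ k t : cls (TScale k t) = k *: cls t.
  by rewrite -[RHS]/(pres_scale _ _) pres_scaleE.
rewrite /sphere_relations -sp_star1; split.
- by rewrite -[star _]/(pres_star _) pres_starE; exact/cls_rel/SR_star0.
- by have := cls_rel (SR_m11 p q); rewrite !(cD, cM, cZ) scaleN1r.
- by have := cls_rel (SR_01 p q); rewrite !(cD, cM, cZ) scaleN1r.
- by have := cls_rel (SR_proj p q); rewrite !(cD, cM, cZ) !scaleN1r.
Qed.

Section Lift.
Variables (Y : starAlgType C) (w f0 : Y).
Hypothesis hY : sphere_relations p q w f0.

Definition sphere_val (g : sphere_gen) : Y :=
  match g with S_f1 => w | S_fm1 => star w | S_f0 => f0 end.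

Lemma sphere_val_rel t u : sphere_rel p q t u ->
  alg_eval sphere_val t = alg_eval sphere_val u.
Proof.
have [h1 h2 h3 h4] := hY.
case=> //=; rewrite ?scaleN1r //.
have := congr1 star h3; rewrite starB !starZ !starM h1 !conjC_real; exact.
Qed.

Definition sphere_lift : {lrmorphism P -> Y} :=
  pres_lrmorphism (@sphere_nontrivial R p q) sphere_val_rel.

Lemma sphere_lift_star : star_morphism sphere_lift.
Proof. exact: pres_lrmorphism_star. Qed.

Lemma sphere_lift1 : sphere_lift (sp p q S_f1) = w.
Proof. exact: pres_lrmorphismE. Qed.

Lemma sphere_lift0 : sphere_lift (sp p q S_f0) = f0.
Proof. exact: pres_lrmorphismE. Qed.

End Lift.

Lemma sphere_poly_eq (Y : starAlgType C) (f g : {lrmorphism P -> Y}) :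
  star_morphism f -> star_morphism g -> f (sp p q S_f1) = g (sp p q S_f1) ->
  f (sp p q S_f0) = g (sp p q S_f0) -> f =1 g.
Proof.
move=> fs gs e1 e0; elim/pres_ind; elim=> [[]||||||] //.
- by rewrite -[pres_class _ _]/(sp p q S_fm1) sp_star1 fs gs e1.
- by rewrite -[pres_class _ _]/(0 : P) !linear0.
- by rewrite -[pres_class _ _]/(1 : P) !rmorph1.
- move=> t ht u hu; rewrite -pres_addE -[pres_add _ _]/(cls t + cls u).
  by rewrite !linearD /= ht hu.
- move=> t ht u hu; rewrite -pres_mulE -[pres_mul _ _]/(cls t * cls u).
  by rewrite !rmorphM /= ht hu.
- move=> k t ht; rewrite -pres_scaleE -[pres_scale _ _]/(k *: cls t).
  by rewrite !linearZ /= ht.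
- by move=> t ht; rewrite -pres_starE -[pres_star _]/(star (cls t)) fs gs ht.
Qed.

Lemma gauge_relations (Y : starAlgType C) (w f0 : Y) (z : C) : z * z^* = 1 ->
  sphere_relations p q w f0 -> sphere_relations p q (z *: w) f0.
Proof.
move=> zz [h1 h2 h3 h4].
have E1 : star (z *: w) * (z *: w) = star w * w.
  by rewrite starZ -scalerAl -scalerAr scalerA mulrC zz scale1r.
have E2 : (z *: w) * star (z *: w) = w * star w.
  by rewrite starZ -scalerAl -scalerAr scalerA zz scale1r.
split=> //; rewrite ?E1 ?E2 //.
have zC k (v : Y) : k *: (z *: v) = z *: (k *: v) by rewrite !scalerA mulrC.
by rewrite -scalerAl -scalerAr !zC -scalerBr h3.
Qed.

Definition gauge z (zz : z * z^* = 1) : {lrmorphism P -> P} :=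
  sphere_lift (gauge_relations zz sphere_poly_relations).

Lemma gauge_star z (zz : z * z^* = 1) : star_morphism (gauge zz).
Proof. exact: sphere_lift_star. Qed.

(** A representation composed with a gauge automorphism is again a representation, so the left
    supremum runs over part of the right one. *)
Lemma rep_norm_gauge z (zz : z * z^* = 1) (a : P) :
  (rep_norm (gauge zz a) <= rep_norm a)%E.
Proof.
apply: ge_ereal_sup => y [H [rho [hr ->]]]; apply: ereal_sup_ubound.
exists H, (fun b => rho (gauge zz b)); split=> //; case: hr => h1 h2 h3 h4 h5.
split=> //.
- by move=> k b c x; rewrite linearD linearZ h2.
- by move=> x; rewrite rmorph1 h3.
- by move=> b c x; rewrite rmorphM h4.
- by move=> b x y'; rewrite h5 gauge_star.
Qed.

End SphereLift.

(** * Elements of gauge degree zero and normal forms *)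

Section DegreeZero.
Variables (R : realType) (p q : R).
Hypotheses (hp : 0 < p < 1) (hq : 0 < q < 1).
Local Notation C := R[i].
Local Notation P := (sphere_poly p q).
Local Notation w := (sp p q S_f1).
Local Notation f0 := (sp p q S_f0).
Local Notation x := (1 - f0).
Local Notation y := (f0 - w * star w).

(** The unital subalgebra generated by x and y. Being inductive, it lets the eigenvalue function of
    an element be built along its construction, simultaneously in two C*-algebras. *)
Inductive deg0 : P -> Prop :=
  | deg0_const k : deg0 (k *: 1)
  | deg0_x : deg0 x
  | deg0_y : deg0 y
  | deg0_add a b : deg0 a -> deg0 b -> deg0 (a + b)
  | deg0_mul a b : deg0 a -> deg0 b -> deg0 (a * b).

Let rels := sphere_diagonal (sphere_poly_relations p q) erefl erefl.

Lemma deg0_scale k a : deg0 a -> deg0 (k *: a).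
Proof.
by move=> h; rewrite -[a]mul1r scalerAl; apply: deg0_mul => //; exact: deg0_const.
Qed.

Lemma deg01 : deg0 1.
Proof. by rewrite -[1]scale1r; exact: deg0_const. Qed.

Lemma deg00 : deg0 0.
Proof. by rewrite -(scale0r 1); exact: deg0_const. Qed.

Lemma deg0_sub a b : deg0 a -> deg0 b -> deg0 (a - b).
Proof. by move=> ha hb; rewrite -scaleN1r; apply/deg0_add/deg0_scale. Qed.

Lemma deg0_f0 : deg0 f0.
Proof.
by rewrite -[f0](subKr 1); apply: deg0_sub; [exact: deg01|exact: deg0_x].
Qed.

Lemma deg0_ww : deg0 (w * star w).
Proof.
have [_ [_ _ -> _]] := rels.
apply: deg0_sub; last exact: deg0_y.
by apply: deg0_sub; [exact: deg01|exact: deg0_x].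
Qed.

Lemma deg0_wsw : deg0 (star w * w).
Proof.
have [_ [_ _ _ ->]] := rels.
apply: deg0_sub; last exact/deg0_scale/deg0_y.
by apply: deg0_sub; [exact: deg01|exact/deg0_scale/deg0_x].
Qed.

Lemma deg0_star a : deg0 a -> deg0 (star a).
Proof.
have [[xs ys _ _] _] := rels.
elim=> [k|||{}a b _ ha _ hb|{}a b _ ha _ hb].
- by rewrite starZ star1; exact: deg0_const.
- by rewrite xs; exact: deg0_x.
- by rewrite ys; exact: deg0_y.
- by rewrite starD; exact: deg0_add.
- by rewrite starM; exact: deg0_mul.
Qed.

Lemma deg0_shiftr a : deg0 a -> exists2 a', deg0 a' & a * w = w * a'.
Proof.
have [_ [xw yw _ _]] := rels.
elim=> [k|||{}a b _ [a' ha ea] _ [b' hb eb]|{}a b _ [a' ha ea] _ [b' hb eb]].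
- by exists (k *: 1); [exact: deg0_const|rewrite -scalerAl -scalerAr mul1r mulr1].
- by exists (p%:C%C *: x); [exact/deg0_scale/deg0_x|rewrite xw scalerAr].
- by exists (q%:C%C *: y); [exact/deg0_scale/deg0_y|rewrite yw scalerAr].
- by exists (a' + b'); [exact: deg0_add|rewrite mulrDl mulrDr ea eb].
- by exists (a' * b'); [exact: deg0_mul|rewrite -mulrA eb mulrA ea mulrA].
Qed.

(** The commutation rules are read backwards, w x = p^-1 x w and likewise for y, which requires p
    and q to be nonzero. *)
Lemma deg0_shiftl a : deg0 a -> exists2 a', deg0 a' & w * a = a' * w.
Proof.
have [_ [xw yw _ _]] := rels.
have hp0 : p%:C%C != 0 :> C by case/andP: hp => h _; rewrite gt_eqF // ltcR.
have hq0 : q%:C%C != 0 :> C by case/andP: hq => h _; rewrite gt_eqF // ltcR.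
elim=> [k|||{}a b _ [a' ha ea] _ [b' hb eb]|{}a b _ [a' ha ea] _ [b' hb eb]].
- by exists (k *: 1); [exact: deg0_const|rewrite -scalerAl -scalerAr mul1r mulr1].
- exists (p%:C%C^-1 *: x); first exact/deg0_scale/deg0_x.
  by rewrite -scalerAl xw scalerA mulVf // scale1r.
- exists (q%:C%C^-1 *: y); first exact/deg0_scale/deg0_y.
  by rewrite -scalerAl yw scalerA mulVf // scale1r.
- by exists (a' + b'); [exact: deg0_add|rewrite mulrDl mulrDr ea eb].
- by exists (a' * b'); [exact: deg0_mul|rewrite mulrA ea -mulrA eb mulrA].
Qed.

Lemma deg0_star_shiftl a : deg0 a -> exists2 a', deg0 a' & star w * a = a' * star w.
Proof.
move=> /deg0_star/deg0_shiftr[a' ha ea]; exists (star a'); first exact: deg0_star.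
by have := congr1 star ea; rewrite !starM starK.
Qed.

Lemma deg0_conj a : deg0 a -> deg0 (w * a * star w).
Proof.
move=> /deg0_shiftl[a' ha ->]; rewrite -mulrA.
by apply: deg0_mul => //; exact: deg0_ww.
Qed.

Lemma deg0_star_conj a : deg0 a -> deg0 (star w * a * w).
Proof.
move=> /deg0_shiftr[a' ha ea]; rewrite -mulrA ea mulrA.
by apply: deg0_mul => //; exact: deg0_wsw.
Qed.

Lemma deg0_conjX a n : deg0 a -> deg0 (w ^+ n * a * star w ^+ n).
Proof.
elim: n a => [|n IH] a ha; first by rewrite !expr0 mul1r mulr1.
rewrite exprSr exprS !mulrA -(mulrA _ w a) -(mulrA _ (w * a)).
exact/IH/deg0_conj.
Qed.

Lemma deg0_star_conjX a n : deg0 a -> deg0 (star w ^+ n * a * w ^+ n).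
Proof.
elim: n a => [|n IH] a ha; first by rewrite !expr0 mul1r mulr1.
rewrite exprSr exprS !mulrA -(mulrA _ (star w) a) -(mulrA _ (star w * a)).
exact/IH/deg0_star_conj.
Qed.

Lemma deg0_starX_shiftl a n : deg0 a ->
  exists2 a', deg0 a' & star w ^+ n * a = a' * star w ^+ n.
Proof.
elim: n a => [|n IH] a ha; first by exists a => //; rewrite expr0 mul1r mulr1.
have [b hb eb] := deg0_star_shiftl ha; have [a' ha' ea'] := IH b hb.
by exists a' => //; rewrite exprSr -mulrA eb mulrA ea' -mulrA.
Qed.

(** Terms of gauge degree from -d to d. Powers of w stand on the left and powers of w^* on the
    right; the second sum starts at exponent 1 so that degree 0 occurs once. *)
Definition nform d (a : P) : Prop := exists g h : nat -> P,
  (forall k, deg0 (g k) /\ deg0 (h k)) /\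
  a = \sum_(k < d.+1) w ^+ k * g k + \sum_(k < d) h k * star w ^+ k.+1.

Lemma nform0 d : nform d 0.
Proof.
exists (fun=> 0), (fun=> 0); split; first by split; exact: deg00.
by rewrite !big1 ?addr0 // => k _; rewrite ?mulr0 ?mul0r.
Qed.

Lemma nformD d a b : nform d a -> nform d b -> nform d (a + b).
Proof.
move=> [g [h [gh ->]]] [g' [h' [gh' ->]]].
exists (fun k => g k + g' k), (fun k => h k + h' k); split.
  by move=> k; have [? ?] := gh k; have [? ?] := gh' k; split; exact: deg0_add.
rewrite addrACA -!big_split; congr (_ + _); apply: eq_bigr => k _ /=.
  by rewrite mulrDr.
by rewrite mulrDl.
Qed.

Lemma nformZ d k a : nform d a -> nform d (k *: a).
Proof.
move=> [g [h [gh ->]]]; exists (fun j => k *: g j), (fun j => k *: h j); split.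
  by move=> j; have [? ?] := gh j; split; exact: deg0_scale.
rewrite scalerDr !scaler_sumr; congr (_ + _); apply: eq_bigr => j _ /=.
  by rewrite scalerAr.
by rewrite scalerAl.
Qed.

Lemma nform_sum d (I : Type) (s : seq I) (Q : pred I) (F : I -> P) :
  (forall i, Q i -> nform d (F i)) -> nform d (\sum_(i <- s | Q i) F i).
Proof.
move=> h; elim/big_rec: _ => [|i a Qi ha]; first exact: nform0.
by apply: nformD => //; exact: h.
Qed.

Lemma nform_w d k a : (k <= d)%N -> deg0 a -> nform d (w ^+ k * a).
Proof.
move=> kd ha; exists (fun j => if j == k then a else 0), (fun=> 0); split.
  by move=> j; split; [case: ifP => _ //|]; exact: deg00.
rewrite [X in _ + X]big1 ?addr0; last by move=> j _; rewrite mul0r.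
have kd' : (k < d.+1)%N by rewrite ltnS.
rewrite (bigD1 (Ordinal kd')) //= eqxx big1 ?addr0 // => j /negbTE jk.
by rewrite -(inj_eq val_inj) /= in jk; rewrite jk mulr0.
Qed.

Lemma nform_star d k a : (k <= d)%N -> deg0 a -> nform d (a * star w ^+ k).
Proof.
case: k => [|k] kd ha.
  by rewrite expr0 mulr1 -[a]mul1r -(expr0 w); exact: nform_w.
exists (fun=> 0), (fun j => if j == k then a else 0); split.
  by move=> j; split; [|case: ifP => _ //]; exact: deg00.
rewrite [X in X + _]big1 ?add0r; last by move=> j _; rewrite mulr0.
rewrite (bigD1 (Ordinal kd)) //= eqxx big1 ?addr0 // => j /negbTE jk.
by rewrite -(inj_eq val_inj) /= in jk; rewrite jk mul0r.
Qed.

Lemma nform_ind (d e : nat) (f : P -> P) : {morph f : a b / a + b} -> f 0 = 0 ->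
  (forall k a, (k <= d)%N -> deg0 a -> nform e (f (w ^+ k * a))) ->
  (forall k a, (k < d)%N -> deg0 a -> nform e (f (a * star w ^+ k.+1))) ->
  forall a, nform d a -> nform e (f a).
Proof.
move=> fD f0' h1 h2 a [g [h [gh ->]]]; rewrite fD !(big_morph f fD f0').
apply: nformD; apply: nform_sum => k _; have [gk hk] := gh k.
  by apply: h1 => //; rewrite -ltnS.
exact: h2.
Qed.

Lemma nform_le d e a : (d <= e)%N -> nform d a -> nform e a.
Proof.
move=> de; apply: (nform_ind (f := id)) => // k b kd hb.
  by apply: nform_w => //; exact: leq_trans de.
by apply: nform_star => //; exact: leq_trans de.
Qed.

Lemma nform_mulw d a : nform d a -> nform d.+1 (a * w).
Proof.
apply: (nform_ind (f := fun b => b * w)); rewrite ?mul0r //.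
- by move=> b c; rewrite mulrDl.
- move=> k b kd /deg0_shiftr[b' hb' eb]; rewrite -mulrA eb mulrA -exprSr.
  exact: nform_w.
- move=> k b kd hb.
  (* The last w^* meets w, and the resulting degree zero element is moved to the left of the
     remaining powers. *)
  have [c hc ec] := deg0_starX_shiftl k deg0_wsw.
  rewrite exprSr -!mulrA ec mulrA.
  by apply: nform_star; [rewrite ltnW // ltnW|exact: deg0_mul].
Qed.

Lemma nform_mulws d a : nform d a -> nform d.+1 (a * star w).
Proof.
apply: (nform_ind (f := fun b => b * star w)); rewrite ?mul0r //.
- by move=> b c; rewrite mulrDl.
- case=> [|k] b kd hb.
    by rewrite expr0 mul1r -(expr1 (star w)); exact: nform_star.
  rewrite exprSr -!mulrA; apply: nform_w; first by rewrite ltnW // ltnW.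
  by rewrite mulrA; exact: deg0_conj.
- by move=> k b kd hb; rewrite -mulrA -exprSr; exact: nform_star.
Qed.

Lemma nform_mul0 d a c : deg0 c -> nform d a -> nform d (a * c).
Proof.
move=> hc; apply: (nform_ind (f := fun b => b * c)); rewrite ?mul0r //.
- by move=> b c'; rewrite mulrDl.
- by move=> k b kd hb; rewrite -mulrA; apply: nform_w => //; exact: deg0_mul.
- move=> k b kd hb; have [c' hc' ec] := deg0_starX_shiftl k.+1 hc.
  by rewrite -mulrA ec mulrA; apply: nform_star => //; exact: deg0_mul.
Qed.

(** Multiplication by b and by its adjoint are treated together so that the induction on terms
    passes through [TStar] and through reversed products. *)
Lemma nform_degree (b : P) : exists e, forall d a, nform d a ->
  nform (d + e) (a * b) /\ nform (d + e) (a * star b).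
Proof.
have cD t u : pres_class (@sphere_nontrivial R p q) (TAdd t u) =
    (pres_class _ t : P) + pres_class _ u by rewrite -[RHS]/(pres_add _ _) pres_addE.
have cM t u : pres_class (@sphere_nontrivial R p q) (TMul t u) =
    (pres_class _ t : P) * pres_class _ u by rewrite -[RHS]/(pres_mul _ _) pres_mulE.
have cZ k t : pres_class (@sphere_nontrivial R p q) (TScale k t) =
    k *: (pres_class _ t : P) by rewrite -[RHS]/(pres_scale _ _) pres_scaleE.
have cS t : pres_class (@sphere_nontrivial R p q) (TStar t) =
    star (pres_class _ t : P) by rewrite -[RHS]/(pres_star _) pres_starE.
elim/pres_ind: b; elim=> [[]|||t [e ht] u [e' hu]|t [e ht] u [e' hu]|k t [e ht]|t [e ht]].
- exists 1%N => d a ha; rewrite addn1 -[pres_class _ _]/w.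
  by split; [exact: nform_mulw|exact: nform_mulws].
- exists 1%N => d a ha; rewrite addn1 -[pres_class _ _]/(sp p q S_fm1) sp_star1 starK.
  by split; [exact: nform_mulws|exact: nform_mulw].
- exists 0%N => d a ha; rewrite addn0 -[pres_class _ _]/f0.
  by split; apply: nform_mul0 => //; [|apply: deg0_star]; exact: deg0_f0.
- exists 0%N => d a ha; rewrite -[pres_class _ _]/(0 : P) star0 mulr0.
  by split; exact: nform0.
- exists 0%N => d a ha; rewrite addn0 -[pres_class _ _]/(1 : P) star1 mulr1.
  by split.
- exists (e + e')%N => d a ha; have [h1 h2] := ht d a ha; have [h3 h4] := hu d a ha.
  rewrite cD starD !mulrDr; split; apply: nformD.
  + by apply: nform_le h1; rewrite addnA leq_addr.
  + by apply: nform_le h3; rewrite leq_add2l leq_addl.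
  + by apply: nform_le h2; rewrite addnA leq_addr.
  + by apply: nform_le h4; rewrite leq_add2l leq_addl.
- exists (e + e')%N => d a ha; rewrite cM starM !mulrA addnA.
  have [h1 _] := ht d a ha; have [h3 _] := hu _ _ h1; split=> //.
  have [_ h5] := hu d a ha; have [_] := ht _ _ h5.
  by rewrite addnAC.
- exists e => d a ha; have [h1 h2] := ht d a ha.
  by rewrite cZ starZ -!scalerAr; split; exact: nformZ.
- exists e => d a ha; have [h1 h2] := ht d a ha.
  by rewrite cS starK; split.
Qed.

(** The degree grows at most linearly in the exponent, which is the growth that [pow2_bound_le]
    tolerates. *)
Lemma nform_pow (c : P) : exists e, forall n, nform (n * e) (c ^+ n).
Proof.
have [e he] := nform_degree c; exists e; elim=> [|n IH].
  by rewrite mul0n -[_ ^+ 0]mulr1 expr0 -(expr0 w); apply: nform_w => //; exact: deg01.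
by rewrite exprSr mulSn addnC; have [] := he _ _ IH.
Qed.

Definition gauge_morphism (f : {lrmorphism P -> P}) (z : C) : Prop :=
  [/\ z * z^* = 1, star_morphism f, f f0 = f0 & f w = z *: w].

Lemma gaugeP z (zz : z * z^* = 1) : gauge_morphism (gauge p q zz) z.
Proof.
by split=> //; [exact: gauge_star|exact: sphere_lift0|exact: sphere_lift1].
Qed.

Lemma gauge_deg0 f z a : gauge_morphism f z -> deg0 a -> f a = a.
Proof.
move=> [zz fs g0 g1]; elim=> [k|||{}a b _ ha _ hb|{}a b _ ha _ hb].
- by rewrite linearZ /= rmorph1.
- by rewrite linearB /= rmorph1 g0.
- rewrite linearB /= rmorphM /= fs g0 g1 starZ -scalerAl -scalerAr scalerA.
  by rewrite zz scale1r.
- by rewrite linearD /= ha hb.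
- by rewrite rmorphM /= ha hb.
Qed.

(** Degrees are read modulo 2d + 1: the component of degree -(j+1) is stored at index 2d - j, where
    a (2d+1)-th root of unity z acts by z^k like on the other components. *)
Lemma nform_graded d a : nform d a -> exists c : nat -> P,
  [/\ a = \sum_(k < d.+1 + d) c k,
      forall k, deg0 (star (c k) * c k) &
      forall f z k, gauge_morphism f z -> z ^+ (d.+1 + d) = 1 ->
        (k < d.+1 + d)%N -> f (c k) = z ^+ k *: c k].
Proof.
move=> [g [h [gh ->]]].
(* For d < k <= 2d the index of h is 2d - k. Beyond 2d the truncated subtraction gives 0, which is
   harmless since degree zero of c_k^* c_k holds for any coefficient. *)
exists (fun k => if (k < d.+1)%N then w ^+ k * g k
   else h (d - (k - d.+1).+1)%N * star w ^+ (d - (k - d.+1).+1).+1); split.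
- rewrite big_split_ord /=; congr (_ + _).
    by apply: eq_bigr => k _; rewrite ltn_ord.
  rewrite (reindex_inj rev_ord_inj); apply: eq_bigr => k _ /=.
  by rewrite ltnNge leq_addr /= addKn.
- move=> k; case: ifP => kd.
    have [hg _] := gh k; rewrite starM starX -mulrA (mulrA (star w ^+ k)).
    apply: deg0_mul; first exact: deg0_star.
    apply: deg0_mul => //.
    by rewrite -[X in X * _]mulr1; apply: deg0_star_conjX; exact: deg01.
  set j := (d - (k - d.+1).+1)%N.
  have [_ hh] := gh j; rewrite starM starX starK -mulrA (mulrA (star (h j))) mulrA.
  by apply: deg0_conjX; apply: deg0_mul => //; exact: deg0_star.
- move=> f z k gf zn kd; have [zz fs g0 g1] := gf.
  case: ifP => kd1.
    have [hg _] := gh k.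
    by rewrite rmorphM rmorphXn /= g1 (gauge_deg0 gf hg) exprZn scalerAl.
  set j := (d - (k - d.+1).+1)%N.
  have [_ hh] := gh j.
  rewrite rmorphM rmorphXn /= fs g1 (gauge_deg0 gf hh) starZ exprZn.
  rewrite -scalerAr; congr (_ *: _).
  have jk : (j.+1 + k = d.+1 + d)%N by rewrite /j; move: kd kd1; lia.
  rewrite -[RHS]mul1r -[X in X * _](expr1n _ j.+1) -zz exprMn.
  by rewrite mulrAC -exprD jk zn mul1r.
Qed.

End DegreeZero.

(** * Comparison of the norms on polynomials *)

Section NormComparison.
Variables (R : realType) (p q : R).
Hypotheses (hp : 0 < p < 1) (hq : 0 < q < 1).
Local Notation C := R[i].
Local Notation P := (sphere_poly p q).
Local Notation r := (par p q).
Local Notation tau := (sphere_tau p q).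

Definition sphere_gap : R := Num.min (1 - p) (1 - q).

Lemma sphere_gap_gt0 : 0 < sphere_gap.
Proof.
by case/andP: hp => _ h1; case/andP: hq => _ h2; rewrite lt_min !subr_gt0 h1.
Qed.

Lemma sphere_tau_ge i : sphere_gap <= tau i.
Proof.
have le_gap b : sphere_gap <= 1 - r b.
  by case: b; rewrite ge_min lexx ?orbT.
case: i => [[b k]|] /=.
  apply: (le_trans (le_gap b)); rewrite lerD2l lerN2.
  have /andP[r0 r1] := par_ge0_lt1 hp hq b.
  by rewrite exprS ler_piMr // exprn_ile1 // ltW.
by apply: (le_trans (le_gap true)); have /andP[r0 _] := par_ge0_lt1 hp hq true; lra.
Qed.

Lemma sphere_tau_neq0 i : rc tau i != 0.
Proof.
rewrite /rc gt_eqF // ltcR; exact: lt_le_trans sphere_gap_gt0 (sphere_tau_ge i).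
Qed.

Lemma sphere_relations_morphism (A B : starAlgType C) (f : {lrmorphism A -> B})
    (w f0 : A) : star_morphism f -> sphere_relations p q w f0 ->
  sphere_relations p q (f w) (f f0).
Proof.
move=> fs [h1 h2 h3 h4]; split.
- by rewrite -fs h1.
- by have := congr1 f h2; rewrite linearB linearD !linearZ /= !rmorphM /= fs rmorph1.
- by have := congr1 f h3; rewrite linearB !linearZ /= !rmorphM /=.
- by have := congr1 f h4; rewrite rmorphM /= !linearB /= rmorphM /= fs rmorph1 linear0.
Qed.

Lemma ws_zero (Z : cstarAlgType R) (t : didx -> C) (w : Z) e b :
  geo t -> (forall i, t i != 0) -> weighted_shift t w e -> e b 0%N = 0 ->
  forall k, e b k = 0.
Proof.
move=> gt t0 h e0; elim=> [//|k IH]; apply: (scalerI (t0 (Some (b, k)))).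
by rewrite -(ws_next b k h gt) IH mulr0 mul0r scaler0.
Qed.

Section Completion.
Variables (X : cstarAlgType R) (iota : {lrmorphism P -> X}).
Hypothesis hX : cstar_completion iota.
Local Notation w := (sp p q S_f1).
Local Notation f0 := (sp p q S_f0).

(** If one projection of a family vanished, so would its base projection and then the whole family,
    forcing x or y to be 0, which the l^2 models exclude. *)
Lemma completion_projections : exists e : bool -> nat -> X,
  [/\ weighted_shift (rc tau) (iota w) e,
      1 - iota f0 = dval e (sphere_eig p q true),
      iota f0 - iota w * star (iota w) = dval e (sphere_eig p q false) &
      forall b k, e b k != 0].
Proof.
have rel := sphere_relations_morphism (completion_star hX) (sphere_poly_relations p q).
have [e [h ex ey]] := sphere_ws hp hq rel.
exists e; split=> // b k; apply: (ws_neq0 k (sphere_tau_geo hp hq) sphere_tau_neq0 h).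
apply/eqP => e0.
have ek := ws_zero (sphere_tau_geo hp hq) sphere_tau_neq0 h e0.
have d0 : dval e (sphere_eig p q b) = 0.
  apply: dvalE; [exact: ws_oproj h|exact: sphere_eig_geo|].
  rewrite (_ : dpart _ _ = fun=> 0); first exact: ccvg_cst.
  apply/funext => n; rewrite /dpart /= scale0r add0r big1 // => -[b' j] _ /=.
  have [->|/negbTE bb] := eqVneq b' b; first by rewrite ek scaler0.
  by rewrite mulr0 subr0 rmorph0 scale0r.
case: b e0 ek d0 => _ _ d0.
  have /eqP[] := completion_x_neq0 hp hq hX.
  by rewrite linearB /= rmorph1 ex d0.
have /eqP[] := completion_y_neq0 hp hq hX.
rewrite linearB rmorphM /= sp_star1 (completion_star hX) -opprB ey d0 oppr0 //.
Qed.

Variables (Z : cstarAlgType R) (w' f0' : Z).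
Hypothesis hZ : sphere_relations p q w' f0'.
Local Notation pi := (sphere_lift hZ).

(** Both images are [dval] of one function v. In the target some projections may vanish, so the
    supremum of |v| is only an upper bound there; in the completion it is also a lower bound. *)
Lemma deg0_norm b : deg0 b -> cnorm (pi b) <= cnorm (iota b).
Proof.
move=> hb; have [e1 [h1 x1 y1 en]] := completion_projections.
have [e0 [h0 x0 y0]] := sphere_ws hp hq hZ.
have o1 := ws_oproj h1; have o0 := ws_oproj h0.
have lw : pi w = w' by exact: sphere_lift1.
have lf : pi f0 = f0' by exact: sphere_lift0.
have ls : star_morphism pi by exact: sphere_lift_star.
move: lw lf ls; move: (pi) => f lw lf ls.
have is_ := completion_star hX.
have [v [gv v0 v1]] : exists v, [/\ geo v, f b = dval e0 v & iota b = dval e1 v].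
  elim: hb => [k|||a c _ [u [gu u0 u1]] _ [v [gv v0 v1]]|
     a c _ [u [gu u0 u1]] _ [v [gv v0 v1]]].
  - exists (fun=> k); split; first exact: geo_const.
      by rewrite dval_const // linearZ /= rmorph1.
    by rewrite dval_const // linearZ /= rmorph1.
  - exists (sphere_eig p q true); split; first exact: sphere_eig_geo.
      by rewrite linearB /= rmorph1 lf.
    by rewrite linearB /= rmorph1.
  - exists (sphere_eig p q false); split; first exact: sphere_eig_geo.
      by rewrite linearB /= rmorphM /= ls lf lw.
    by rewrite linearB /= rmorphM /= is_.
  - exists (fun i => u i + v i); split; first exact: geoD.
      by rewrite linearD /= u0 v0 dvalD.
    by rewrite linearD /= u1 v1 dvalD.
  - exists (fun i => u i * v i); split; first exact: geoM.
      by rewrite rmorphM /= u0 v0 dvalM.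
    by rewrite rmorphM /= u1 v1 dvalM.
rewrite v0; apply: dval_norm => //.
(* Multiplication by a nonzero projection isolates a single eigenvalue. *)
have vb c k : nm (v (Some (c, k))) <= cnorm (iota b).
  have ep : 0 < cnorm (e1 c k) by rewrite lt_def cnorm_eq0 en cnorm_ge0.
  rewrite -(ler_pM2r ep) -cnorm_nmZ -dval_mulr // v1; exact: cnormM.
(* The index [None] has no projection of its own; its value is estimated as a limit of the
   others. *)
case=> [[c k]|] //; apply/ler_addgt0Pr => eps eps0.
have [K [rr [rr01 hK]]] := gv.
have /cvgrPdist_lt/(_ _ eps0)[N _ /(_ N (leqnn N))] := cvg_geo K rr01.
rewrite sub0r normrN => /ltr_normlW hN.
rewrite -[v None](subrK (v (Some (true, N)))) addrC (le_trans (nmD _ _)) //.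
by apply: lerD => //; rewrite -nmN opprB (le_trans (hK _ _)) // ltW.
Qed.

Lemma iota_gauge z (zz : z * z^* = 1) (a : P) :
  cnorm (iota (gauge p q zz a)) <= cnorm (iota a).
Proof.
rewrite -lee_fin !(completion_norm hX); exact: rep_norm_gauge.
Qed.

Lemma graded_norm n (c : nat -> P) : (0 < n)%N ->
  (forall f z k, gauge_morphism f z -> z ^+ n = 1 -> (k < n)%N ->
    f (c k) = z ^+ k *: c k) ->
  forall k, (k < n)%N -> cnorm (iota (c k)) <= cnorm (iota (\sum_(k < n) c k)).
Proof.
move=> n0 hc k kn; set a := \sum_(k < n) c k.
have [om hom] := @prim_root_ex C n n0.
pose k' : 'I_n := Ordinal kn.
have omn j : (om ^+ j) ^+ n = 1.
  by rewrite -exprM mulnC exprM (prim_expr_order hom) expr1n.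
have nmo j : nm (om ^+ j) = 1.
  apply/eqP; rewrite -(@pexpr_eq1 _ _ n) ?nm_ge0 //.
  by rewrite -nmX omn nm1.
have zz j : om ^+ j * (om ^+ j)^* = 1.
  by rewrite -nm_sqr nmo expr1n rmorph1.
have [F hF] : exists F : nat -> {lrmorphism P -> P}, forall j,
    gauge_morphism (F j) (om ^+ j) /\
    forall b, cnorm (iota (F j b)) <= cnorm (iota b).
  exists (fun j => gauge p q (zz j)) => j.
  by split=> [|b]; [exact: gaugeP|exact: iota_gauge].
have ga j : F j a = \sum_(l < n) (om ^+ j) ^+ l *: c l.
  rewrite linear_sum; apply: eq_bigr => l _ /=.
  by have [gj _] := hF j; rewrite (hc _ _ _ gj (omn j)).
(* Discrete Fourier inversion. There are n summands of norm at most that of a, and the n on the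
   right cancels their number. *)
have E : \sum_(j < n) ((om ^+ j) ^+ k)^-1 *: F j a = n%:R *: c k.
  under eq_bigr => j _ do rewrite ga scaler_sumr.
  rewrite exchange_big /=.
  rewrite (eq_bigr (fun l : 'I_n => (if l == k' then n%:R else 0) *: c l)).
    rewrite (bigD1 k') //= eqxx big1 ?addr0 // => l /negbTE ->.
    by rewrite scale0r.
  move=> l _; rewrite -(prim_root_sum _ _ hom) scaler_suml.
  by apply: eq_bigr => j _; rewrite scalerA mulrC.
have n0' : (0 : R) < n%:R by rewrite ltr0n.
rewrite -(ler_pM2l n0').
have -> : n%:R * cnorm (iota (c k)) = cnorm (iota (n%:R *: c k)).
  rewrite linearZ /= cnorm_nmZ -(rmorph_nat (real_complex R)) nm_real.
  by rewrite ger0_norm // ler0n.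
rewrite -E linear_sum (le_trans (cnorm_sum _ _ _)) //=.
apply: le_trans (_ : \sum_(j < n) cnorm (iota a) <= _).
  apply: ler_sum => j _; rewrite linearZ /= cnorm_nmZ.
  have -> : nm ((om ^+ j) ^+ k)^-1 = 1.
    have h : nm ((om ^+ j) ^+ k) = 1 by rewrite nmX nmo expr1n.
    have := nmM ((om ^+ j) ^+ k)^-1 ((om ^+ j) ^+ k).
    rewrite mulVf ?nm1 ?h ?mulr1 // -nm_eq0 h oner_eq0 //.
  by rewrite mul1r; have [_ ->] := hF j.
by rewrite sumr_const card_ord -[leLHS]mulr_natl.
Qed.

Lemma nform_norm d a : nform d a ->
  cnorm (pi a) <= (2 * d%:R + 1) * cnorm (iota a).
Proof.
move=> /(nform_graded hp hq)[c [aE c0 cg]].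
have hk k : (k < d.+1 + d)%N -> cnorm (pi (c k)) <= cnorm (iota a).
  move=> kn; apply: le_trans (_ : cnorm (iota (c k)) <= _); last first.
    by rewrite aE; apply: graded_norm kn.
  rewrite -(ler_pXn2r (n := 2)) ?nnegrE ?cnorm_ge0 // -!cnorm_star.
  rewrite -(sphere_lift_star hZ) -(completion_star hX) -!rmorphM.
  exact: deg0_norm.
rewrite {1}aE linear_sum (le_trans (cnorm_sum _ _ _)) //.
apply: le_trans (_ : \sum_(k < d.+1 + d) cnorm (iota a) <= _).
  by apply: ler_sum => k _; exact: hk.
rewrite sumr_const card_ord -[leLHS]mulr_natl ler_wpM2r ?cnorm_ge0 //.
by rewrite natrD -natr1; lra.
Qed.

Theorem sphere_lift_norm a : cnorm (pi a) <= cnorm (iota a).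
Proof.
rewrite -(ler_pXn2r (n := 2)) ?nnegrE ?cnorm_ge0 //.
have [e he] := nform_pow hp hq (star a * a).
(* For N = 2^j the element (a^* a)^N has degree at most N e, and the factor 2 N e + 1 is at most (2e
   + 1)(N + 1). *)
apply: (@pow2_bound_le _ _ _ (2 * e%:R + 1)); rewrite ?sqr_ge0 // => j.
have h := nform_norm (he (2 ^ j)%N).
have E (Y : cstarAlgType R) (f : {lrmorphism P -> Y}) : star_morphism f ->
    cnorm (f ((star a * a) ^+ (2 ^ j))) = (cnorm (f a) ^+ 2) ^+ (2 ^ j).
  move=> fs; rewrite rmorphXn rmorphM /= fs cnorm_star_pow2 -!exprM.
  by rewrite mulnC.
move: h; rewrite !E; [|exact: completion_star hX|exact: sphere_lift_star].
move=> h; apply: (le_trans h); apply: ler_wpM2r.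
  by rewrite exprn_ge0 // sqr_ge0.
set N := (2 ^ j)%N; have -> : (N * e)%:R = N%:R * e%:R :> R by rewrite natrM.
by rewrite -natr1; have := ler0n R e; have := ler0n R N; nra.
Qed.

End Completion.
End NormComparison.

(** * Extension to the completion, and the isomorphism *)

Section Extension.
Variables (R : realType) (P : starAlgType R[i]) (X Z : cstarAlgType R).
Variables (iota : {lrmorphism P -> X}) (f : {lrmorphism P -> Z}).
Hypothesis hX : cstar_completion iota.
Hypothesis f_star : star_morphism f.
Hypothesis f_norm : forall a, cnorm (f a) <= cnorm (iota a).

(** The graph of the extension. As one sequence of polynomials approximates on both sides, algebraic
    identities are checked by operating on that sequence. *)
Let approx (x : X) (z : Z) := exists2 a : nat -> P,
  ccvg (fun n => iota (a n)) x & ccvg (fun n => f (a n)) z.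

Lemma completion_seq (x : X) : exists2 a : nat -> P,
  ccvg (fun n => iota (a n)) x & forall n, cnorm (x - iota (a n)) < 2^-1 ^+ n.
Proof.
have d n : (0 : R) < 2^-1 ^+ n by rewrite exprn_gt0 // invr_gt0.
exists (fun n => projT1 (cid (completion_dense hX x (d n)))); last first.
  by move=> n; case: cid.
apply: (ccvg_bound (b := fun n => 1 * 2^-1 ^+ n)); last first.
  by apply: cvg_geo; apply/andP; split; lra.
by move=> n; rewrite cnormB mul1r ltW //; case: cid.
Qed.

Lemma approx_ex x : exists z, approx x z.
Proof.
have [a ax ha] := completion_seq x.
have h01 : 0 <= (2^-1 : R) < 1 by rewrite invr_ge0 ler0n invf_lt1 ?ltr1n ?ltr0n.
have [z az] : exists z, ccvg (fun n => f (a n)) z; last by exists z, a.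
(* Consecutive approximants differ by less than 2^-n + 2^-(n+1), hence the constant 2. *)
apply: (ccvg_geo_ex (K := 2) h01) => n; rewrite -rmorphB.
apply: (le_trans (f_norm _)); rewrite rmorphB /=.
rewrite -[iota _](subrK x) -addrA (le_trans (cnormD _ _)) //.
have h1 := ha n; have h2 := ha n.+1; have d0 : (0 : R) <= 2^-1 ^+ n.
  by rewrite exprn_ge0 // invr_ge0.
rewrite [cnorm (_ - x)]cnormB; move: h2; rewrite exprS.
by lra.
Qed.

Lemma approx_unique x z z' : approx x z -> approx x z' -> z = z'.
Proof.
move=> [a ax az] [b bx bz]; apply/eqP; rewrite -subr_eq0; apply/eqP.
apply: (ccvg_unique (ccvgB az bz)).
have := ccvgB ax bx; rewrite subrr /ccvg => h.
apply: (ccvg_bound (b := fun n => cnorm (iota (a n) - iota (b n) - 0))) h => n.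
by rewrite !subr0 -!rmorphB; exact: f_norm.
Qed.

Definition extension (x : X) : Z := projT1 (cid (approx_ex x)).

Lemma extensionP x : approx x (extension x).
Proof. by rewrite /extension; case: cid. Qed.

Lemma extension_eq x z : approx x z -> extension x = z.
Proof. exact/approx_unique/extensionP. Qed.

Lemma extension_linear : linear extension.
Proof.
move=> k x y; apply: extension_eq.
have [a ax az] := extensionP x; have [b bx bz] := extensionP y.
exists (fun n => k *: a n + b n).
  by under eq_fun do rewrite linearP; apply: ccvgD => //; exact: ccvgZ.
by under eq_fun do rewrite linearP; apply: ccvgD => //; exact: ccvgZ.
Qed.

Lemma extension_iota a : extension (iota a) = f a.
Proof. by apply: extension_eq; exists (fun=> a); exact: ccvg_cst. Qed.

Lemma extension_monoid : monoid_morphism extension.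
Proof.
split; first by rewrite -(rmorph1 iota) extension_iota rmorph1.
move=> x y; apply: extension_eq.
have [a ax az] := extensionP x; have [b bx bz] := extensionP y.
exists (fun n => a n * b n).
  by under eq_fun do rewrite rmorphM; exact: ccvgM.
by under eq_fun do rewrite rmorphM; exact: ccvgM.
Qed.

HB.instance Definition _ := GRing.isLinear.Build R[i] X Z *:%R
  extension extension_linear.
HB.instance Definition _ := GRing.isMonoidMorphism.Build X Z
  extension extension_monoid.

Lemma extension_star : star_morphism extension.
Proof.
move=> x; apply: extension_eq; have [a ax az] := extensionP x.
exists (fun n => star (a n)).
  by under eq_fun do rewrite (completion_star hX); exact: ccvg_star.
by under eq_fun do rewrite f_star; exact: ccvg_star.
Qed.

Lemma extension_ex : exists F : {lrmorphism X -> Z},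
  star_morphism F /\ forall a, F (iota a) = f a.
Proof.
exists (extension : {lrmorphism X -> Z}); split; first exact: extension_star.
exact: extension_iota.
Qed.

End Extension.

Lemma star_morphism_comp (C : numClosedFieldType) (X Y Z : starAlgType C)
    (f : Y -> Z) (g : X -> Y) :
  star_morphism f -> star_morphism g -> star_morphism (f \o g).
Proof. by move=> fs gs x; rewrite /= gs fs. Qed.

Theorem proposition21 (R : realType) (p q mu c : R)
  (hp : 0 < p < 1) (hq : 0 < q < 1) (hmu : `|mu| < 1) (hc : 0 < c)
  (CSpq : cstarAlgType R) (iota : {lrmorphism sphere_poly p q -> CSpq})
  (hCSpq : cstar_completion iota)
  (CSmuc : cstarAlgType R) (A B : CSmuc)
  (hCSmuc : podles_universal mu c A B) :
  cstar_isomorphic CSpq CSmuc.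
Proof.
have [hAB hU] := hCSmuc.
set ts := sphere_tau p q; set tp := podles_tau mu c.
have ts_ge := sphere_tau_ge hp hq; have tp_ge := podles_tau_ge hmu hc.
have gap_s := sphere_gap_gt0 hp hq.
have gap_p : 0 < 1 - mu ^+ 2 by have /andP[_] := sqr_ge0_lt1 hmu; rewrite subr_gt0.
have ts0 i : 0 < ts i by exact: lt_le_trans (ts_ge i).
have tp0 i : 0 < tp i by exact: lt_le_trans (tp_ge i).
have g_s : geo (rc ts) by exact: sphere_tau_geo.
have g_p : geo (rc tp) by exact: podles_tau_geo.
have g_ps : geo (reweight tp ts) by exact: (reweight_geo g_p g_s gap_p gap_s tp_ge ts_ge).
have g_sp : geo (reweight ts tp) by exact: (reweight_geo g_s g_p gap_s gap_p ts_ge tp_ge).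
have nz_s i : rc ts i != 0 by rewrite /rc gt_eqF // ltcR.
have nz_p i : rc tp i != 0 by rewrite /rc gt_eqF // ltcR.
pose sc := Num.sqrt c.
have sc0 : sc != 0 by rewrite gt_eqF // sqrtr_gt0.
have scV : sc%:C%C * (sc^-1)%:C%C = 1 :> R[i] by rewrite -rmorphM mulfV // rmorph1.
have [e0 [ws0 AE]] := podles_ws hmu hc hAB.
set w0 := _ *: star B in ws0; have o0 := ws_oproj ws0.
pose w0' := w0 * dval e0 (reweight tp ts).
have ws0' : weighted_shift (rc ts) w0' e0 by exact: ws_reweight.
have rel0 := ws_sphere hp hq ws0'.
(* The reweighted element [w0'] obeys the sphere relations inside the Podles algebra; the norm
   comparison carries the morphism from polynomials to the completion. *)
have [F [Fs Fi]] := extension_ex hCSpq (sphere_lift_star rel0)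
  (sphere_lift_norm hp hq hCSpq rel0).
have Fw : F (iota (sp p q S_f1)) = w0' by rewrite Fi sphere_lift1.
have Ff : F (iota (sp p q S_f0)) = 1 - dval e0 (sphere_eig p q true).
  by rewrite Fi sphere_lift0.
have [e1 [ws1 x1 y1 _]] := completion_projections hp hq hCSpq.
set w1 := iota (sp p q S_f1) in ws1 y1 Fw; set f1 := iota (sp p q S_f0) in x1 y1 Ff.
have o1 := ws_oproj ws1.
pose w1' := w1 * dval e1 (reweight ts tp).
have ws1' : weighted_shift (rc tp) w1' e1 by exact: ws_reweight.
have [G [[Gs GA GB] _]] := hU _ _ _ (ws_podles hmu hc ws1').
have ge i : geo (sphere_eig p q i) by exact: sphere_eig_geo.
have gpe : geo (podles_eig mu c) by exact: podles_eig_geo.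
(* Both families exhibit [w0'] as a shift with the same weights and give the same x and y, so
   uniqueness of the projections applies. *)
have Fe b k : F (e1 b k) = e0 b k.
  have wsF := morphism_ws Fs g_s ws1; rewrite Fw in wsF.
  have eig i : dval (fun b k => F (e1 b k)) (sphere_eig p q i) =
      dval e0 (sphere_eig p q i).
    rewrite -morphism_dval //; case: i; first by rewrite -x1 linearB /= rmorph1 Ff subKr.
    rewrite -y1 linearB /= rmorphM /= Fs Fw Ff (ws_Mstar ws0').
    by rewrite sphere_dval_tau_shift // opprB addrC addrA subrK addrC addKr.
  apply: (ws_unique g_s nz_s wsF ws0') => b'.
  (* The base piece b' is separated by x or y according to b': the eigenvalue is 1 on it and 0 on
     the other piece. *)
  by apply: (ws_base_unique g_s nz_s wsF ws0' (ge b') _ (eig b'));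
    rewrite //= ?eqxx ?expr0 ?mul1r ?rmorph1 ?oner_neq0 //; case: b' => /=;
    rewrite ?rmorph0 ?rmorph1 eq_sym oner_neq0.
have FeE : (fun b k => F (e1 b k)) = e0 by apply/funext => b; apply/funext => k.
have FA : F (dval e1 (podles_eig mu c)) = A by rewrite morphism_dval // FeE.
have Fw1 : F w1' = w0 by rewrite rmorphM /= Fw morphism_dval // FeE reweightK.
have FB : F (sc%:C%C *: star w1') = B.
  by rewrite linearZ /= Fs Fw1 starZ starK conjC_real scalerA scV scale1r.
have Gw : G w0 = w1'.
  rewrite linearZ /= Gs GB starZ starK conjC_real scalerA mulrC scV scale1r //.
have Ge b k : G (e0 b k) = e1 b k.
  have wsG := morphism_ws Gs g_p ws0; rewrite Gw in wsG.
  have eig : dval (fun b k => G (e0 b k)) (podles_eig mu c) =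
      dval e1 (podles_eig mu c).
    by rewrite -morphism_dval // -AE.
  apply: (ws_unique g_p nz_p wsG ws1') => b'.
  (* A alone separates both base pieces, its eigenvalues [lam true] and [lam false] being nonzero
     and of opposite signs. *)
  apply: (ws_base_unique g_p nz_p wsG ws1' gpe _ eig) => //=.
    by rewrite expr0 mul1r -(rmorph0 (real_complex R)) (inj_eq (@complexI R)) lam_neq0.
  rewrite !expr0 !mul1r (inj_eq (@complexI R)).
  have := lam_true_gt1 hc; have := lam_false_lt0 hc.
  by case: b' => /= h1 h2; [rewrite lt_eqF //|rewrite gt_eqF //]; lra.
have GeE : (fun b k => G (e0 b k)) = e1 by apply/funext => b; apply/funext => k.
(* The composite and the identity both fix A and B, and universality includes uniqueness. *)
have FGK : cancel G F.
  have [h [_ hh]] := hU _ _ _ hAB.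
  have e1' := hh (F \o G : {lrmorphism CSmuc -> CSmuc}).
  have e2' := hh (idfun : {lrmorphism CSmuc -> CSmuc}).
  move=> z; transitivity (h z); last by apply/esym/e2'.
  by apply: e1'; split=> /=; [exact: star_morphism_comp|rewrite GA|rewrite GB].
(* The completion has no universal property to invoke: the identity is checked on the generators,
   then extended by density and continuity. *)
have GFi a : G (F (iota a)) = iota a.
  have GFs := star_morphism_comp Gs (star_morphism_comp Fs (completion_star hCSpq)).
  apply: (sphere_poly_eq (f := (G \o (F \o iota)) : {lrmorphism sphere_poly p q -> CSpq})
    GFs (completion_star hCSpq)) => /=.
    by rewrite -/w1 Fw rmorphM /= Gw morphism_dval // GeE reweightK.
  by rewrite -/f1 Ff linearB /= rmorph1 morphism_dval // GeE -x1 subKr.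
exists F; split=> //; exists G => // x.
have [a ax _] := completion_seq hCSpq x.
apply: (ccvg_unique (morphism_ccvg Gs (morphism_ccvg Fs ax))).
by under eq_fun do rewrite GFi.
Qed.
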